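(* Let $P$ be a sequence of standardized trees, each with $n$ elements, and let $C\subseteq P$ be a chain of maximum size $r=\mathrm{rank}(P)$. Suppose $n\to\infty$ and $n-r=o(n^{1/2})$. Let $\mathbf e=\{e_u:u\in P\setminus C\}$ be the multiset of elevations and $\widehat{\mathbf e}=\sqrt{12}\,\mathbf e/|\mathbf e|_2$. Then for each fixed even $d\ge2$, the cumulants of $\mathcal X_P^*$ satisfy $$(\kappa_d^P)^*\sim\frac{B_d/d}{(B_2/2)^{d/2}}\left(\frac{|\mathbf e/r|_d}{|\mathbf e/r|_2}\right)^d=\frac{B_d}{d}|\widehat{\mathbf e}|_d^d.$$ The sequence $\mathcal X_P^*$ converges in distribution if and only if the multisets $\widehat{\mathbf e}$ converge pointwise to some $\mathbf t\in\mathbf P_{\mathrm{DUSTPAN}}$, in which case the limit distribution is that of $\mathcal S_{\mathbf t}+\mathcal N(0,\sigma^2)$ (independent summands) with $\sigma=\sqrt{1-|\mathbf t|_2^2/12}$. In particular, $\mathcal X_P$ is asymptotically normal if and only if $|\mathbf e/r|_2^2=\sum_{u\in P\setminus C}(e_u/r)^2\to\infty$.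
   Context: A finite poset is a forest if every element is covered by at most one element; a tree is a forest with a unique maximal element (the root). A tree is standardized if its root covers at least two elements. Hook length: $h_x=\#\{t\le_P x\}$. $\mathrm{rank}(P)$ is the maximum number of elements in a chain. $\mathcal X_P$ is the random variable with $\mathbb P(\mathcal X_P=k)=c_k/\mathcal L_P(1)$ where $\mathcal L_P(q)=[n]_q!/\prod_{u\in P}[h_u]_q=\sum c_kq^k$, $[k]_q=1+\dots+q^{k-1}$; $\kappa_d^P$ is its $d$-th cumulant and $(\kappa_d^P)^*=\kappa_d^P/(\kappa_2^P)^{d/2}$ the cumulant of the standardization $\mathcal X_P^*=(\mathcal X_P-\mu)/\sigma$. For $u\in P\setminus C$, the elevation is $e_u=\#\{v\in C:u\not\le_P v\}$. $B_d$ are Bernoulli numbers. Multisets of nonnegative reals are identified with weakly decreasing sequences padded with zeros in $\mathbb R^{\mathbb N}$; $|\mathbf t|_p=(\sum t_k^p)^{1/p}$. $\mathbf P_{\mathrm{DUSTPAN}}=\{\mathbf t=(t_1\ge t_2\ge\dots\ge0):|\mathbf t|_2^2\le12\}$. For such $\mathbf t$, $\mathcal S_{\mathbf t}=\sum_k\mathcal U[-t_k/2,t_k/2]$ with independent summands (almost surely convergent). *)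

(* Defs.v *)
From HB Require Import structures.
From mathcomp Require Import all_boot all_order all_algebra.
From mathcomp Require Import all_classical all_reals all_analysis.
From mathcomp Require Import measurable_realfun.

Set Implicit Arguments.
Unset Strict Implicit.
Unset Printing Implicit Defensive.

Import Order.TTheory GRing.Theory Num.Theory.
Import numFieldNormedType.Exports.

Local Open Scope ring_scope.

Section Posets.
Context {disp : Order.disp_t} {P : finPOrderType disp}.
Implicit Types (x y u : P) (C : {set P}).

Definition covers y x : bool :=
  (x < y)%O && [forall z : P, ~~ ((x < z)%O && (z < y)%O)].

Definition maximal x : bool := [forall y : P, ~~ (x < y)%O].

Definition is_chain C : bool := [forall x in C, forall y in C, (x >=< y)%O].

Definition hook_length x : nat := #|[set y : P | (y <= x)%O]|.

Definition elevation C u : nat := #|[set v in C | ~~ (u <= v)%O]|.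

End Posets.

Section PosetClasses.
Context {disp : Order.disp_t} (P : finPOrderType disp).

Definition is_forest : bool := [forall x : P, #|[set y : P | covers y x]| <= 1]%N.

Definition is_tree : bool := is_forest && (#|[set x : P | maximal x]| == 1%N).

Definition standardized_tree : bool :=
  is_tree && [forall x : P, maximal x ==> (2 <= #|[set y : P | covers x y]|)%N].

Definition poset_rank : nat := (\max_(C : {set P} | is_chain C) #|C|)%N.

End PosetClasses.

Section QHook.
Context (R : realType).

Definition qint (k : nat) : {poly R} := \sum_(i < k) 'X^i.

Definition qfact (n : nat) : {poly R} := \prod_(k < n) qint k.+1.

(* Euclidean quotient; the division is exact when P is a forest. *)
Definition qhook {disp : Order.disp_t} (P : finPOrderType disp) : {poly R} :=
  qfact #|P| %/ \prod_(u : P) qint (hook_length u).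

(* [:: B_0; ...; B_(m-1)], from sum_(k <= j) 'C(j+1, k) B_k = [j = 0]. *)
Fixpoint bernoulli_seq (m : nat) : seq R :=
  if m is j.+1 then
    let s := bernoulli_seq j in
    rcons s (((j == 0)%:R - \sum_(k < j) 'C(j.+1, k)%:R * s`_k) / j.+1%:R)
  else [::].

Definition bernoulli_number (d : nat) : R := (bernoulli_seq d.+1)`_d.

End QHook.

Local Open Scope classical_set_scope.

Section RandomVariables.
Context {R : realType}.

(* d-th derivative at 0 of the cumulant generating function log E[exp(sX)]. *)
Definition cumulant {d} {T : measurableType d} {P : probability T R}
    (X : {RV P >-> R}) (k : nat) : R :=
  derive1n k (fun s : R => ln (fine ('M_P X s))) 0.

Definition std_cumulant {d} {T : measurableType d} {P : probability T R}
    (X : {RV P >-> R}) (k : nat) : R :=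
  cumulant X k / (cumulant X 2) `^ (k%:R / 2).

Definition standardize {d} {T : measurableType d} {P : probability T R}
    (X : {RV P >-> R}) : {RV P >-> R} :=
  ((X \- cst (fine 'E_P[X])) \* cst (Num.sqrt (fine 'V_P[X]))^-1)%R.

Definition has_law {d} {T : measurableType d} {P : probability T R}
    (X : {RV P >-> R}) (mu : probability (measurableTypeR R) R) : Prop :=
  forall A : set (measurableTypeR R), measurable A -> P (X @^-1` A) = mu A.

Definition mutually_independent {d} {T : measurableType d}
    {P : probability T R} {I : eqType} (X : I -> {RV P >-> R}) : Prop :=
  forall (s : seq I) (A : I -> set R), uniq s ->
    (forall i, measurable (A i)) ->
    P (\bigcap_(i in [set` s]) (X i @^-1` A i)) =
    (\prod_(i <- s) P (X i @^-1` A i))%E.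

Definition independent {d} {T : measurableType d} {P : probability T R}
    (X Y : {RV P >-> R}) : Prop :=
  mutually_independent (fun b : bool => if b then X else Y).

(* The random variables may live on different probability spaces. *)
Definition cvg_in_distribution {d : nat -> measure_display}
    {T : forall N, measurableType (d N)} {P : forall N, probability (T N) R}
    (X : forall N, {RV P N >-> R}) (mu : probability (measurableTypeR R) R) : Prop :=
  forall x : R, {for x, continuous (fun y : R => mu `]-oo, y])} ->
    (fun N => cdf (X N) x) @ \oo --> mu `]-oo, x].

Definition asymptotically_normal {d : nat -> measure_display}
    {T : forall N, measurableType (d N)} {P : forall N, probability (T N) R}
    (X : forall N, {RV P N >-> R}) : Prop :=
  cvg_in_distribution (fun N => standardize (X N)) (normal_prob (0 : R) 1).

End RandomVariables.

Section Multisets.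
Context {R : realType}.
Implicit Types (t : nat -> R).

Definition lp_norm (p : nat) t : \bar R :=
  poweR (\sum_(0 <= k <oo) (t k ^+ p)%:E)%E p%:R^-1.

Definition dustpan t : Prop :=
  [/\ forall k, 0 <= t k, forall k, t k.+1 <= t k &
      (lp_norm 2 t ^+ 2 <= 12%:E)%E].

(* U[-w/2, w/2], degenerate at 0 when w = 0. *)
Definition centered_uniform (w : R) : probability (measurableTypeR R) R :=
  match pselect (- (w / 2) < w / 2) with
  | left h => uniform_prob h
  | right _ => dirac (0 : measurableTypeR R)
  end.

(* N(0, s^2) with standard deviation s; the library's normal_prob 0 0 is not
   the point mass. *)
Definition centered_normal (s : R) : probability (measurableTypeR R) R :=
  if s == 0 then (dirac (0 : measurableTypeR R) : probability _ R)
  else normal_prob (0 : R) s.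

(* mu is the law of S_t + N(0, 1 - |t|_2^2 / 12). *)
Definition dustpan_law t (mu : probability (measurableTypeR R) R) : Prop :=
  exists (d : measure_display) (T : measurableType d) (P : probability T R)
         (U : nat -> {RV P >-> R}) (S Z : {RV P >-> R}),
  [/\ mutually_independent U /\
        forall k, has_law (U k) (centered_uniform (t k)),
      {ae P, forall w, (fun m => \sum_(k < m) U k w) @ \oo --> S w},
      has_law Z (centered_normal
                   (Num.sqrt (1 - fine (lp_norm 2 t ^+ 2)%E / 12))),
      independent S Z &
      has_law ((S \+ Z)%R : {RV P >-> R}) mu].

Section Elevations.
Context {disp : Order.disp_t} {P : finPOrderType disp} (C : {set P}).

(* The multiset of elevations as a weakly decreasing, zero-padded sequence. *)
Definition elevations : nat -> R := fun k =>
  (nth 0%N (sort geq [seq elevation C u | u <- enum (~: C)]) k)%:R.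

Definition scaled_elevations : nat -> R := fun k =>
  elevations k / (poset_rank P)%:R.

Definition normalized_elevations : nat -> R := fun k =>
  Num.sqrt 12 * elevations k / fine (lp_norm 2 elevations).

End Elevations.
End Multisets.

(* Main.v *)
Require Import Defs.
From HB Require Import structures.
From mathcomp Require Import all_boot all_order all_algebra.
From mathcomp Require Import all_classical all_reals all_analysis.
From mathcomp Require Import measurable_realfun.
From mathcomp Require Import zify ring lra.

Set Implicit Arguments.
Unset Strict Implicit.
Unset Printing Implicit Defensive.

Import Order.TTheory GRing.Theory Num.Theory.
Import numFieldNormedType.Exports.

Local Open Scope ring_scope.

(** For a standardized tree with a maximal chain C, the hook lengths along C
    are the integers of {1, ..., n} other than the "gaps" f_k = e_k + (m - k),
    where e_1 >= e_2 >= ... are the elevations and m = n - r.  Hence the hook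
    generating polynomial is a quotient of products of q-integers [f_k]_q and
    [h_u]_q with u off C, so that the cumulants of X are
    (B_d / d) (sum f_k^d - sum h_u^d), and the centred characteristic function
    is the quotient of the corresponding products of sinc.  As h_u <= m,
    0 <= f_k - e_k <= m and m^2 = o(r), both are asymptotically those obtained
    with the e_k alone.

    The characteristic function of S_t + N(0, 1 - |t|_2^2 / 12) depends
    continuously on t for pointwise convergence and determines t, since the
    first index where t and t' differ produces a zero of one function that the
    other lacks.  With Levy's continuity theorem and the compactness of the
    space of sequences t (used through ultrafilters), convergence in
    distribution is equivalent to pointwise convergence of the normalized
    elevations.  Normality of the limit means t = 0, that is t_1 = 0, and the
    largest elevation is r - 1. *)

(** * Hook lengths of standardized trees *)

(** Two hypotheses meet in one error term. As the root covers two elements, some elevation equals r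
    - 1, so the elevations have power sum of order d at least (r - 1)^d. Replacing gaps by
    elevations and dropping the m off-chain hooks changes it by at most a constant times m^2 (r -
    1)^(d - 1). The relative error is a constant times m^2 / (r - 1), which n - r = o(n^(1/2)) sends
    to 0.

    Pointwise convergence of t does not preserve |t|_2; the lost mass reappears as the normal
    summand. Continuity in t therefore rests on truncations whose tail is already replaced by a
    normal of the same variance, with an error uniform in t.

    The limit laws are symmetric, so complex exponentials are avoided: E cos(x Y + th) = cos th
    phi(x) for every phase th records the cosine and sine parts together, and the phase absorbs the
    other summand when independent variables are added.

    The limit laws must also be exhibited: the independent uniforms are extracted from the binary
    digits of a single one. *)

Section QIntegers.
Context {R : realType}.

Lemma qint_horner1 k : (qint R k).[1] = k%:R.
Proof.
rewrite /qint horner_sum; under eq_bigr do rewrite hornerXn expr1n.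
by rewrite sumr_const card_ord.
Qed.

Lemma qint_neq0 k : (0 < k)%N -> qint R k != 0.
Proof.
move=> k0; apply/eqP => /(congr1 (fun p => p.[1])).
by rewrite qint_horner1 horner0 => /eqP; rewrite pnatr_eq0; case: k k0.
Qed.

Lemma qintD a b : qint R (a + b) = qint R a + 'X^a * qint R b.
Proof.
rewrite /qint big_split_ord /=; congr (_ + _).
by rewrite mulr_sumr; apply: eq_bigr => i _; rewrite exprD.
Qed.

Lemma qfactS n : qfact R n.+1 = qfact R n * qint R n.+1.
Proof. by rewrite /qfact big_ord_recr. Qed.

(** Integrality of the q-binomial coefficients, from the q-Pascal rule: the last factor [a + b] of
    the q-factorial splits as [a] + X^a [b], and each part completes one of the two smaller
    products. *)
Lemma dvdp_qfact a b : qfact R a * qfact R b %| qfact R (a + b).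
Proof.
move: {2}(a + b)%N (leqnn (a + b)) => n; elim: n a b => [|n IH] a b.
  by case: a => //; case: b => // _; rewrite /qfact !big_ord0 mulr1 dvdpp.
case: a => [|a]; first by rewrite /qfact big_ord0 mul1r dvdpp.
case: b => [|b]; first by rewrite addn0 /qfact (big_ord0 _ _ _) mulr1 dvdpp.
move=> abn.
have -> : qfact R (a.+1 + b.+1) = qfact R (a + b.+1) * qint R (a.+1 + b.+1).
  by rewrite addSn qfactS.
rewrite qintD mulrDr.
apply: dvdp_add.
- rewrite (qfactS a) mulrAC dvdp_mul// IH//; lia.
- rewrite (qfactS b) mulrA mulrCA mulrC [X in _ %| X](_ : _ = 'X^(a.+1) * (qfact R (a + b.+1) * qint R b.+1)); last by ring.
  by apply: dvdp_mull; rewrite [X in X %| _]mulrC dvdp_mul// addnS -addSn IH//; lia.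
Qed.

End QIntegers.

Section PosetFacts.
Context {disp : Order.disp_t} {P : finPOrderType disp}.
Implicit Types (x y u v w : P) (C D F : {set P}).

Lemma hook_length_gt0 u : (0 < hook_length u)%N.
Proof. by apply/card_gt0P; exists u; rewrite inE. Qed.

Lemma hook_length_lt x y : (x < y)%O -> (hook_length x < hook_length y)%N.
Proof.
move=> xy; apply: proper_card; apply/fintype.properP; split.
  by apply/fintype.subsetP => z; rewrite !inE => /le_trans; apply; exact: ltW.
by exists y; rewrite inE ?lexx// lt_geF.
Qed.

Lemma hook_length_le x : (hook_length x <= #|P|)%N.
Proof. exact: max_card. Qed.

(** An element of ]x, y] with least hook length covers x. *)
Lemma covers_exists x y : (x < y)%O -> exists2 c, covers c x & (c <= y)%O.
Proof.
move=> xy; case: (@arg_minnP _ y (fun z => (x < z)%O && (z <= y)%O) hook_length).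
  by rewrite xy lexx.
move=> c /andP[xc cy] cmin; exists c => //; apply/andP; split=> //.
apply/forallP => z; apply/negP => /andP[xz zc].
have := cmin z; rewrite xz (le_trans (ltW zc) cy) => /(_ isT).
by rewrite leqNgt hook_length_lt.
Qed.

(** Two strict upper bounds of y both lie above its unique cover, so the induction climbs the poset
    until one of them is reached. *)
Lemma forest_comparable y a b :
  is_forest P -> (y <= a)%O -> (y <= b)%O -> (a >=< b)%O.
Proof.
move=> /forallP forestP.
move: {2}(#|P| - hook_length y)%N (leqnn (#|P| - hook_length y)) => n.
elim: n y a b => [|n IH] y a b yn; rewrite le_eqVlt => /predU1P[<-|ya];
  rewrite ?[(y <= b)%O]le_eqVlt; do ?(by move=> yb; rewrite /Order.comparable le_eqVlt yb);
  move=> /predU1P[<-|yb]; do ?(by rewrite /Order.comparable (ltW ya) orbT).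
  have := hook_length_lt ya; have := hook_length_le a; lia.
have [c cy ca] := covers_exists ya.
have [c' cy' cb] := covers_exists yb.
have cc' : c = c' by have /card_le1_eqP := forestP y; apply; rewrite inE.
apply: (IH c) => //; last by rewrite cc'.
have yc : (y < c)%O by case/andP: cy.
have := hook_length_lt yc; lia.
Qed.

(** Split off the ideal D below an element m of F with largest hook length. The rest of F is again a
    down-set, because the elements above a given one form a chain, and [dvdp_qfact] combines the two
    parts. If D is all of F, then m is its top and contributes [#|F|], the last factor of the
    q-factorial. *)
Lemma dvdp_hooks (R : realType) F : is_forest P ->
  {in F, forall x y, (y <= x)%O -> y \in F} ->
  \prod_(u in F) qint R (hook_length u) %| qfact R #|F|.
Proof.
move=> forestP; move: {2}#|F| (leqnn #|F|) => n.
elim: n F => [|n IH] F Fn downF.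
  move: Fn; rewrite leqn0 cards_eq0 => /eqP ->.
  by rewrite big_set0 dvd1p.
have [->|[m0 m0F]] := set_0Vmem F; first by rewrite big_set0 dvd1p.
case: (@arg_maxnP _ m0 (mem F) hook_length m0F) => m mF mmax.
have {}mF : m \in F := mF.
have mmax' z : z \in F -> (m <= z)%O -> z = m.
  move=> zF; rewrite le_eqVlt => /predU1P[//|/hook_length_lt].
  by move=> mz; have /= := mmax z zF; lia.
pose D := [set y : P | (y <= m)%O].
have DF : D \subset F.
  by apply/fintype.subsetP => y; rewrite inE => /(downF _ mF).
have cardFD : (#|F :\: D| + #|D| = #|F|)%N.
  by rewrite -[RHS](cardsID D F) (finset.setIidPr DF) addnC.
have [FD|FD] := eqVneq (F :\: D) finset.set0.
  have FeD : F = D.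
    by apply/eqP; rewrite finset.eqEsubset DF andbT -finset.setD_eq0 FD.
  have cF : #|F| = (#|F :\ m|).+1 by rewrite (cardsD1 m F) mF.
  rewrite (big_setD1 m mF) /= {1}/hook_length -/D -FeD cF qfactS mulrC.
  rewrite dvdp_mul// IH//; first by rewrite cF in Fn.
  move=> x; rewrite !inE => /andP[xm xF] y yx; rewrite !inE; apply/andP; split; last exact: downF yx.
  apply: contraNneq xm => ym; apply/eqP/mmax' => //; by rewrite -ym.
have D0 : (0 < #|D|)%N by apply/card_gt0P; exists m; rewrite inE.
have FD0 : (0 < #|F :\: D|)%N by rewrite card_gt0.
rewrite (big_setID D) /= (finset.setIidPr DF) mulrC -cardFD.
apply: (dvdp_trans _ (dvdp_qfact _ _)); apply: dvdp_mul; apply: IH.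
- lia.
- move=> x; rewrite !inE => /andP[xm xF] y yx; rewrite !inE.
  rewrite (downF _ xF _ yx) andbT.
  apply: contra xm => ym; have := forest_comparable forestP yx ym.
  by rewrite /Order.comparable => /orP[//|/(mmax' _ xF) ->].
- lia.
- by move=> x; rewrite !inE => xm y yx; rewrite inE; exact: le_trans yx xm.
Qed.

(** The quotient defining [qhook] is exact on a forest; everything later goes through this product
    identity. *)
Lemma qhook_mul_hooks (R : realType) : is_forest P ->
  qhook R P * \prod_(u : P) qint R (hook_length u) = qfact R #|P|.
Proof.
move=> forestP; apply: divpK.
have := @dvdp_hooks R [set: P] forestP; rewrite cardsT.
by under eq_bigl do rewrite inE; apply => x _ y; rewrite !inE.
Qed.

End PosetFacts.

Section SortedDescending.
Variable (s : seq nat).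
Hypothesis s_desc : sorted geq s.

Lemma nth_desc_le k l : (k <= l)%N -> (nth 0%N s l <= nth 0%N s k)%N.
Proof.
move=> kl; have [ls|sl] := ltnP l (size s); last by rewrite (nth_default _ sl).
have geq_trans : transitive geq by move=> a b c /= ab bc; exact: leq_trans bc ab.
have := @sorted_leq_nth _ geq geq_trans leqnn 0%N s s_desc k l.
by rewrite !inE ls (leq_ltn_trans kl ls); apply.
Qed.

(** Together with [count_desc_le], this decides on which side of the k-th gap a hook length of the
    chain lies, according to the comparison of the k-th elevation with a position i in the chain. *)
Lemma count_desc_ge i k : (nth 0%N s k < i)%N ->
  (size s - k <= count (fun e => e < i)%N s)%N.
Proof.
move=> ki; rewrite -{2}(cat_take_drop k s) count_cat.
suff -> : count (fun e => e < i)%N (drop k s) = (size s - k)%N by rewrite leq_addl.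
rewrite -size_drop; apply/eqP; rewrite -all_count; apply/(all_nthP 0%N) => j _.
by rewrite nth_drop; apply: leq_ltn_trans ki; exact/nth_desc_le/leq_addr.
Qed.

Lemma count_desc_le i k : (k < size s)%N -> (i <= nth 0%N s k)%N ->
  (count (fun e => e < i)%N s < size s - k)%N.
Proof.
move=> ks ki; rewrite -{1}(cat_take_drop k.+1 s) count_cat.
have -> : count (fun e => e < i)%N (take k.+1 s) = 0%N.
  apply/eqP; rewrite -leqn0 leqNgt -has_count; apply/(has_nthP 0%N) => -[j].
  rewrite size_take_min => jk; rewrite nth_take; last by lia.
  by rewrite ltnNge => /negP; apply; apply: (leq_trans ki); apply: nth_desc_le; lia.
rewrite add0n; apply: (leq_ltn_trans (count_size _ _)); rewrite size_drop; lia.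
Qed.

End SortedDescending.

(** * Elevations and hook lengths relative to a maximum chain *)

Section StandardizedTree.
Context {disp : Order.disp_t} {P : finPOrderType disp} (C : {set P}).
Hypothesis P_std : standardized_tree P.
Hypothesis C_chain : is_chain C.
Hypothesis C_max : #|C| = poset_rank P.
Implicit Types u v w : P.

Let forestP : is_forest P.
Proof. by case/andP: P_std => /andP[]. Qed.

Lemma chain_card_le_rank (D : {set P}) : is_chain D -> (#|D| <= poset_rank P)%N.
Proof. by move=> chD; exact: (@leq_bigmax_cond _ _ (fun D : {set P} => #|D|) D). Qed.

Let chainC v w : v \in C -> w \in C -> (v >=< w)%O.
Proof. by move=> vC wC; move/forall_inP: C_chain => /(_ v vC)/forall_inP/(_ w wC). Qed.

Lemma max_chain_mem u : {in C, forall w, (u >=< w)%O} -> u \in C.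
Proof.
move=> uC; apply/negPn/negP => uNC.
have : is_chain (u |: C).
  apply/forall_inP => x; rewrite !inE => /predU1P[->|xC];
  apply/forall_inP => y; rewrite !inE => /predU1P[->|yC].
  - exact: comparablexx.
  - exact: uC.
  - by rewrite comparable_sym uC.
  - exact: chainC.
by move/chain_card_le_rank; rewrite -C_max cardsU1 uNC; lia.
Qed.

(** The ideal below u avoids C: an element y of C below u would make u comparable with all of C, by
    the forest property for the elements above y and by transitivity for those below, and u could be
    added to C. *)
Lemma off_chain_hook_le u : u \notin C -> (hook_length u <= #|~: C|)%N.
Proof.
move=> uC; apply: subset_leq_card; apply/fintype.subsetP => y; rewrite !inE => yu.
apply: contra uC => yC; apply: max_chain_mem => w wC.
have := chainC yC wC; rewrite /Order.comparable => /orP[yw|wy].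
  exact: forest_comparable forestP yu yw.
by rewrite (le_trans wy yu) orbT.
Qed.

Lemma root_exists : exists2 rt : P, (forall x, (x <= rt)%O) &
  (2 <= #|[set y | covers rt y]|)%N.
Proof.
case/andP: P_std => /andP[_ /cards1P[rt rtE]] /forallP std.
have max_rt x : maximal x -> x = rt.
  by move=> mx; have : x \in [set rt]; [rewrite -rtE inE|rewrite inE => /eqP].
exists rt; last by apply: (implyP (std rt)); have : rt \in [set rt]; [rewrite inE|rewrite -rtE inE].
move=> x; case: (@arg_maxnP _ x (fun z => (x <= z)%O) hook_length (lexx x)) => z xz zmax.
suff /max_rt <- : maximal z by [].
apply/forallP => y; apply/negP => zy.
have := zmax y (le_trans xz (ltW zy)); have := hook_length_lt zy; lia.
Qed.

Lemma poset_rank_ge2 : (2 <= poset_rank P)%N.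
Proof.
have [rt rtP rt2] := root_exists.
have /card_gt0P[y] : (0 < #|[set y | covers rt y]|)%N by lia.
rewrite inE => /andP[yrt _].
have <- : #|[set y; rt]| = 2%N by rewrite cards2 lt_eqF.
apply: chain_card_le_rank; apply/forall_inP => a; rewrite !inE => aP.
apply/forall_inP => b; rewrite !inE => bP; rewrite /Order.comparable.
by case/orP: aP => /eqP ->; case/orP: bP => /eqP ->; rewrite ?lexx ?rtP ?orbT.
Qed.

Lemma elevation_lt_rank u : (elevation C u < poset_rank P)%N.
Proof.
have [rt rtP _] := root_exists.
have rtC : rt \in C by apply: max_chain_mem => w _; rewrite /Order.comparable rtP orbT.
rewrite -C_max; apply: proper_card; apply/fintype.properP; split.
  by apply/fintype.subsetP => x; rewrite inE => /andP[].
by exists rt; rewrite ?inE ?rtC ?rtP.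
Qed.

(** Two elements covered by the root are incomparable, so one of them is off C; the only element of
    C above it is the root. *)
Lemma max_elevation : exists2 u, u \in ~: C & elevation C u = (poset_rank P).-1.
Proof.
have [rt rtP rt2] := root_exists.
have rtC : rt \in C by apply: max_chain_mem => w _; rewrite /Order.comparable rtP orbT.
have cov_inj a b : covers rt a -> covers rt b -> (a <= b)%O -> a = b.
  move=> /andP[_ /forallP /(_ b)] ca /andP[brt _].
  by rewrite le_eqVlt => /predU1P[//|ab]; move: ca; rewrite ab brt.
have [u uC urt] : exists2 u, u \in ~: C & covers rt u.
  have := rt2; case/card_gt1P => a [b []]; rewrite !inE => ca cb ab.
  have [aC|aC] := boolP (a \in C); last by exists a; rewrite ?inE.
  have [bC|bC] := boolP (b \in C); last by exists b; rewrite ?inE.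
  have := chainC aC bC; rewrite /Order.comparable => /orP[/cov_inj h|/cov_inj h].
    by move: ab; rewrite h ?eqxx.
  by move: ab; rewrite h ?eqxx.
exists u => //; rewrite -C_max (cardsD1 rt C) rtC add1n /=.
apply: eq_card => w; rewrite !inE andbC; have [->|wrt] /= := eqVneq w rt.
  by rewrite rtP.
have [wC|_] := boolP (w \in C); rewrite ?andbF// andbT.
apply/negP => uw; have wlt : (w < rt)%O by rewrite lt_neqAle wrt rtP.
case/andP: urt => _ /forallP/(_ w); rewrite wlt andbT.
have [uew|nuw] := eqVneq u w; first by move: uC; rewrite uew inE wC.
by rewrite lt_neqAle nuw uw.
Qed.

Let idx v := #|[set w in C | (w <= v)%O]|.

(** The elements of C that are not above u form an initial segment of C with e_u elements, so v is
    above u exactly when its position in C, counted from 1 at the bottom, exceeds e_u. *)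
Let below_idx u v : v \in C -> (u <= v)%O = (elevation C u < idx v)%N.
Proof.
move=> vC; have [uv|uv] := boolP (u <= v)%O; apply/esym.
  apply: proper_card; apply/fintype.properP; split.
    apply/fintype.subsetP => w; rewrite !inE => /andP[wC uw]; rewrite wC /=.
    have := chainC wC vC; rewrite /Order.comparable => /orP[//|vw].
    by rewrite (le_trans uv vw) in uw.
  by exists v; rewrite !inE ?vC ?lexx ?uv.
apply/negbTE; rewrite -leqNgt; apply: subset_leq_card; apply/fintype.subsetP => w.
rewrite !inE => /andP[wC wv]; rewrite wC /=; apply: contra uv => uw.
exact: le_trans uw wv.
Qed.

Definition desc_elevations : seq nat :=
  sort geq [seq elevation C u | u <- enum (~: C)].

Lemma size_desc_elevations : size desc_elevations = #|~: C|.
Proof. by rewrite size_sort size_map cardE. Qed.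

Lemma desc_elevations_sorted : sorted geq desc_elevations.
Proof. by apply: sort_sorted => a b; exact: leq_total. Qed.

Lemma nth_desc_elevations_lt k : (nth 0%N desc_elevations k < poset_rank P)%N.
Proof.
have r2 := poset_rank_ge2.
have [ks|?] := ltnP k (size desc_elevations); last by rewrite nth_default//; lia.
have := mem_nth 0%N ks; rewrite mem_sort => /mapP[u _ ->].
exact: elevation_lt_rank.
Qed.

Lemma nth0_desc_elevations : nth 0%N desc_elevations 0 = (poset_rank P).-1.
Proof.
have [u uC eu] := max_elevation.
have /(nthP 0%N)[j _ ej] : elevation C u \in desc_elevations.
  by rewrite mem_sort map_f// mem_enum.
have := nth_desc_elevations_lt 0; have := nth_desc_le desc_elevations_sorted (leq0n j).
rewrite ej eu; lia.
Qed.

(* The hooks along C skip exactly these values of 1..n. *)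
Definition chain_gap (k : nat) : nat :=
  (nth 0%N desc_elevations k + (#|~: C| - k))%N.

(** The second term counts the off-chain elements below v: by [below_idx] they are those whose
    elevation is less than the position of v. *)
Let hook_chain v : v \in C ->
  hook_length v = (idx v + count (fun e => e < idx v)%N desc_elevations)%N.
Proof.
move=> vC; rewrite count_sort count_map -size_filter.
have -> : [seq x <- enum (~: C) | preim [eta elevation C] (fun e : nat => (e < idx v)%N) x]
  = enum [set u in ~: C | (u <= v)%O].
  rewrite /enum_mem -filter_predI; apply: eq_filter => u /=.
  by rewrite !inE -below_idx// andbC.
rewrite -cardE /hook_length -(cardsID C) ; congr (_ + _)%N.
  by apply: eq_card => w; rewrite !inE andbC.
by apply: eq_card => w; rewrite !inE.
Qed.

(** Gaps strictly decrease with k, hook lengths strictly increase along C, and no gap is such a hook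
    length. These are n distinct numbers in {1, ..., n}, hence all of them. *)
Lemma perm_hooks_gaps :
  perm_eq ([seq chain_gap k | k <- iota 0 #|~: C|] ++
           [seq hook_length v | v <- enum C]) (iota 1 #|P|).
Proof.
have sd := desc_elevations_sorted; have szd := size_desc_elevations.
have cardP : (#|~: C| + #|C| = #|P|)%N by rewrite addnC cardsC.
have gap_lt k l : (k < l < #|~: C|)%N -> (chain_gap l < chain_gap k)%N.
  move=> kl; have kl' : (k <= l)%N by lia.
  have := nth_desc_le sd kl'; rewrite /chain_gap; lia.
set s := (_ ++ _).
have us : uniq s.
  rewrite cat_uniq; apply/and3P; split.
  - rewrite map_inj_in_uniq ?iota_uniq// => k l; rewrite !mem_iota !add0n /= => km lm kl.
    have [klt|lkt|//] := ltngtP k l.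
      by have := @gap_lt k l; rewrite klt lm kl => /(_ isT); rewrite ltnn.
    by have := @gap_lt l k; rewrite lkt km kl => /(_ isT); rewrite ltnn.
  - apply/hasPn => _ /mapP[v vC ->]; rewrite mem_enum in vC.
    apply/negP => /mapP[k]; rewrite mem_iota add0n => /= km.
    rewrite (hook_chain vC) /chain_gap.
    (* Let i be the position of v. If e_k < i, at least m - k elevations are below i and the hook
       length exceeds e_k + (m - k). If i <= e_k, fewer than m - k are, and it stays below. *)
    have [ki|ik] := ltnP (nth 0%N desc_elevations k) (idx v).
      by have := count_desc_ge sd ki; rewrite szd; lia.
    have ks : (k < size desc_elevations)%N by rewrite szd.
    by have := count_desc_le sd ks ik; rewrite szd; lia.
  - rewrite map_inj_in_uniq ?enum_uniq// => v w; rewrite !mem_enum => vC wC hvw.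
    apply/eqP/negPn/negP => vw; have := chainC vC wC.
    rewrite /Order.comparable !le_eqVlt (eq_sym w) (negbTE vw) /=.
    by case/orP => /hook_length_lt; rewrite hvw ltnn.
apply: uniq_perm => //; first exact: iota_uniq.
apply: (uniq_min_size us _ _).2; last first.
  by rewrite size_iota size_cat !size_map size_iota -cardE cardP.
move=> x; rewrite mem_cat mem_iota => /orP[/mapP[k]|/mapP[v _ ->]].
  rewrite mem_iota => /andP[_ km] ->; have := nth_desc_elevations_lt k.
  rewrite /chain_gap -C_max; lia.
by have := hook_length_gt0 v; have := hook_length_le v; lia.
Qed.

(** Gaps and hooks along C together make up the q-factorial of n, so the hooks along C cancel from
    the hook formula and only m factors remain on each side. *)
Lemma qhook_off_chain (R : realType) :
  qhook R P * \prod_(u in ~: C) qint R (hook_length u) =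
  \prod_(k < #|~: C|) qint R (chain_gap k).
Proof.
have := qhook_mul_hooks R forestP.
have -> : qfact R #|P| = \prod_(j <- iota 1 #|P|) qint R j.
  rewrite /qfact -(big_mkord predT (fun k => qint R k.+1)).
  by rewrite /index_iota subn0 (iotaDl 1 0) big_map.
rewrite -(perm_big _ perm_hooks_gaps) big_cat /= !big_map big_enum /=.
have -> : \prod_(j <- iota 0 #|~: C|) qint R (chain_gap j) =
  \prod_(k < #|~: C|) qint R (chain_gap k).
  by rewrite -(big_mkord predT (fun k => qint R (chain_gap k))) /index_iota subn0.
rewrite (bigID (mem C)) /= mulrCA mulrC => /mulIf H.
have : \prod_(v in C) qint R (hook_length v) != 0.
  by apply/prodf_neq0 => v _; rewrite qint_neq0// hook_length_gt0.
move=> /H <-; congr (_ * _); apply: eq_bigl => u; by rewrite inE.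
Qed.

End StandardizedTree.

Local Open Scope classical_set_scope.

(** * Cumulants of q-integers *)

Section Smooth.
Context {R : realType}.
Implicit Types (f g : R -> R).

(** Repeated differentiability on the whole line, with the derivatives as witnesses, so that closure
    under products and inverses is proved by plain induction. *)
Fixpoint Cn (n : nat) f : Prop :=
  if n is m.+1 then
    exists2 f', (forall x : R, is_derive x 1 f (f' x)) & Cn m f'
  else True.

Lemma is_derive1E f f' : (forall x : R, is_derive x 1 f (f' x)) -> f^`() = f'.
Proof. by move=> ff'; apply/funext => x; rewrite derive1E; have [_ ->] := ff' x. Qed.

Lemma CnS n f : Cn n.+1 f -> Cn n f.
Proof. by elim: n f => // n IH f [f' ff' /IH Cf']; exists f'. Qed.

Lemma Cn_cst n c : Cn n (cst c).
Proof.
elim: n c => // n IH c; exists (cst 0); last exact: IH.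
by move=> x; exact: is_derive_cst.
Qed.

Lemma CnD n f g : Cn n f -> Cn n g -> Cn n (f \+ g).
Proof.
elim: n f g => // n IH f g [f' ff' Cf'] [g' gg' Cg'].
exists (f' \+ g'); last exact: IH.
by move=> x; apply: is_deriveD.
Qed.

Lemma CnM n f g : Cn n f -> Cn n g -> Cn n (f \* g).
Proof.
elim: n f g => // n IH f g Cf Cg.
have [f' ff' Cf'] := Cf; have [g' gg' Cg'] := Cg.
exists ((f \* g') \+ (g \* f')).
  by move=> x; apply: is_deriveM.
by apply: CnD; apply: IH => //; exact: CnS.
Qed.

Lemma CnV n f : (forall x, f x != 0) -> Cn n f -> Cn n (fun x => (f x)^-1).
Proof.
move=> f0; elim: n => // n IH Cf; have [f' ff' Cf'] := Cf.
have CV := IH (CnS Cf).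
exists ((cst (-1) \* ((fun x => (f x)^-1) \* (fun x => (f x)^-1))) \* f').
  move=> x; have := is_deriveV (f0 x) (ff' x).
  move=> H; apply: (is_derive_eq H) => /=.
  by rewrite /GRing.scale /= expr2 invfM; ring.
by do 2!(apply: CnM => //); [exact: Cn_cst|exact: CnM].
Qed.

Lemma Cn_sum n m (F : 'I_m -> R -> R) : (forall i, Cn n (F i)) ->
  Cn n (fun x => \sum_(i < m) F i x).
Proof.
elim: m F => [|m IH] F CF.
  by under [fun x => _]funext do rewrite big_ord0; exact: Cn_cst.
under [fun x => _]funext do rewrite big_ord_recr.
by apply: CnD => //; exact: IH.
Qed.

Lemma is_derive_expRM (c x : R) : is_derive x 1 (fun s => expR (c * s)) (c * expR (c * x)).
Proof.
have H : is_derive x 1 ( *%R c) c.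
  have := @is_deriveZ R R R id c x 1 1 (is_derive_id x 1).
  by rewrite /GRing.scale /= mulr1.
have H2 := is_derive1_comp (is_derive_expR (c * x)) H.
by apply: (is_derive_eq H2); exact: mulrC.
Qed.

Lemma Cn_expR n (c : R) : Cn n (fun s => expR (c * s)).
Proof.
elim: n => // n IH; exists (cst c \* (fun s => expR (c * s))).
  by move=> x; exact: is_derive_expRM.
by apply: CnM => //; exact: Cn_cst.
Qed.

(** Dividing by the factorial turns the Leibniz rule into a Cauchy product, so that derivatives at 0
    can be computed with polynomials modulo X^N. *)
Definition taylor f (n : nat) : R := derive1n n f 0 / n`!%:R.

Lemma taylor0 f : taylor f 0 = f 0.
Proof. by rewrite /taylor fact0 divr1. Qed.

Lemma taylorS f f' n : (forall x : R, is_derive x 1 f (f' x)) ->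
  n.+1%:R * taylor f n.+1 = taylor f' n.
Proof.
move=> ff'; rewrite /taylor derive1Sn (is_derive1E ff') factS natrM.
by rewrite invfM mulrCA [X in _ * X = _]mulrA mulfV ?pnatr_eq0// mul1r.
Qed.

Lemma taylorSE f f' n : (forall x : R, is_derive x 1 f (f' x)) ->
  taylor f n.+1 = taylor f' n / n.+1%:R.
Proof.
by move=> ff'; rewrite -(taylorS n ff') mulrAC mulfV ?mul1r// pnatr_eq0.
Qed.

Lemma taylorD f g n : Cn n f -> Cn n g ->
  taylor (f \+ g) n = taylor f n + taylor g n.
Proof.
elim: n f g => [|n IH] f g; first by rewrite !taylor0.
move=> [f' ff' Cf'] [g' gg' Cg'].
have h (x : R) : is_derive x 1 (f \+ g) ((f' \+ g') x) by apply: is_deriveD.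
by rewrite (taylorSE n h) (taylorSE n ff') (taylorSE n gg') IH// mulrDl.
Qed.

Let conv (a b : nat -> R) n := \sum_(j < n.+1) a j * b (n - j)%N.

(** The rule (fg)' = f'g + fg' on coefficients: the weight n + 1 splits as j + (n + 1 - j). *)
Lemma conv_deriv (a b : nat -> R) n :
  n.+1%:R * conv a b n.+1 =
  conv (fun i => i.+1%:R * a i.+1) b n + conv a (fun i => i.+1%:R * b i.+1) n.
Proof.
have -> : n.+1%:R * conv a b n.+1 =
  \sum_(j < n.+2) (j%:R * a j) * b (n.+1 - j)%N +
  \sum_(j < n.+2) a j * ((n.+1 - j)%N%:R * b (n.+1 - j)%N).
  rewrite /conv mulr_sumr -big_split /=; apply: eq_bigr => j _.
  have -> : n.+1%:R = j%:R + (n.+1 - j)%N%:R :> R.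
    by rewrite -natrD subnKC// -ltnS.
  by ring.
congr (_ + _).
  by rewrite big_ord_recl /= mul0r mul0r add0r; apply: eq_bigr => j _.
rewrite big_ord_recr /= subnn mul0r mulr0 addr0; apply: eq_bigr => j _.
by rewrite subSn// -ltnS.
Qed.

Lemma taylorM f g n : Cn n f -> Cn n g ->
  taylor (f \* g) n = conv (taylor f) (taylor g) n.
Proof.
elim: n f g => [|n IH] f g.
  by rewrite /conv big_ord_recl big_ord0 addr0 !taylor0.
move=> Cf Cg; have [f' ff' Cf'] := Cf; have [g' gg' Cg'] := Cg.
have h (x : R) : is_derive x 1 (f \* g) (((f \* g') \+ (g \* f')) x) by apply: is_deriveM.
apply: (@mulfI _ n.+1%:R); first by rewrite pnatr_eq0.
have [Cf0 Cg0] := (CnS Cf, CnS Cg).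
rewrite (taylorS n h) taylorD; [|exact: CnM..].
rewrite conv_deriv addrC; congr (_ + _).
  have -> : g \* f' = f' \* g by apply/funext => x /=; rewrite mulrC.
  rewrite IH//; apply: eq_bigr => j _; by rewrite (taylorS j ff').
by rewrite IH//; apply: eq_bigr => j _; rewrite (taylorS (n - j) gg').
Qed.

Lemma taylor_expR (c : R) n : taylor (fun s => expR (c * s)) n = c ^+ n / n`!%:R.
Proof.
rewrite /taylor; congr (_ / _).
suff -> : derive1n n (fun s : R => expR (c * s)) = fun s => c ^+ n * expR (c * s).
  by rewrite mulr0 expR0 mulr1.
elim: n => [|n IH]; first by apply/funext => x /=; rewrite mul1r.
rewrite derive1nS IH; apply: is_derive1E => x.
have := @is_deriveZ R R R _ (c ^+ n) x 1 _ (is_derive_expRM c x).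
by move=> H; apply: (is_derive_eq H); rewrite /GRing.scale /= exprS; ring.
Qed.

Lemma taylor_cst (c : R) n : taylor (cst c) n = if n is 0 then c else 0.
Proof.
case: n => [|n]; first by rewrite taylor0.
have h (x : R) : is_derive x 1 (cst c) (cst (0 : R) x) by exact: is_derive_cst.
rewrite (taylorSE n h); elim: n {h} => [|n IH]; first by rewrite taylor0 mul0r.
have h (x : R) : is_derive x 1 (cst (0:R)) (cst (0 : R) x) by exact: is_derive_cst.
rewrite (taylorSE n h); move/eqP: IH; rewrite mulf_eq0 invr_eq0 pnatr_eq0 orbF.
by move=> /eqP ->; rewrite !mul0r.
Qed.

Definition taylor_poly N f : {poly R} := \poly_(i < N) taylor f i.

Lemma dvdXnP N (p : {poly R}) : reflect (forall i, (i < N)%N -> p`_i = 0) ('X^N %| p).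
Proof.
apply: (iffP idP) => [/dvdpP[q ->] i iN|p0].
  by rewrite coefMXn iN.
rewrite -[p](poly_take_drop N) (_ : take_poly N p = 0) ?add0r ?dvdp_mull//.
by apply/polyP => i; rewrite coef_take_poly coef0; case: ifP => // /p0.
Qed.

(** Divisibility of a difference by X^N serves as congruence of power series up to order N. *)
Lemma taylor_polyM N f g : Cn N f -> Cn N g ->
  'X^N %| taylor_poly N (f \* g) - taylor_poly N f * taylor_poly N g.
Proof.
move=> Cf Cg; apply/dvdXnP => i iN.
have [Cif Cig] : Cn i f /\ Cn i g.
  by elim: N Cf Cg iN => // N IH Cf Cg; rewrite ltnS leq_eqVlt => /predU1P[->|?];
    [split; exact: CnS|apply: IH => //; exact: CnS].
rewrite coefB coef_poly iN taylorM// coefM; apply/eqP; rewrite subr_eq0; apply/eqP.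
apply: eq_bigr => j _; rewrite !coef_poly.
by rewrite (leq_ltn_trans _ iN) ?(leq_ltn_trans _ iN)// ?leq_subr// -ltnS.
Qed.

End Smooth.

Section Bernoulli.
Context {R : realType}.
Local Notation B := (bernoulli_number R).

Lemma size_bernoulli_seq m : size (bernoulli_seq R m) = m.
Proof. by elim: m => //= m IH; rewrite size_rcons IH. Qed.

Lemma nth_bernoulli_seq m k : (k < m)%N -> (bernoulli_seq R m)`_k = B k.
Proof.
elim: m => // m IH; rewrite ltnS leq_eqVlt => /predU1P[->//|km].
by rewrite /= nth_rcons size_bernoulli_seq km IH.
Qed.

Lemma bernoulli_numberE n : B n =
  ((n == 0%N)%:R - \sum_(k < n) 'C(n.+1, k)%:R * B k) / n.+1%:R.
Proof.
rewrite {1}/bernoulli_number /= nth_rcons size_bernoulli_seq ltnn eqxx.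
by congr ((_ - _) / _); apply: eq_bigr => k _; rewrite nth_bernoulli_seq.
Qed.

Lemma bernoulli_rec n : \sum_(k < n.+1) 'C(n.+1, k)%:R * B k = (n == 0%N)%:R.
Proof.
rewrite big_ord_recr /= [B n]bernoulli_numberE.
have -> : 'C(n.+1, n) = n.+1 by rewrite -bin_sub// subSnn bin1.
by rewrite mulrCA mulfV ?pnatr_eq0// mulr1 addrC subrK.
Qed.

Lemma bernoulli1 : B 1 = - 2^-1.
Proof.
have := bernoulli_rec 1; rewrite !big_ord_recl big_ord0 /= bin0 bin1.
have := bernoulli_rec 0; rewrite !big_ord_recl big_ord0 /= bin0.
rewrite /bump /= => h1 h2; lra.
Qed.

Lemma bernoulli2 : B 2 = 6^-1.
Proof.
have := bernoulli_rec 2; rewrite !big_ord_recl big_ord0 /= /bump /=.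
have := bernoulli_rec 0; rewrite !big_ord_recl big_ord0 /= bin0.
rewrite bernoulli1 bin0 bin1 (_ : 'C(3, 2) = 3%N)// => h1 h2; lra.
Qed.

(* The exponential generating series of the Bernoulli numbers inverts
   (e^X - 1) / X. *)
Lemma bernoulli_egf N (c : R) :
  'X^N %| (\poly_(i < N) (B i * c ^+ i / i`!%:R)) *
          (\poly_(i < N) (c ^+ i / i.+1`!%:R)) - 1.
Proof.
apply/dvdXnP => n nN; rewrite coefB coefM coef1.
have -> : \sum_(j < n.+1) (\poly_(i < N) (B i * c ^+ i / i`!%:R))`_j *
   (\poly_(i < N) (c ^+ i / i.+1`!%:R))`_(n - j) =
   c ^+ n / n.+1`!%:R * \sum_(k < n.+1) 'C(n.+1, k)%:R * B k.
  rewrite mulr_sumr; apply: eq_bigr => j _; have jn : (j <= n)%N by rewrite -ltnS.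
  rewrite !coef_poly (leq_ltn_trans jn nN) (leq_ltn_trans (leq_subr _ _) nN).
  have := bin_fact (leqW jn); rewrite subSn// => /(congr1 (fun x => x%:R : R)).
  rewrite natrM [X in _ * X]natrM => <-.
  have -> : c ^+ n = c ^+ j * c ^+ (n - j) by rewrite -exprD subnKC.
  have h1 : j`!%:R != 0 :> R by rewrite pnatr_eq0 -lt0n fact_gt0.
  have h2 : (n - j).+1`!%:R != 0 :> R by rewrite pnatr_eq0 -lt0n fact_gt0.
  have h3 : 'C(n.+1, j)%:R != 0 :> R by rewrite pnatr_eq0 -lt0n bin_gt0 ltnW.
  move: h2; set z := (n - j).+1`!%:R => h2.
  by field; rewrite h1 h2 h3.
rewrite bernoulli_rec; case: n nN => [|n] _ /=; last by rewrite mulr0 subrr.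
by rewrite expr0 mulr1 divr1 subrr.
Qed.

End Bernoulli.

Section LogQint.
Context {R : realType}.
Local Notation B := (bernoulli_number R).

(** [k]_q at q = e^s: up to the factor k, the moment generating function of the uniform law on {0,
    ..., k - 1}. *)
Definition qexp (k : nat) (s : R) : R := (qint R k).[expR s].

Lemma qexpE k s : qexp k s = \sum_(i < k) expR (i%:R * s).
Proof.
rewrite /qexp /qint horner_sum; apply: eq_bigr => i _.
by rewrite hornerXn -expRM_natl mulr_natl.
Qed.

Lemma qexp_gt0 k s : (0 < k)%N -> 0 < qexp k s.
Proof.
case: k => // k _; rewrite qexpE big_ord_recl.
by apply: ltr_pwDl; rewrite ?expR_gt0// sumr_ge0// => i _; exact: expR_ge0.
Qed.

Definition qexp' (k : nat) (s : R) : R := \sum_(i < k) i%:R * expR (i%:R * s).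

Lemma is_derive_qexp k (s : R) : is_derive s 1 (qexp k) (qexp' k s).
Proof.
have -> : qexp k = \sum_(i < k) (fun s => expR (i%:R * s)).
  by apply/funext => x; rewrite qexpE fct_sumE.
by apply: is_derive_sum => i; exact: is_derive_expRM.
Qed.

Definition dlnq (k : nat) (s : R) : R := qexp' k s / qexp k s.

Lemma is_derive_ln_qexp k (s : R) : (0 < k)%N -> is_derive s 1 (fun s => ln (qexp k s)) (dlnq k s).
Proof.
move=> k0; have h1 := is_derive1_ln (qexp_gt0 s k0).
have H := is_derive1_comp h1 (is_derive_qexp k s).
by apply: (is_derive_eq H); rewrite mulrC.
Qed.

Lemma Cn_qexp n k : Cn n (qexp k).
Proof.
have -> : qexp k = fun s => \sum_(i < k) expR (i%:R * s) by apply/funext => s; exact: qexpE.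
by apply: Cn_sum => i; exact: Cn_expR.
Qed.

Lemma Cn_dlnq n k : (0 < k)%N -> Cn n (dlnq k).
Proof.
move=> k0; apply: (@CnM _ _ (qexp' k) (fun s => (qexp k s)^-1)).
  have [f ff' Cf] := Cn_qexp n.+1 k.
  suff -> : qexp' k = f by [].
  by rewrite -(is_derive1E ff') (is_derive1E (is_derive_qexp k)).
by apply: CnV; [move=> x; rewrite gt_eqF ?qexp_gt0|exact: Cn_qexp].
Qed.

(** Obtained by differentiating (e^s - 1) [k] = e^(ks) - 1. Dividing out would give the usual
    difference k e^(ks) / (e^(ks) - 1) - e^s / (e^s - 1), which is undefined at s = 0, where the
    Taylor coefficients are taken. *)
Lemma dlnq_eq k s : (0 < k)%N ->
  expR s * (expR (k%:R * s) - 1) + (expR s - 1) * (dlnq k s * (expR (k%:R * s) - 1)) =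
  k%:R * (expR (k%:R * s) * (expR s - 1)).
Proof.
move=> k0.
have geo x : (expR x - 1) * qexp k x = expR (k%:R * x) - 1.
  rewrite qexpE; under eq_bigr do rewrite expRM_natl.
  by rewrite expRM_natl subrX1.
have dgeo : expR s * qexp k s + (expR s - 1) * qexp' k s = k%:R * expR (k%:R * s).
  have h : forall x : R, is_derive x 1 (fun x => (expR x - 1) * qexp k x)
     ((expR x - 1) * qexp' k x + qexp k x * (expR x - 0)).
    move=> x; apply: (@is_deriveM _ _ (fun x => expR x - 1) (qexp k)).
    exact: is_derive_qexp.
  have h2 : forall x : R, is_derive x 1 (fun x => expR (k%:R * x) - 1) (k%:R * expR (k%:R * x) - 0).
    by move=> x; apply: is_deriveB; exact: is_derive_expRM.
  have := is_derive1E h; have := is_derive1E h2.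
  rewrite -(funext geo) => -> /(congr1 (fun f => f s)) /=.
  by rewrite !subr0 => ->; ring.
have q0 : qexp k s != 0 by rewrite gt_eqF ?qexp_gt0.
rewrite -geo /dlnq.
have -> : k%:R * (expR (k%:R * s) * (expR s - 1)) = (k%:R * expR (k%:R * s)) * (expR s - 1) by ring.
by rewrite -dgeo; field.
Qed.

(** Since x / (e^x - 1) generates the Bernoulli numbers, s times the logarithmic derivative of [k]
    at e^s equals b(ks) + ks - b(s) - s with b the Bernoulli series. The computation is carried out
    on Taylor polynomials, starting from the division-free [dlnq_eq]. *)
Lemma taylor_dlnq k d : (0 < k)%N ->
  taylor (dlnq k) d = (k%:R ^+ d.+1 - 1) * B d.+1 / d.+1`!%:R + (d == 0%N)%:R * (k%:R - 1).
Proof.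
(* One order is lost by cancelling a factor X, and the coefficient finally read off has degree d +
   1. *)
move=> k0; pose N := d.+3.
set psi := dlnq k.
(* [E c] and [b c] truncate (e^(cX) - 1) / (cX) and its inverse, the Bernoulli series at cX. *)
pose E (c : R) : {poly R} := \poly_(i < N) (c ^+ i / i.+1`!%:R).
pose b (c : R) : {poly R} := \poly_(i < N) (B i * c ^+ i / i`!%:R).
pose em (c : R) (s : R) := expR (c * s) + cst (-1) s.
have Cem n c : Cn n (em c) by apply: CnD; [exact: Cn_expR|exact: Cn_cst].
have Te c : 'X^N %| taylor_poly N (fun s => expR (c * s)) - (1 + c *: ('X * E c)).
  apply/dvdXnP => i iN; rewrite coefB coef_poly iN taylor_expR coefD coef1 coefZ coefXM.
  case: i iN => [|i] iN /=; first by rewrite mulr0 addr0 expr0 fact0 divr1 subrr.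
  by rewrite add0r coef_poly (ltnW iN) exprS mulrA subrr.
have Tem c : 'X^N %| taylor_poly N (em c) - c *: ('X * E c).
  apply/dvdXnP => i iN; rewrite coefB coef_poly iN /em taylorD; [|exact: Cn_expR|exact: Cn_cst].
  rewrite taylor_expR taylor_cst coefZ coefXM.
  case: i iN => [|i] iN /=; first by rewrite mulr0 expr0 fact0 divr1 subrr subr0.
  by rewrite addr0 coef_poly (ltnW iN) exprS mulrA subrr.
pose kr : R := k%:R.
have Cpsi n : Cn n psi by exact: Cn_dlnq.
have fid : (fun s => expR (1 * s)) \* em kr \+ em 1 \* (psi \* em kr) =
  cst kr \* ((fun s => expR (kr * s)) \* em 1).
  by apply/funext => s /=; rewrite /em /= !mul1r; exact: dlnq_eq.
pose T := @taylor_poly R N.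
have TD f g : Cn N f -> Cn N g -> 'X^N %| T (f \+ g) - (T f + T g).
  move=> Cf Cg; apply/dvdXnP => i iN; rewrite coefB coefD !coef_poly iN.
  have Ci h : Cn N h -> Cn i h.
    by elim: (N) iN h => // M IH; rewrite ltnS leq_eqVlt => /predU1P[->|iM] h Ch; [exact: CnS|apply: IH => //; exact: CnS].
  by rewrite taylorD ?subrr//; exact: Ci.
have Tc : T (cst kr) = kr%:P.
  by apply/polyP => i; rewrite coef_poly taylor_cst coefC; case: i => // i; case: ifP.
have eqmP (p q : {poly R}) : p = q -> 'X^N %| p - q by move=> ->; rewrite subrr dvdp0.
have eqm_sym (p q : {poly R}) : 'X^N %| p - q -> 'X^N %| q - p by rewrite -dvdpNr opprB.
have eqm_trans (p q r : {poly R}) : 'X^N %| p - q -> 'X^N %| q - r -> 'X^N %| p - r.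
  by move=> pq qr; rewrite -[p - r](subrKA q) dvdp_add.
have eqmM (p q p' q' : {poly R}) : 'X^N %| p - p' -> 'X^N %| q - q' -> 'X^N %| p * q - p' * q'.
  move=> pp qq; rewrite (_ : _ - _ = (p - p') * q + p' * (q - q')); last by ring.
  by apply: dvdp_add; [exact: dvdp_mulr|exact: dvdp_mull].
have eqmD (p q p' q' : {poly R}) : 'X^N %| p - p' -> 'X^N %| q - q' -> 'X^N %| (p + q) - (p' + q').
  by move=> pp qq; rewrite opprD addrACA dvdp_add.
have key : 'X^N %| ((1 + 1 *: ('X * E 1)) * (kr *: ('X * E kr))
    + (1 *: ('X * E 1)) * (T psi * (kr *: ('X * E kr))))
    - kr%:P * ((1 + kr *: ('X * E kr)) * (1 *: ('X * E 1))).
  have lhs : 'X^N %| T ((fun s => expR (1 * s)) \* em kr \+ em 1 \* (psi \* em kr)) -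
      ((1 + 1 *: ('X * E 1)) * (kr *: ('X * E kr))
        + (1 *: ('X * E 1)) * (T psi * (kr *: ('X * E kr)))).
    apply: (eqm_trans _ _ _); first by apply: TD; do ?apply: CnM => //; exact: Cn_expR.
    apply: (eqmD _ _ _ _).
      apply: (eqm_trans _ _ _); first by apply: taylor_polyM => //; exact: Cn_expR.
      by apply: (eqmM _ _ _ _).
    apply: (eqm_trans _ _ _); first by apply: taylor_polyM => //; exact: CnM.
    apply: (eqmM _ _ _ _) => //.
    apply: (eqm_trans _ _ _); first exact: taylor_polyM.
    by apply: (eqmM _ _ _ _) => //; exact: (eqmP _ _).
  have rhs : 'X^N %| T (cst kr \* ((fun s => expR (kr * s)) \* em 1)) -
      kr%:P * ((1 + kr *: ('X * E kr)) * (1 *: ('X * E 1))).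
    apply: (eqm_trans _ _ _).
      by apply: taylor_polyM; [exact: Cn_cst|apply: CnM => //; exact: Cn_expR].
    apply: (eqmM _ _ _ _); first by apply: (eqmP _ _).
    apply: (eqm_trans _ _ _); first by apply: taylor_polyM => //; exact: Cn_expR.
    by apply: (eqmM _ _ _ _).
  rewrite fid in lhs; exact: (eqm_trans _ _ _ (eqm_sym _ _ lhs) rhs).
(* What is left of [key] after division by kr X. *)
pose W : {poly R} := E kr + 'X * (E 1 * E kr) + 'X * (E 1 * E kr * T psi) - E 1 - kr *: ('X * (E kr * E 1)).
have kr0 : kr != 0 by rewrite pnatr_eq0 -lt0n.
have W0 : 'X^(d.+2) %| W.
  move: key; rewrite (_ : _ - _ = kr *: ('X * W)); last first.
    by rewrite /W -!mul_polyC polyC1; ring.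
  by rewrite dvdpZr// exprS dvdp_mul2l ?polyX_eq0.
have dN : ('X^(d.+2) : {poly R}) %| 'X^N by rewrite [X in _ %| X]exprS dvdp_mull.
have b1 := dvdp_trans dN (bernoulli_egf N (1 : R)).
have bk := dvdp_trans dN (bernoulli_egf N kr).
rewrite -/(E 1) -/(b 1) in b1; rewrite -/(E kr) -/(b kr) in bk.
(* Multiplying W by [b 1 * b kr] removes [E 1] and [E kr], which are inverse to these factors at
   this order. *)
have fin : 'X^(d.+2) %| b 1 + 'X + 'X * T psi - b kr - kr *: 'X.
  have -> : b 1 + 'X + 'X * T psi - b kr - kr *: 'X =
    b 1 * b kr * W
    - (b kr * E kr - 1) * (b 1 + 'X * (b 1 * E 1) + 'X * (b 1 * E 1 * T psi) - kr *: ('X * (b 1 * E 1)))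
    + (b 1 * E 1 - 1) * (b kr - 'X - 'X * T psi + kr *: 'X).
    by rewrite /W -!mul_polyC; ring.
  by apply: dvdp_add; [apply: dvdp_sub; [exact: dvdp_mull|exact: dvdp_mulr]|exact: dvdp_mulr].
move/dvdXnP: fin => /(_ d.+1 (ltnSn _)).
rewrite !(coefB, coefD, coefN, coefXM, coefZ, coefX) /= !coef_poly.
have -> : (d.+1 < N)%N by rewrite /N; lia.
have -> : (d < N)%N by rewrite /N; lia.
rewrite eqSS expr1n mulr1 -/kr => h.
have -> : taylor psi d = B d.+1 * kr ^+ d.+1 / d.+1`!%:R - B d.+1 / d.+1`!%:R - (d == 0%N)%:R + kr * (d == 0%N)%:R.
  by apply/eqP; rewrite -subr_eq0 -[X in _ == X]h; apply/eqP; ring.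
by ring.
Qed.

End LogQint.

(** * Characteristic functions *)

Section Sinc.
Context {R : realType}.
Implicit Types (x y z : R).

(** Used to integrate inequalities from 0: each polynomial bound below for sine or cosine is the
    previous one integrated, up to [sin_le]. *)
Lemma ge0_derive_le (f df : R -> R) (a b : R) : a <= b ->
  (forall x : R, a <= x -> is_derive x 1 f (df x)) ->
  (forall x, a <= x -> 0 <= df x) -> f a <= f b.
Proof.
move=> ab fdf df0; rewrite -subr_ge0.
have fdf' x : x \in `]a, b[%R -> is_derive x 1 f (df x).
  by rewrite in_itv /= => /andP[ax _]; apply: fdf; exact: ltW.
have cf : {within `[a, b], continuous f}.
  apply: derivable_within_continuous => x; rewrite in_itv /= => /andP[ax _].
  by case: (fdf x ax).
have [c] := MVT_segment ab fdf' cf.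
rewrite in_itv /= => /andP[ac _] ->.
by rewrite mulr_ge0 ?subr_ge0// df0.
Qed.

Lemma sin_le_id y : 0 <= y -> sin y <= y.
Proof.
move=> y0; have := @ge0_derive_le (fun x => x - sin x) (fun x => 1 - cos x) 0 y y0.
rewrite /= sin0 subr0 => h; rewrite -subr_ge0; apply: h => x _.
by rewrite subr_ge0 cos_le1.
Qed.

Lemma is_derive_pow (n : nat) x : is_derive x 1 (fun x : R => x ^+ n.+1) (n.+1%:R * x ^+ n).
Proof.
have H := @is_deriveX R _ id n.+1 x 1 1 (is_derive_id x 1).
have -> : (fun x : R => x ^+ n.+1) = id ^+ n.+1 by apply/funext => u; rewrite exprfctE.
by apply: (is_derive_eq H); rewrite /GRing.scale /= mulr1.
Qed.

Lemma is_derive_powM (c : R) (n : nat) x :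
  is_derive x 1 (fun x : R => c * x ^+ n.+1) (c * (n.+1%:R * x ^+ n)).
Proof. exact: (@is_deriveZ R R R _ c x 1 _ (is_derive_pow n x)). Qed.

Lemma cos_ge y : 0 <= y -> 1 - 2^-1 * y ^+ 2 <= cos y.
Proof.
move=> y0; have := @ge0_derive_le (fun x => cos x + 2^-1 * x ^+ 2)
  (fun x => - sin x + 2^-1 * (2 * x ^+ 1)) 0 y y0.
rewrite /= cos0 expr0n /= mulr0 addr0 => h.
have {}h : 1 <= cos y + 2^-1 * y ^+ 2.
  apply: h => x x0; first by apply: is_deriveD; exact: is_derive_powM.
  by have := sin_le_id x0; lra.
lra.
Qed.

Lemma sin_ge y : 0 <= y -> y - 6^-1 * y ^+ 3 <= sin y.
Proof.
move=> y0; have := @ge0_derive_le (fun x => (sin x - x) + 6^-1 * x ^+ 3)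
  (fun x => (cos x - 1) + 6^-1 * (3 * x ^+ 2)) 0 y y0.
rewrite /= sin0 expr0n /= mulr0 addr0 subr0 => h.
have {}h : 0 <= (sin y - y) + 6^-1 * y ^+ 3.
  apply: h => x x0; first by apply: is_deriveD; exact: is_derive_powM.
  by have := cos_ge x0; lra.
lra.
Qed.

Lemma cos_le y : 0 <= y -> cos y <= 1 - 2^-1 * y ^+ 2 + 24^-1 * y ^+ 4.
Proof.
move=> y0; have := @ge0_derive_le (fun x => (- cos x - 2^-1 * x ^+ 2) + 24^-1 * x ^+ 4)
  (fun x => (- - sin x - 2^-1 * (2 * x ^+ 1)) + 24^-1 * (4 * x ^+ 3)) 0 y y0.
rewrite /= cos0 !expr0n /= !mulr0 addr0 subr0 => h.
have {}h : - 1 <= (- cos y - 2^-1 * y ^+ 2) + 24^-1 * y ^+ 4.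
  apply: h => x x0; first by apply: is_deriveD; [apply: is_deriveB; exact: is_derive_powM|exact: is_derive_powM].
  by have := sin_ge x0; lra.
lra.
Qed.

Lemma sin_le y : 0 <= y -> sin y <= y - 6^-1 * y ^+ 3 + 120^-1 * y ^+ 5.
Proof.
move=> y0; have := @ge0_derive_le (fun x => ((x - sin x) - 6^-1 * x ^+ 3) + 120^-1 * x ^+ 5)
  (fun x => ((1 - cos x) - 6^-1 * (3 * x ^+ 2)) + 120^-1 * (5 * x ^+ 4)) 0 y y0.
rewrite /= sin0 !expr0n /= !mulr0 addr0 !subr0 => h.
have {}h : 0 <= ((y - sin y) - 6^-1 * y ^+ 3) + 120^-1 * y ^+ 5.
  apply: h => x x0; first by apply: is_deriveD; [apply: is_deriveB; exact: is_derive_powM|exact: is_derive_powM].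
  by have := cos_le x0; lra.
lra.
Qed.

(** [sinc (w * x / 2)] is the characteristic function at x of the uniform law on [-w/2, w/2]. *)
Definition sinc y : R := if y == 0 then 1 else sin y / y.

Lemma sinc0 : sinc 0 = 1. Proof. by rewrite /sinc eqxx. Qed.

Lemma sincM y : sinc y * y = sin y.
Proof.
rewrite /sinc; case: eqVneq => [->|y0]; first by rewrite sin0 mulr0.
by rewrite divfK.
Qed.

Lemma sincN y : sinc (- y) = sinc y.
Proof. by rewrite /sinc oppr_eq0; case: eqVneq => // _; rewrite sinN invrN mulrNN. Qed.

Lemma sinc_norm y : sinc `|y| = sinc y.
Proof. by case: ger0P => // _; rewrite sincN. Qed.

Lemma sinc_ge y : 1 - 6^-1 * y ^+ 2 <= sinc y.
Proof.
rewrite -sinc_norm -real_normK ?num_real//; have := normr_ge0 y; move: `|y| => {}y.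
rewrite le_eqVlt => /predU1P[<-|y0]; first by rewrite sinc0 expr0n /= mulr0 subr0.
rewrite /sinc gt_eqF// ler_pdivlMr//; have := sin_ge (ltW y0); lra.
Qed.

Lemma sinc_le y : sinc y <= 1 - 6^-1 * y ^+ 2 + 120^-1 * y ^+ 4.
Proof.
rewrite -sinc_norm -real_normK ?num_real//.
have -> : y ^+ 4 = `|y| ^+ 4 by rewrite -[4%N]/(2 * 2)%N !exprM real_normK ?num_real.
have := normr_ge0 y; move: `|y| => {}y.
rewrite le_eqVlt => /predU1P[<-|y0]; first by rewrite sinc0 !expr0n /= !mulr0 subr0 addr0.
rewrite /sinc gt_eqF// ler_pdivrMr//; have := sin_le (ltW y0); lra.
Qed.

Lemma sinc_abs_le1 y : `|sinc y| <= 1.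
Proof.
rewrite -sinc_norm; have := normr_ge0 y; move: `|y| => {}y.
rewrite le_eqVlt => /predU1P[<-|y0]; first by rewrite sinc0 normr1.
rewrite /sinc gt_eqF// normf_div (gtr0_norm y0) ler_pdivrMr// mul1r.
rewrite ler_norml; apply/andP; split; last by apply: sin_le_id; exact: ltW.
have [y1|y1] := leP 1 y; first by have := sin_geN1 y; lra.
have := sin_ge (ltW y0) => h; apply: le_trans h.
have : y ^+ 3 <= y by rewrite exprS ger_pMr// exprn_ile1// ltW.
lra.
Qed.

Lemma sinc_gt0 y : `|y| < pi -> 0 < sinc y.
Proof.
rewrite -sinc_norm; have := normr_ge0 y; move: `|y| => {}y.
rewrite le_eqVlt => /predU1P[<-|y0] ypi; first by rewrite sinc0.
by rewrite /sinc gt_eqF// divr_gt0// sin_gt0_pi// y0.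
Qed.

Lemma sinc_pi : sinc pi = 0.
Proof. by rewrite /sinc gt_eqF ?pi_gt0// sinpi mul0r. Qed.

Lemma expRN_le z : 0 <= z -> expR (- z) <= 1 - z + 2^-1 * z ^+ 2.
Proof.
move=> z0.
have := @ge0_derive_le (fun x => (x - 2^-1 * x ^+ 2) * -1 + - expR (-1 * x))
  (fun x => (1 - 2^-1 * (2 * x ^+ 1)) * -1 + - (-1 * expR (-1 * x))) 0 z z0.
rewrite /= !mulr0 expR0 expr0n /= mulr0 subr0 mul0r add0r mulN1r => h.
have {}h : - 1 <= (z - 2^-1 * z ^+ 2) * -1 + - expR (- z).
  apply: h => x x0; last first.
    by rewrite !mulN1r; have := expR_ge1Dx (- x); lra.
  have H1 : is_derive x 1 ( *%R (-1)) (-1 : R).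
    have := @is_deriveZ R R R id (-1) x 1 1 (is_derive_id x 1).
    by rewrite /GRing.scale /= mulr1.
  have H2 := is_derive1_comp (is_derive_expR (-1 * x)) H1.
  have H3 := @is_deriveB R R R _ _ x 1 _ _ (is_derive_id x 1) (is_derive_powM 2^-1 1 x).
  have H4 := @is_deriveZ R R R _ (-1) x 1 _ H3.
  have H5 := @is_deriveB R R R _ _ x 1 _ _ H4 H2.
  have E : (fun x => (x - 2^-1 * x ^+ 2) * -1 + - expR (-1 * x)) =
     (-1 \*: (id - (fun x : R => 2^-1 * x ^+ 2)) - (expR \o *%R (-1))).
    by apply/funext => u; rewrite /GRing.scale /= !fctE /= mulrC.
  rewrite E; apply: (is_derive_eq H5).
  by rewrite /GRing.scale /=; ring.
lra.
Qed.

(** The exponential is the characteristic function of the normal law with the same variance as the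
    uniform one: both functions are 1 - y^2 / 6 up to a term of order y^4. *)
Lemma sinc_expR y : `|sinc y - expR (- (6^-1 * y ^+ 2))| <= y ^+ 4.
Proof.
have z0 : 0 <= 6^-1 * y ^+ 2 by rewrite mulr_ge0// sqr_ge0.
have := sinc_ge y; have := sinc_le y; have := expRN_le z0.
have := expR_ge1Dx (- (6^-1 * y ^+ 2)).
have y4 : 0 <= y ^+ 4 by rewrite exprn_even_ge0.
have -> : (6^-1 * y ^+ 2) ^+ 2 = 36^-1 * y ^+ 4 by field.
by rewrite ler_norml => *; apply/andP; split; lra.
Qed.

(** The derivative of sinc at x > 0 lies between -2x and 2x, so sinc plus and minus the square are
    monotone in opposite directions. *)
Lemma sinc_lip_pos y z : 0 < y -> y <= z -> `|sinc z - sinc y| <= z ^+ 2 - y ^+ 2.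
Proof.
move=> y0 yz; have z0 := lt_le_trans y0 yz.
rewrite /sinc !gt_eqF// .
have dsinc (x : R) : y <= x -> is_derive x 1 (fun x => sin x / x) ((x * cos x - sin x) / x ^+ 2).
  move=> yx; have x0 : x != 0 by rewrite gt_eqF// (lt_le_trans y0).
  have H := @is_deriveM R _ sin (fun x => x^-1) x 1 _ _ (is_derive_sin x) (is_deriveV x0 (is_derive_id x 1)).
  by apply: (is_derive_eq H); rewrite /GRing.scale /=; field.
have bnd x : y <= x -> - (2 * x) <= (x * cos x - sin x) / x ^+ 2 <= 2 * x.
  move=> yx; have x0 : 0 < x by rewrite (lt_le_trans y0).
  have x2 : 0 < x ^+ 2 by rewrite exprn_gt0.
  rewrite ler_pdivlMr// ler_pdivrMr//.
  have h1 := sin_le_id (ltW x0); have h2 := sin_ge (ltW x0).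
  have h3 : x * (1 - 2^-1 * x ^+ 2) <= x * cos x by rewrite ler_pM2l// cos_ge// ltW.
  have h4 : x * cos x <= x * 1 by rewrite ler_pM2l// cos_le1.
  have h5 : 0 <= x ^+ 3 by rewrite exprn_ge0// ltW.
  apply/andP; split; lra.
have h1 := @ge0_derive_le (fun x => sin x / x + 1 * x ^+ 2)
  (fun x => (x * cos x - sin x) / x ^+ 2 + 1 * (2 * x ^+ 1)) y z yz.
have h2 := @ge0_derive_le (fun x => 1 * x ^+ 2 - sin x / x)
  (fun x => 1 * (2 * x ^+ 1) - (x * cos x - sin x) / x ^+ 2) y z yz.
have {}h1 : sin y / y + 1 * y ^+ 2 <= sin z / z + 1 * z ^+ 2.
  apply: h1 => x yx; last by have := bnd x yx; lra.
  exact: (@is_deriveD R R R _ _ x 1 _ _ (dsinc x yx) (is_derive_powM 1 1 x)).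
have {}h2 : 1 * y ^+ 2 - sin y / y <= 1 * z ^+ 2 - sin z / z.
  apply: h2 => x yx; last by have := bnd x yx; lra.
  exact: (@is_deriveB R R R _ _ x 1 _ _ (is_derive_powM 1 1 x) (dsinc x yx)).
rewrite ler_norml; apply/andP; split; lra.
Qed.

(** Measuring the increment by squares makes the errors of a product of such factors add up to
    differences of power sums of order two, which are what the trees control. *)
Lemma sinc_lip y z : `|sinc y - sinc z| <= `|y ^+ 2 - z ^+ 2|.
Proof.
wlog yz : y z / `|y| <= `|z|.
  by move=> H; have [/H//|/ltW/H] := leP `|y| `|z|; rewrite distrC [X in _ <= X -> _]distrC.
rewrite -(sinc_norm y) -(sinc_norm z) -(real_normK (num_real y)) -(real_normK (num_real z)).
have := normr_ge0 y; move: `|y| `|z| yz => {}y {}z yz; rewrite le_eqVlt => /predU1P[<-|y0].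
  rewrite sinc0 expr0n /= sub0r normrN (@ger0_norm _ (z ^+ 2)) ?sqr_ge0//.
  have := sinc_ge z; have := sinc_abs_le1 z; have : 0 <= z ^+ 2 by rewrite sqr_ge0.
  by rewrite !ler_norml => ? /andP[_ ?] ?; apply/andP; split; lra.
rewrite distrC (distrC (y ^+ 2)); apply: (le_trans (sinc_lip_pos y0 yz)).
exact: ler_norm.
Qed.

Lemma continuous_sinc : continuous sinc.
Proof.
move=> x; apply/cvgrPdist_le => e e0.
have cx : (fun y : R => y ^+ 2) @ x --> x ^+ 2 by exact: exprn_continuous.
move/cvgrPdist_le : cx => /(_ e e0).
by apply: filterS => y; apply: le_trans; exact: sinc_lip.
Qed.

End Sinc.

(** * The limiting characteristic function and its continuity in t *)

Section DustpanCharacteristicFunction.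
Context {R : realType}.
Implicit Types (t : nat -> R) (x : R).

Lemma ler_norm_prod (a : nat -> R) n : (forall i, `|a i| <= 1) -> `|\prod_(i < n) a i| <= 1.
Proof.
move=> a1; elim: n => [|n IH]; first by rewrite big_ord0 normr1.
by rewrite big_ord_recr /= normrM mulr_ile1.
Qed.

Lemma ler_dist_prod (a b : nat -> R) n :
  (forall i, `|a i| <= 1) -> (forall i, `|b i| <= 1) ->
  `|\prod_(i < n) a i - \prod_(i < n) b i| <= \sum_(i < n) `|a i - b i|.
Proof.
move=> a1 b1; elim: n => [|n IH]; first by rewrite !big_ord0 subrr normr0.
rewrite !big_ord_recr /=.
set A := \prod_(i < n) a i; set B := \prod_(i < n) b i.
have -> : A * a n - B * b n = (A - B) * a n + B * (a n - b n) by ring.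
apply: (le_trans (ler_normD _ _)); apply: lerD; rewrite normrM.
  by apply: le_trans IH; rewrite ler_piMr.
by rewrite ler_piMl// ler_norm_prod.
Qed.

(* Truncated characteristic function of S_t + N(0, 1 - |t|_2^2 / 12): the
   summands of index at least K are replaced by a normal of the same variance. *)
Definition dcf_trunc t (K : nat) x : R :=
  \prod_(k < K) sinc (t k * x / 2) *
  expR (- ((1 - (\sum_(k < K) t k ^+ 2) / 12) * x ^+ 2 / 2)).

Definition dcf t x : R := lim (dcf_trunc t K x @[K --> \oo]).

(** Same condition as [dustpan], with the norm expressed by partial sums to stay within the
    reals. *)
Definition predust t : Prop :=
  [/\ forall k, 0 <= t k, forall k, t k.+1 <= t k &
      forall K, \sum_(k < K) t k ^+ 2 <= 12].

Lemma predust_nonincr t k l : predust t -> (k <= l)%N -> t l <= t k.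
Proof.
move=> [_ td _] /subnK <-; elim: (l - k)%N => [|n IH]; first by rewrite add0n.
by rewrite addSn; apply: le_trans IH; exact: td.
Qed.

(** The first K + 1 squares are all at least t_K^2, and their sum is at most 12. *)
Lemma predust_sq_le t K : predust t -> t K ^+ 2 <= 12 / K.+1%:R.
Proof.
move=> pt; have [t0 td t12] := pt; rewrite ler_pdivlMr ?ltr0n//.
apply: le_trans (t12 K.+1).
have -> : t K ^+ 2 * K.+1%:R = \sum_(k < K.+1) t K ^+ 2.
  by rewrite sumr_const card_ord mulr_natr.
by apply: ler_sum => k _; rewrite lerXn2r ?nnegrE//; apply: predust_nonincr => //; rewrite -ltnS.
Qed.

(** Each sinc factor of index k >= K is traded for its normal counterpart at a cost of at most (t_k
    x / 2)^4 <= t_k^2 t_K^2 x^4 / 16. Summing with t_K^2 <= 12 / (K + 1) gives 12 (12 / (K + 1)) x^4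
    / 16 = 9 x^4 / (K + 1), a bound that does not involve t. *)
Lemma dcf_trunc_dist t K M x : predust t -> (K <= M)%N ->
  `|dcf_trunc t M x - dcf_trunc t K x| <= 9 * x ^+ 4 / K.+1%:R.
Proof.
move=> pt /subnKC <-; move: (M - K)%N => {M} j; have [t0 td t12] := pt.
pose a i := sinc (t (K + i)%N * x / 2).
pose b i := expR (- (6^-1 * (t (K + i)%N * x / 2) ^+ 2)).
pose A := \prod_(k < K) sinc (t k * x / 2).
pose e := expR (- ((1 - (\sum_(k < K + j) t k ^+ 2) / 12) * x ^+ 2 / 2)).
have -> : dcf_trunc t (K + j) x = A * e * \prod_(i < j) a i.
  by rewrite /dcf_trunc big_split_ord /= -/A mulrAC.
have -> : dcf_trunc t K x = A * e * \prod_(i < j) b i.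
  rewrite /dcf_trunc -/A -[RHS]mulrA; congr (_ * _).
  rewrite /e /b -expR_sum -expRD big_split_ord /= sumrN -mulr_sumr; congr expR.
  have -> : \sum_(i < j) (t (K + i)%N * x / 2) ^+ 2 =
            (\sum_(i < j) t (K + i)%N ^+ 2) * (x ^+ 2 / 4).
    by rewrite mulr_suml; apply: eq_bigr => i _; field.
  by field.
have A1 : `|A| <= 1 by apply: ler_norm_prod (fun k => sinc (t k * x / 2)) _ _ => i; exact: sinc_abs_le1.
have e1 : `|e| <= 1.
  rewrite ger0_norm ?expR_ge0// -[leRHS]expR0 ler_expR oppr_le0.
  by rewrite divr_ge0// mulr_ge0 ?sqr_ge0// subr_ge0 ler_pdivrMr// mul1r.
have b1 i : `|b i| <= 1.
  rewrite ger0_norm ?expR_ge0// -[leRHS]expR0 ler_expR oppr_le0.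
  by rewrite mulr_ge0// sqr_ge0.
rewrite -mulrBr normrM; apply: (@le_trans _ _ `|\prod_(i < j) a i - \prod_(i < j) b i|).
  by rewrite ler_piMl// normrM mulr_ile1.
apply: (le_trans (ler_dist_prod _ _ _)) => [i|//|]; first exact: sinc_abs_le1.
apply: (@le_trans _ _ (\sum_(i < j) t (K + i)%N ^+ 2 * (t K ^+ 2 * (x ^+ 4 / 16)))).
  apply: ler_sum => i _; apply: (le_trans (sinc_expR _)).
  have -> : (t (K + i)%N * x / 2) ^+ 4 = t (K + i)%N ^+ 2 * (t (K + i)%N ^+ 2 * (x ^+ 4 / 16)) by field.
  rewrite ler_wpM2l ?sqr_ge0// ler_wpM2r//.
    by rewrite divr_ge0// exprn_even_ge0.
  by rewrite lerXn2r ?nnegrE//; apply: predust_nonincr => //; exact: leq_addr.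
rewrite -mulr_suml.
have s12 : \sum_(i < j) t (K + i)%N ^+ 2 <= 12.
  apply: le_trans (t12 (K + j)%N); rewrite big_split_ord /= lerDr.
  by apply: sumr_ge0 => i _; exact: sqr_ge0.
have tK := predust_sq_le K pt.
have x4 : 0 <= x ^+ 4 / 16 by rewrite divr_ge0// exprn_even_ge0.
apply: (@le_trans _ _ (12 * ((12 / K.+1%:R) * (x ^+ 4 / 16)))).
  apply: ler_pM => //.
  - by apply: sumr_ge0 => i _; exact: sqr_ge0.
  - by apply: mulr_ge0 => //; exact: sqr_ge0.
  - exact: ler_wpM2r.
have K0 : K.+1%:R != 0 :> R by rewrite pnatr_eq0.
move: K.+1%:R K0 => z K0.
by rewrite (_ : 12 * _ = 9 * x ^+ 4 / z)//; field.
Qed.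

Lemma dcf_bound_cvg0 x : 9 * x ^+ 4 / K.+1%:R @[K --> \oo] --> (0 : R).
Proof.
rewrite -[X in _ --> X](mulr0 (9 * x ^+ 4)); apply: cvgM; first exact: cvg_cst.
exact: cvg_harmonic.
Qed.

Lemma cvg_dcf t x : predust t -> dcf_trunc t K x @[K --> \oo] --> dcf t x.
Proof.
move=> pt; apply/cauchy_cvgP/cauchy_exP => e e0.
have /cvgrPdist_lt/(_ e e0)[K _ KP] := dcf_bound_cvg0 x.
exists (dcf_trunc t K x); exists K => // M /= KM.
rewrite -ball_normE /= distrC; apply: (le_lt_trans (dcf_trunc_dist x pt KM)).
by have := KP K (leqnn K); rewrite /= sub0r normrN => h; apply: le_lt_trans h; exact: ler_norm.
Qed.

Lemma dcf_trunc_le t K x : predust t ->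
  `|dcf t x - dcf_trunc t K x| <= 9 * x ^+ 4 / K.+1%:R.
Proof.
move=> pt; have h : `|dcf_trunc t M x - dcf_trunc t K x| @[M --> \oo] --> `|dcf t x - dcf_trunc t K x|.
  by apply: cvg_norm; apply: cvgB; [exact: cvg_dcf|exact: cvg_cst].
apply: (cvgr_to_le h).
by near=> M; apply: dcf_trunc_dist => //; near: M; exact: nbhs_infty_ge.
Unshelve. all: by end_near. Qed.

(** When finitely many terms exhaust the bound 12, the normal part has variance 0. This is the case
    of the normalized elevations of a tree. *)
Lemma dcf_finite t m x : (forall k, (m <= k)%N -> t k = 0) ->
  \sum_(k < m) t k ^+ 2 = 12 -> dcf t x = \prod_(k < m) sinc (t k * x / 2).
Proof.
move=> t0 t12; apply/cvg_lim => //; apply: cvg_near_cst.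
near=> M.
have mM : (m <= M)%N by near: M; exact: nbhs_infty_ge.
rewrite /dcf_trunc -(subnKC mM) !big_split_ord /= t12.
rewrite [X in _ * X * _]big1 ?mulr1; last first.
  by move=> i _; rewrite t0 ?leq_addr// !mul0r sinc0.
rewrite [X in 12 + X]big1 ?addr0; last by move=> i _; rewrite t0 ?leq_addr// expr0n.
by rewrite divff// subrr !mul0r oppr0 expR0 mulr1.
Unshelve. all: by end_near. Qed.

Context {I : Type} {F : set_system I} {PF : ProperFilter F}.
Variables (e : I -> nat -> R) (t : nat -> R).
Hypothesis e_predust : forall i, predust (e i).
Hypothesis e_cvg : forall k, e i k @[i --> F] --> t k.

Lemma cvg_sum_sq K : \sum_(k < K) e i k ^+ 2 @[i --> F] --> \sum_(k < K) t k ^+ 2.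
Proof.
elim: K => [|K IH].
  by rewrite big_ord0; under eq_fun do rewrite big_ord0; exact: cvg_cst.
rewrite big_ord_recr /=; under eq_fun do rewrite big_ord_recr.
apply: cvgD => //; rewrite expr2; under eq_fun do rewrite expr2.
by apply: cvgM.
Qed.

Lemma predust_lim : predust t.
Proof.
split=> [k|k|K].
- have h : \near F, 0 <= e F k by apply: nearW => i; case: (e_predust i).
  exact: (cvgr_to_ge (@e_cvg k) h).
- have h : e i k - e i k.+1 @[i --> F] --> t k - t k.+1 by apply: cvgB.
  have h2 : \near F, 0 <= e F k - e F k.+1.
    by apply: nearW => i; rewrite subr_ge0; case: (e_predust i).
  rewrite -subr_ge0; exact: (cvgr_to_ge h h2).
- have h : \near F, \sum_(k < K) e F k ^+ 2 <= 12 by apply: nearW => i; case: (e_predust i).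
  exact: (cvgr_to_le (@cvg_sum_sq K) h).
Qed.

Lemma cvg_dcf_trunc K x : dcf_trunc (e i) K x @[i --> F] --> dcf_trunc t K x.
Proof.
apply: cvgM.
  elim: K => [|K IH].
    by rewrite big_ord0; under eq_fun do rewrite big_ord0; exact: cvg_cst.
  rewrite big_ord_recr /=; under eq_fun do rewrite big_ord_recr.
  apply: cvgM => //; apply: continuous_cvg; first exact: continuous_sinc.
  by apply: cvgM; [apply: cvgM; [exact: e_cvg|exact: cvg_cst]|exact: cvg_cst].
apply: continuous_cvg; first exact: continuous_expR.
apply: cvgN; apply: cvgM; last exact: cvg_cst.
apply: cvgM; last exact: cvg_cst.
apply: cvgB; first exact: cvg_cst.
by apply: cvgM; [exact: cvg_sum_sq|exact: cvg_cst].
Qed.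

(** A fixed truncation depends on finitely many coordinates and is continuous in them; the
    truncation error is uniform in i. The sums of squares need not converge to that of t. *)
Lemma cvg_dcf_seq x : dcf (e i) x @[i --> F] --> dcf t x.
Proof.
apply/cvgrPdist_le => eps eps0.
have eps3 : 0 < eps / 3 by rewrite divr_gt0.
have /cvgrPdist_le/(_ _ eps3)[K _ /(_ K (leqnn K))] := dcf_bound_cvg0 x.
rewrite /= sub0r normrN => /(le_trans (ler_norm _)) KP.
have /cvgrPdist_le/(_ _ eps3) := @cvg_dcf_trunc K x.
apply: filterS => i h.
have h1 := le_trans (dcf_trunc_le K x predust_lim) KP.
have h2 := le_trans (dcf_trunc_le K x (e_predust i)) KP.
have -> : dcf t x - dcf (e i) x = (dcf t x - dcf_trunc t K x) +
   (dcf_trunc t K x - dcf_trunc (e i) K x) - (dcf (e i) x - dcf_trunc (e i) K x) by ring.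
apply: (le_trans (ler_normB _ _)); apply: (le_trans (lerD (ler_normD _ _) h2)).
apply: (le_trans (lerD (lerD h1 h) (lexx _))); lra.
Qed.

End DustpanCharacteristicFunction.

(** * Levy's continuity theorem *)

Section BoundedIntegrals.
Context {d : measure_display} {T : measurableType d} {R : realType} (P : probability T R).

Definition bmeas (g : T -> R) : Prop :=
  measurable_fun setT g /\ exists M, forall y, `|g y| <= M.

Lemma bmeas_integrable g : bmeas g -> P.-integrable setT (EFin \o g).
Proof.
move=> [mg [M gM]]; apply: measurable_bounded_integrable => //.
  exact: (le_lt_trans (probability_le1 P measurableT) (ltry _)).
by exists M; split; [exact: num_real|move=> x Mx y _; apply: le_trans (gM y) _; exact: ltW].
Qed.

Lemma bmeasD f g : bmeas f -> bmeas g -> bmeas (fun x => f x + g x).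
Proof.
move=> [mf [M fM]] [mg [N gN]]; split; first exact: measurable_funD.
by exists (M + N) => y; apply: (le_trans (ler_normD _ _)); exact: lerD.
Qed.

Lemma bmeasM f g : bmeas f -> bmeas g -> bmeas (fun x => f x * g x).
Proof.
move=> [mf [M fM]] [mg [N gN]]; split; first exact: measurable_funM.
by exists (M * N) => y; rewrite normrM; exact: ler_pM.
Qed.

Lemma bmeas_cst c : bmeas (fun=> c).
Proof. by split; [exact: measurable_cst|exists `|c|]. Qed.

Lemma bmeasZ c f : bmeas f -> bmeas (fun x => c * f x).
Proof. exact: (bmeasM (bmeas_cst c)). Qed.

Lemma bmeas_indic A : measurable A -> bmeas (\1_A : T -> R).
Proof.
move=> mA; split; first exact: measurable_indic.
by exists 1 => y; rewrite indicE; case: (_ \in _); rewrite ?normr1 ?normr0.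
Qed.

Lemma Rintegral_indic A : measurable A -> \int[P]_y (\1_A y : R) = fine (P A).
Proof. by move=> mA; rewrite /Rintegral integral_indic// setIT. Qed.

Lemma Rintegral_prob_cst (c : R) : \int[P]_y c = c.
Proof.
rewrite Rintegral_cst// (_ : fine _ = 1) ?mulr1//.
by rewrite -[1]/(fine 1%E); congr fine; exact: probability_setT. Qed.

End BoundedIntegrals.

Section StepPolynomial.
Context {R : realType}.

(* The Stone-Weierstrass step: these polynomials tend to 1 on [0, 1/2[ and
   to 0 on ]1/2, 1]. *)
Definition step_poly (n : nat) : {poly R} := (1 - 'X^n) ^+ (2 ^ n).

Lemma step_polyE n (y : R) : (step_poly n).[y] = (1 - y ^+ n) ^+ (2 ^ n).
Proof. by rewrite /step_poly horner_exp hornerD hornerN hornerXn hornerC. Qed.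

Lemma step_poly_01 n (y : R) : 0 <= y <= 1 -> 0 <= (step_poly n).[y] <= 1.
Proof.
move=> /andP[y0 y1]; rewrite step_polyE.
have y2 : 0 <= y ^+ n <= 1 by rewrite exprn_ge0// exprn_ile1.
by rewrite exprn_ge0 ?exprn_ile1//; lra.
Qed.

Lemma bernoulli_ineq (z : R) n : -1 <= z -> 1 + n%:R * z <= (1 + z) ^+ n.
Proof.
move=> z1; elim: n => [|n IH]; first by rewrite mul0r addr0 expr0.
rewrite exprS; apply: (@le_trans _ _ ((1 + z) * (1 + n%:R * z))); last first.
  by rewrite ler_wpM2l//; lra.
rewrite -natr1; have : 0 <= n%:R * (z * z) by rewrite mulr_ge0// -expr2 sqr_ge0.
lra.
Qed.

(** Bernoulli's inequality applied to (1 - y^n)^(2^n). *)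
Lemma step_poly_ge n (y : R) : 0 <= y <= 1 -> 1 - (2 * y) ^+ n <= (step_poly n).[y].
Proof.
move=> /andP[y0 y1]; rewrite step_polyE.
have y2 : y ^+ n <= 1 by rewrite exprn_ile1.
have := @bernoulli_ineq (- y ^+ n) (2 ^ n); rewrite lerN2 y2 => /(_ isT).
by rewrite mulrN exprMn natrX.
Qed.

(** With z = y^n and N = 2^n: (1 - z)^N (1 + z)^N <= 1, while (1 + z)^N >= 1 + N z >= (2y)^n. *)
Lemma step_poly_le n (y : R) : 0 <= y <= 1 -> (2 * y) ^+ n * (step_poly n).[y] <= 1.
Proof.
move=> /andP[y0 y1]; rewrite step_polyE.
have y2 : 0 <= y ^+ n <= 1 by rewrite exprn_ge0// exprn_ile1.
set z := y ^+ n in y2 *.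
have h1 : 1 + (2 ^ n)%:R * z <= (1 + z) ^+ (2 ^ n) by apply: bernoulli_ineq; lra.
have h2 : (1 - z) ^+ (2 ^ n) * (1 + z) ^+ (2 ^ n) <= 1.
  rewrite -exprMn; apply: exprn_ile1; first by apply: mulr_ge0; lra.
  have : 0 <= z * z by rewrite -expr2 sqr_ge0.
  lra.
apply: le_trans h2; rewrite mulrC ler_wpM2l//; first by rewrite exprn_ge0//; lra.
by rewrite exprMn -natrX -/z; lra.
Qed.

Lemma step_poly_approx (del eps : R) : 0 < del <= 1 -> 0 < eps ->
  exists n, forall y : R, 0 <= y <= 1 ->
   (y <= (1 - del) / 2 -> 1 - eps <= (step_poly n).[y]) /\
   ((1 + del) / 2 <= y -> (step_poly n).[y] <= eps).
Proof.
(* One rate serves both sides: 1 - del <= 1 / (1 + del) bounds 2y on the left, and 1 / (1 + del)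
   bounds 1 / (2y) on the right. *)
move=> /andP[d0 d1] e0; pose rho := (1 + del)^-1.
have d1' : 0 < 1 + del by lra.
have rho1 : rho < 1 by rewrite /rho invf_lt1//; lra.
have rho0 : 0 < rho by rewrite invr_gt0.
have : rho ^+ n @[n --> \oo] --> (0 : R) by apply: cvg_expr; rewrite ger0_norm ?ltW.
move=> /cvgrPdist_le/(_ eps e0)[n _ /(_ n (leqnn n))] /=.
rewrite sub0r normrN ger0_norm; last by apply: exprn_ge0; exact: ltW.
move=> hn.
exists n => y y01; have /andP[y0 y1] := y01; split=> hy.
  apply: le_trans (step_poly_ge n y01); rewrite lerD2l lerN2.
  apply: le_trans hn; apply: lerXn2r; rewrite ?nnegrE; [lra|exact: ltW|].
  apply: (@le_trans _ _ (1 - del)); first lra.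
  rewrite /rho -[leRHS]div1r ler_pdivlMr//.
  have : 0 <= del * del by rewrite -expr2 sqr_ge0.
  lra.
have /andP[p0 _] := step_poly_01 n y01.
have h := step_poly_le n y01.
apply: le_trans hn; rewrite /rho exprVn -[leRHS]div1r ler_pdivlMr ?exprn_gt0//.
rewrite mulrC; apply: le_trans h; rewrite ler_wpM2r//.
by apply: lerXn2r; rewrite ?nnegrE; lra.
Qed.

Lemma sin_le_pihalf (x y : R) : - (pi / 2) <= x -> x <= y -> y <= pi / 2 -> sin x <= sin y.
Proof.
move=> x1 xy y1; rewrite -subr_ge0.
have -> : sin y - sin x = 2 * (cos ((y + x) / 2) * sin ((y - x) / 2)).
  have -> : sin y = sin ((y + x) / 2 + (y - x) / 2) by congr sin; field.
  have -> : sin x = sin ((y + x) / 2 - (y - x) / 2) by congr sin; field.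
  by rewrite sinD sinB; ring.
have := pi_gt0 R => pi0.
by rewrite !mulr_ge0 ?cos_ge0_pihalf ?sin_ge0_pi//; lra.
Qed.

End StepPolynomial.

Section LevyContinuity.
Context {R : realType}.
Local Notation RR := (measurableTypeR R).

Lemma bmeas_continuous (g : R -> R) (M : R) : continuous g ->
  (forall y, `|g y| <= M) -> bmeas (g : RR -> R).
Proof. by move=> cg gM; split; [exact: continuous_measurable_fun|exists M]. Qed.

Lemma measurable_far (L : R) : measurable ([set y | L < `|y|] : set RR).
Proof.
rewrite (_ : [set y | L < `|y|] = (fun y : RR => `|y|) @^-1` `]L, +oo[).
  by rewrite -[X in measurable X]setTI; apply: (@normr_measurable R setT) => //; exact: measurable_itv.
by apply/seteqP; split => y /=; rewrite in_itv /= andbT.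
Qed.

Lemma continuous_affine (b c : R) : continuous (fun y : R => b * y + c).
Proof. by move=> y; apply: cvgD; [apply: cvgM; [exact: cvg_cst|exact: cvg_id]|exact: cvg_cst]. Qed.

Lemma bmeas_cos (b c : R) : bmeas (fun y : RR => cos (b * y + c)).
Proof.
apply: (@bmeas_continuous _ 1) => [y|y]; last exact: cos_max.
by apply: continuous_comp; [exact: continuous_affine|exact: continuous_cos].
Qed.

Lemma bmeas_sin (b c : R) : bmeas (fun y : RR => sin (b * y + c)).
Proof.
apply: (@bmeas_continuous _ 1) => [y|y]; last exact: sin_max.
by apply: continuous_comp; [exact: continuous_affine|exact: continuous_sin].
Qed.

Context {I : Type} {F : set_system I} {PF : ProperFilter F}.
Variables (nu : I -> probability RR R) (mu : probability RR R).
Hypothesis cvg_cos : forall x : R,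
  \int[nu i]_y cos (x * y) @[i --> F] --> \int[mu]_y cos (x * y).
Hypothesis cvg_sin : forall x : R,
  \int[nu i]_y sin (x * y) @[i --> F] --> \int[mu]_y sin (x * y).

(** The functions against which convergence of integrals is already known; the aim is to approximate
    indicators of half-lines from within this class. *)
Definition test_fun (g : R -> R) : Prop :=
  bmeas (g : RR -> R) /\ \int[nu i]_y g y @[i --> F] --> \int[mu]_y g y.

Lemma test_funD f g : test_fun f -> test_fun g -> test_fun (fun y => f y + g y).
Proof.
move=> [bf cf] [bg cg]; split; first exact: bmeasD.
rewrite RintegralD ?bmeas_integrable//.
under eq_fun do rewrite RintegralD ?bmeas_integrable//.
exact: cvgD.
Qed.

Lemma test_funZ c f : test_fun f -> test_fun (fun y => c * f y).
Proof.
move=> [bf cf]; split; first exact: bmeasZ.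
rewrite RintegralZl ?bmeas_integrable//.
under eq_fun do rewrite RintegralZl ?bmeas_integrable//.
by apply: cvgM => //; exact: cvg_cst.
Qed.

Lemma test_fun_cos (b c : R) : test_fun (fun y => cos (b * y + c)).
Proof.
have -> : (fun y => cos (b * y + c)) = (fun y => cos c * cos (b * y) + - sin c * sin (b * y)).
  by apply/funext => y; rewrite cosD; ring.
apply: test_funD; apply: test_funZ; split => //.
  by have := bmeas_cos b 0; under [X in bmeas X -> _]eq_fun do rewrite addr0.
by have := bmeas_sin b 0; under [X in bmeas X -> _]eq_fun do rewrite addr0.
Qed.

(** Multiplying by (1 + sin) / 2 turns one cosine into three, with other frequencies and phases. The
    cosine factor is there so that the induction on p can vary them. *)
Lemma test_fun_poly (p : {poly R}) (c e b th : R) :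
  test_fun (fun y => p.[(1 + sin (c * y + e)) / 2] * cos (b * y + th)).
Proof.
elim/poly_ind: p b th => [|p q IH] b th.
  have -> : (fun y : R => (0 : {poly R}).[(1 + sin (c * y + e)) / 2] * cos (b * y + th)) =
     (fun y => 0 * cos (b * y + th)) by apply/funext => y; rewrite horner0.
  by apply: test_funZ; exact: test_fun_cos.
have -> : (fun y => (p * 'X + q%:P).[(1 + sin (c * y + e)) / 2] * cos (b * y + th)) =
  (fun y => (2^-1 * (p.[(1 + sin (c * y + e)) / 2] * cos (b * y + th)) +
   (4^-1 * (p.[(1 + sin (c * y + e)) / 2] * cos ((c + b) * y + (e + th - pi / 2))) +
    4^-1 * (p.[(1 + sin (c * y + e)) / 2] * cos ((c - b) * y + (e - th - pi / 2))))) +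
    q * cos (b * y + th)).
  apply/funext => y; rewrite hornerD hornerM hornerX hornerC.
  have -> : (c + b) * y + (e + th - pi / 2) = ((c * y + e) + (b * y + th)) - pi / 2 by ring.
  have -> : (c - b) * y + (e - th - pi / 2) = ((c * y + e) - (b * y + th)) - pi / 2 by ring.
  by move: (c * y + e) (b * y + th) => u v; rewrite !cosBpihalf sinD sinB; field.
apply: test_funD; last by apply: test_funZ; exact: test_fun_cos.
by apply: test_funD; [|apply: test_funD]; apply: test_funZ; exact: IH.
Qed.

(** A sine of low frequency is increasing on [-L, L] and equals 0 at b; the step polynomial in (1 +
    sin) / 2 sharpens it into a step at b. Outside [-L, L] only the bounds 0 and 1 are kept, which
    the indicator of that region pays for. *)
Lemma step_test_fun (b eta eps L : R) : 0 < eta -> 0 < eps -> 0 < L ->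
  exists2 q, test_fun q & forall x,
    \1_`]-oo, b - eta] x <= q x + (eps + \1_[set y | L < `|y|] x) /\
    q x <= \1_`]-oo, b + eta] x + (eps + \1_[set y | L < `|y|] x).
Proof.
(* This frequency keeps c (x - b) within [-1, 1], inside [-pi/2, pi/2], for every x in [-L, L], and
   makes c eta < 1. *)
move=> eta0 eps0 L0; pose c := (L + `|b| + eta + 1)^-1.
have c0' : 0 < L + `|b| + eta + 1 by have := normr_ge0 b; lra.
have c0 : 0 < c by rewrite invr_gt0.
have pi1 := @pihalf_ge1 R.
have ceta : 0 < c * eta < 1.
  rewrite mulr_gt0//= /c mulrC ltr_pdivrMr// mul1r; have := normr_ge0 b; lra.
have del : 0 < sin (c * eta) <= 1.
  by rewrite sin_le1 andbT sin_gt0_pihalf//; apply/andP; split; lra.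
have [n np] := step_poly_approx del eps0.
pose Y (x : R) := (1 + sin (c * x + - (c * b))) / 2.
have Y01 x : 0 <= Y x <= 1.
  by rewrite /Y; have := sin_geN1 (c * x + - (c * b)); have := sin_le1 (c * x + - (c * b)); lra.
exists (fun x => (step_poly n).[Y x]).
  have := @test_fun_poly (step_poly n) c (- (c * b)) 0 0.
  by congr test_fun; apply/funext => y; rewrite mul0r addr0 cos0 mulr1.
move=> x; have [s0 s1] := andP (step_poly_01 n (Y01 x)).
have [h1 h2] := np _ (Y01 x).
rewrite !indicE.
have [Lx|Lx] := boolP (x \in [set y | L < `|y|]).
  by split; case: (x \in _); rewrite /=; lra.
rewrite notin_setE /= in Lx; move/negP: Lx; rewrite -leNgt => Lx.
have bnd : -1 <= c * x + - (c * b) <= 1.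
  rewrite -mulrBr -ler_norml normrM (gtr0_norm c0) /c mulrC ler_pdivrMr// mul1r.
  by apply: (le_trans (ler_normB _ _)); lra.
split.
  case: (boolP (x \in _)) => [|_]; last by rewrite /=; lra.
  rewrite inE /= in_itv /= => xb.
  suff : 1 - eps <= (step_poly n).[Y x] by lra.
  apply: h1; rewrite /Y ler_wpM2r// lerD2l.
  rewrite -sinN; apply: sin_le_pihalf; [lra| |lra].
  have : c * x <= c * (b - eta) by rewrite ler_wpM2l// ltW.
  lra.
case: (boolP (x \in _)) => [_|]; first by rewrite /=; lra.
rewrite notin_setE /= in_itv /= => /negP; rewrite -ltNge => xb.
suff : (step_poly n).[Y x] <= eps by rewrite /=; lra.
apply: h2; rewrite /Y ler_wpM2r// lerD2l.
apply: sin_le_pihalf; [lra| |lra].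
have : c * (b + eta) <= c * x by rewrite ler_wpM2l// ltW.
lra.
Qed.

Lemma step_integral (rho : probability RR R) (b eta eps L : R) q : bmeas (q : RR -> R) ->
  (forall x,
    \1_`]-oo, b - eta] x <= q x + (eps + \1_[set y | L < `|y|] x) /\
    q x <= \1_`]-oo, b + eta] x + (eps + \1_[set y | L < `|y|] x)) ->
  fine (rho `]-oo, b - eta]) <= \int[rho]_x q x + (eps + fine (rho [set y | L < `|y|])) /\
  \int[rho]_x q x <= fine (rho `]-oo, b + eta]) + (eps + fine (rho [set y | L < `|y|])).
Proof.
move=> bq hq.
have mL : measurable ([set y | L < `|y|] : set RR).
  rewrite (_ : [set y | L < `|y|] = (fun y : RR => `|y|) @^-1` `]L, +oo[).
    by rewrite -[X in measurable X]setTI; apply: (@normr_measurable R setT) => //; exact: measurable_itv.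
  by apply/seteqP; split => y /=; rewrite in_itv /= andbT.
have mb (a : R) : measurable (`]-oo, a] : set RR) by exact: measurable_itv.
have b1 a : bmeas (\1_`]-oo, a] : RR -> R) by exact: bmeas_indic.
have bL : bmeas (\1_[set y | L < `|y|] : RR -> R) by exact: bmeas_indic.
have beL : bmeas (fun x : RR => eps + \1_[set y | L < `|y|] x) by apply: bmeasD => //; exact: bmeas_cst.
have IL : \int[rho]_x (eps + \1_[set y | L < `|y|] x) = eps + fine (rho [set y | L < `|y|]).
  rewrite RintegralD//; [|exact: bmeas_integrable (bmeas_cst _)|exact: bmeas_integrable].
  by rewrite Rintegral_prob_cst Rintegral_indic.
split.
  rewrite -IL -Rintegral_indic// -RintegralD//; [|exact: bmeas_integrable..].
  apply: le_Rintegral => //; [exact: bmeas_integrable|by apply: bmeas_integrable; exact: bmeasD|].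
  by move=> x _; have [] := hq x.
rewrite -IL -Rintegral_indic// -RintegralD//; [|exact: bmeas_integrable..].
apply: le_Rintegral => //; [exact: bmeas_integrable|by apply: bmeas_integrable; exact: bmeasD|].
by move=> x _; have [] := hq x.
Qed.

Hypothesis tight : forall eps : R, 0 < eps ->
  exists2 L : R, 0 < L & forall i, fine (nu i [set y | L < `|y|]) <= eps.

(** Continuity from above along the sets |y| > n, whose intersection is empty. *)
Lemma prob_tight (rho : probability RR R) (eps : R) : 0 < eps ->
  exists2 L : R, 0 < L & forall L', L <= L' -> fine (rho [set y | L' < `|y|]) <= eps.
Proof.
move=> eps0; pose A (n : nat) : set RR := [set y | n%:R < `|y|].
have capA : \bigcap_n A n = set0.
  apply/seteqP; split => // y Ay.
  have := Ay (Num.truncn `|y|).+1 Logic.I; rewrite /A /= => h.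
  by have := truncnS_gt `|y|; rewrite ltNge (ltW h).
have h : rho (A n) @[n --> \oo] --> rho (\bigcap_n A n).
  apply: nonincreasing_cvg_mu => //.
  - exact: (le_lt_trans (probability_le1 rho (measurable_far _)) (ltry _)).
  - by move=> n; exact: measurable_far.
  - by rewrite capA; exact: measurable0.
  - by move=> n m nm; apply/subsetPset => y /=; apply: le_lt_trans; rewrite ler_nat.
rewrite capA measure0 in h.
have /fine_cvgP[_ /cvgrPdist_le/(_ eps eps0)[n _ np]] := h.
exists (n.+1%:R : R) => // L' nL.
have := np n.+1 (leqnSn n); rewrite /= sub0r normrN => /(le_trans (ler_norm _)).
apply: le_trans; apply: fine_le; try exact: fin_num_measure (measurable_far _).
  by apply: le_measure; rewrite ?inE; [exact: measurable_far..|move=> y /=; apply: le_lt_trans].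
Qed.

(** The distribution function at a is squeezed between integrals of test functions with steps at a +
    eta and a - eta. Tightness is a hypothesis, verified later by Chebyshev's inequality. The filter
    is arbitrary, so that ultrafilters are allowed. *)
Lemma Levy_continuity (a : R) : {for a, continuous (fun y : R => mu `]-oo, y])} ->
  (fun i => nu i `]-oo, a]) @ F --> mu `]-oo, a].
Proof.
move=> ca; have mb (c : R) : measurable (`]-oo, c] : set RR) by exact: measurable_itv.
rewrite -[X in _ --> X]fineK; last exact: fin_num_measure.
apply/fine_cvgP; split; first by apply: nearW => i; exact: fin_num_measure.
have cfa : {for a, continuous (fun y : R => fine (mu `]-oo, y]))}.
  move: ca; rewrite /prop_for /continuous_at -[X in _ --> X -> _]fineK; last exact: fin_num_measure.
  by move=> /fine_cvgP[_ h]; exact: h.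
(* On each side six errors add up: one for the approximation and one for the tail, under each of the
   two laws, one for the convergence of the integrals, and one for the continuity of the limit at
   a. *)
apply/cvgrPdist_le => eps eps0; pose e := eps / 6.
have e0 : 0 < e by rewrite divr_gt0.
move/cvgrPdist_le : cfa => /(_ e e0)/nbhs_ballP[r /= r0 hr].
pose eta := r / 4; have eta0 : 0 < eta by rewrite divr_gt0.
have {}hr c : `|a - c| <= r / 2 -> `|fine (mu `]-oo, a]) - fine (mu `]-oo, c])| <= e.
  by move=> ac; apply: hr; rewrite /ball /= (le_lt_trans ac)//; lra.
have [L1 L10 hL1] := tight e0; have [L2 L20 hL2] := prob_tight mu e0.
pose L := Num.max L1 L2; have L0 : 0 < L by rewrite lt_max L10.
have nuL i : fine (nu i [set y | L < `|y|]) <= e.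
  apply: le_trans (hL1 i); apply: fine_le; try exact: fin_num_measure (measurable_far _).
  apply: le_measure; rewrite ?inE; [exact: measurable_far..|move=> y /=; apply: le_lt_trans].
  by rewrite le_max lexx.
have muL : fine (mu [set y | L < `|y|]) <= e by apply: hL2; rewrite le_max lexx orbT.
have [q [bq cq] hq] := step_test_fun (a + eta) eta0 e0 L0.
have [q' [bq' cq'] hq'] := step_test_fun (a - eta) eta0 e0 L0.
move/cvgrPdist_le : cq => /(_ e e0); move/cvgrPdist_le : cq' => /(_ e e0).
apply: filterS2 => i hi' hi.
have [_ s1] := step_integral mu bq hq; have [s2 _] := step_integral (nu i) bq hq.
have [s3 _] := step_integral mu bq' hq'; have [_ s4] := step_integral (nu i) bq' hq'.
rewrite -addrA in s1; rewrite addrK in s2; rewrite -addrA -opprD in s3; rewrite subrK in s4.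
have m1 := hr (a + (eta + eta)); have m2 := hr (a - (eta + eta)).
have {}m1 : `|fine (mu `]-oo, a]) - fine (mu `]-oo, (a + (eta + eta))])| <= e.
  by apply: m1; rewrite opprD addrA subrr sub0r normrN ger0_norm /eta; lra.
have {}m2 : `|fine (mu `]-oo, a]) - fine (mu `]-oo, (a - (eta + eta))])| <= e.
  by apply: m2; rewrite opprB addrCA subrr addr0 ger0_norm /eta; lra.
have ni := nuL i; rewrite /= /e in s1 s2 s3 s4 m1 m2 hi hi' ni muL *.
move: hi hi' m1 m2; rewrite !ler_norml => /andP[? ?] /andP[? ?] /andP[? ?] /andP[? ?].
by apply/andP; split; lra.
Qed.

End LevyContinuity.

(** * Laws with real characteristic functions *)

Section Densities.
Context {R : realType}.
Local Notation RR := (measurableTypeR R).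
Local Notation leb := (@lebesgue_measure R).

(** The phase th = 0 gives the cosine integral phi(x), and th = -pi/2 says that the sine integral
    vanishes: this is a real characteristic function, without complex numbers. *)
Definition has_cf (rho : probability RR R) (phi : R -> R) : Prop :=
  forall x th : R, \int[rho]_y cos (x * y + th) = cos th * phi x.

(** The Radon-Nikodym derivative agrees almost everywhere with the given density, since both have
    the same integral over every measurable set. *)
Lemma integral_density (rho : probability RR R) (p : R -> R) (f : R -> R) :
  rho `<< leb ->
  leb.-integrable setT (EFin \o p) ->
  (forall A, measurable A -> rho A = \int[leb]_(x in A) (p x)%:E)%E ->
  bmeas (f : RR -> R) ->
  (\int[rho]_x (f x)%:E = \int[leb]_x (f x * p x)%:E)%E.
Proof.
move=> dom ip pE bf.
rewrite -(Radon_Nikodym_change_of_variables dom)//; last exact: bmeas_integrable.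
have mf : measurable_fun setT (f : RR -> R) by case: bf.
apply: ae_eq_integral => //.
- apply: emeasurable_funM; first exact/measurable_EFinP.
  by apply: (measurable_int leb); exact: Radon_Nikodym_integrable.
- apply/measurable_EFinP; apply: measurable_funM => //.
  by have /integrableP[/measurable_EFinP] := ip.
have : ae_eq leb setT (Radon_Nikodym (charge_of_finite_measure rho) leb) (EFin \o p).
  apply: integral_ae_eq => //; first exact: Radon_Nikodym_integrable.
    by have /integrableP[] := ip.
  by move=> A _ mA; rewrite -Radon_Nikodym_integral// -pE.
by apply: filterS => x /(_ Logic.I) /= h _; rewrite h -EFinM.
Qed.

Lemma FTC_C1 (F f : R -> R) (a b : R) : a < b ->
  (forall x : R, is_derive x 1 F (f x)) -> continuous f ->
  (\int[leb]_(x in `[a, b]) (f x)%:E = (F b - F a)%:E)%E.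
Proof.
move=> ab Ff cf; rewrite EFinB.
have cF : continuous F.
  by move=> x; apply: differentiable_continuous; apply/derivable1_diffP; case: (Ff x).
apply: continuous_FTC2 => //.
- exact: continuous_subspaceT.
- split.
  + by move=> x _; case: (Ff x).
  + exact/cvg_at_right_filter/cF.
  + exact/cvg_at_left_filter/cF.
- by move=> x _; rewrite derive1E; have [_ ->] := Ff x.
Qed.

Lemma is_derive_sin_affine (x th y : R) :
  is_derive y 1 (fun y => sin (x * y + th)) (x * cos (x * y + th)).
Proof.
have H1 : is_derive y 1 (fun y : R => x * y + th) (x + 0).
  have H := @is_deriveZ R R R id x y 1 1 (is_derive_id y 1).
  rewrite /GRing.scale /= mulr1 in H.
  exact: (@is_deriveD R R R _ _ y 1 _ _ H (is_derive_cst th y 1)).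
have H2 := @is_derive1_comp _ sin _ y _ _ (is_derive_sin (x * y + th)) H1.
by apply: (is_derive_eq H2); rewrite addr0 mulrC.
Qed.

Lemma is_derive_cos_affine (x th y : R) :
  is_derive y 1 (fun y => cos (x * y + th)) (- (x * sin (x * y + th))).
Proof.
have H := is_derive_sin_affine x (th + pi / 2) y.
have E : (fun y => cos (x * y + th)) = (fun y => sin (x * y + (th + pi / 2))).
  by apply/funext => u; rewrite addrA sinDpihalf.
by rewrite E; apply: (is_derive_eq H); rewrite addrA cosDpihalf mulrN.
Qed.

Lemma continuous_cos_affine (x th : R) : continuous (fun y => cos (x * y + th)).
Proof.
by move=> y; apply: continuous_comp; [exact: continuous_affine|exact: continuous_cos].
Qed.

Lemma continuous_sin_affine (x th : R) : continuous (fun y => sin (x * y + th)).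
Proof.
by move=> y; apply: continuous_comp; [exact: continuous_affine|exact: continuous_sin].
Qed.

Lemma has_cf_dirac0 : has_cf (dirac (0 : RR)) (fun=> 1).
Proof.
move=> x th; rewrite /Rintegral integral_dirac//.
  by rewrite diracT mul1e /= mulr0 add0r mulr1.
by apply/measurable_EFinP; case: (bmeas_cos x th).
Qed.

Lemma has_cf_centered_uniform (w : R) : 0 <= w ->
  has_cf (centered_uniform w) (fun x => sinc (w * x / 2)).
Proof.
rewrite le_eqVlt => /predU1P[<-|w0].
  move=> x th; rewrite /centered_uniform; case: pselect => [h|_].
    by exfalso; move: h; rewrite mul0r oppr0 ltxx.
  by rewrite has_cf_dirac0 !mul0r sinc0.
move=> x th; rewrite /centered_uniform; case: pselect => [h|]; last first.
  by move=> h; exfalso; apply: h; lra.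
rewrite /Rintegral (@integral_density _ (uniform_pdf (- (w / 2)) (w / 2))); last first.
- exact: bmeas_cos.
- by [].
- exact: integrable_uniform_pdf.
- exact: dominates_uniform_prob.
have -> : (\int[leb]_y (cos (x * y + th) * uniform_pdf (- (w / 2)) (w / 2) y)%:E =
   \int[leb]_(y in `[(- (w / 2))%R, (w / 2)%R]) (w^-1 * cos (x * y + th))%:E)%E.
  rewrite [RHS]integral_mkcond; apply: eq_integral => y _; rewrite patchE.
  case: ifPn => [|]; rewrite ?inE ?notin_setE /= in_itv /= /uniform_pdf.
    by move=> ->; rewrite mulrC opprK -splitr.
  by move=> /negP/negbTE ->; rewrite mulr0.
have [->|x0] := eqVneq x 0.
  under eq_integral do rewrite mul0r add0r.
  rewrite integral_cst//= lebesgue_measure_itv /= lte_fin h -EFinB -EFinM /=.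
  rewrite mulr0 mul0r sinc0 opprK -splitr mulr1 mulrAC mulVf ?mul1r//.
  by rewrite gt_eqF.
have cc : continuous (fun y => w^-1 * cos (x * y + th)).
  move=> y; apply: cvgM; first exact: cvg_cst.
  exact: continuous_cos_affine.
have dd (y : R) : is_derive y 1 (fun y => (w^-1 * x^-1) * sin (x * y + th)) (w^-1 * cos (x * y + th)).
  have := @is_deriveZ R R R _ (w^-1 * x^-1) y 1 _ (is_derive_sin_affine x th y).
  by move=> H; apply: (is_derive_eq H); rewrite /GRing.scale /=; field; rewrite x0 gt_eqF.
rewrite (FTC_C1 h dd cc) /= !sinD mulrN sinN cosN /sinc.
have -> : x * (w / 2) = w * x / 2 by ring.
have -> : (w * x / 2 == 0) = false.
  by apply/negbTE; rewrite !mulf_neq0// gt_eqF.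
by field; rewrite x0 gt_eqF.
Qed.

End Densities.

(** * The normal characteristic function, by a differential equation *)

Section NormalCharacteristicFunction.
Context {R : realType} (s : R).
Hypothesis s0 : s != 0.
Local Notation RR := (measurableTypeR R).
Local Notation leb := (@lebesgue_measure R).
Local Notation p := (normal_pdf 0 s).

Let pE z : p z = normal_peak s * expR (- z ^+ 2 / (s ^+ 2 *+ 2)).
Proof. by rewrite normal_pdfE// /normal_fun subr0. Qed.

Let ip : leb.-integrable setT (EFin \o p).
Proof. exact: integrable_normal_pdf. Qed.

Let mp : measurable_fun setT p.
Proof. exact: measurable_normal_pdf. Qed.

Let p_ge0 z : 0 <= p z.
Proof. exact: normal_pdf_ge0. Qed.

Let cp : continuous p.
Proof. exact: continuous_normal_pdf. Qed.

Let s2 : 0 < s ^+ 2.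
Proof. by rewrite exprn_even_gt0. Qed.

Let is_derive_p (z : R) : is_derive z 1 p (- (z / s ^+ 2) * p z).
Proof.
have -> : p = fun z => normal_peak s * expR (- z ^+ 2 / (s ^+ 2 *+ 2)) by apply/funext.
have H1 := is_derive_powM (- (s ^+ 2 *+ 2)^-1) 1 z.
have H2 := @is_derive1_comp _ expR _ z _ _ (is_derive_expR (- (s ^+ 2 *+ 2)^-1 * z ^+ 2)) H1.
have H3 := @is_deriveZ R R R _ (normal_peak s) z 1 _ H2.
have -> : (fun z => normal_peak s * expR (- z ^+ 2 / (s ^+ 2 *+ 2))) =
   (normal_peak s \*: (expR \o (fun z : R => - (s ^+ 2 *+ 2)^-1 * z ^+ 2))).
  by apply/funext => u; rewrite /= /GRing.scale /=; congr (_ * expR _); rewrite mulNr mulrC mulNr.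
apply: (is_derive_eq H3); rewrite /GRing.scale /= expr1.
have -> : - z ^+ 2 / (s ^+ 2 *+ 2) = - (s ^+ 2 *+ 2)^-1 * z ^+ 2 by rewrite mulNr mulrC mulNr.
move: s2 => /lt0r_neq0; move: (s ^+ 2) (expR _) => v w v0.
by rewrite -mulr_natr; field.
Qed.

Let expRN_inv (y : R) : 0 <= y -> expR (- y) <= (1 + y)^-1.
Proof. by move=> y0; rewrite expRN lef_pV2 ?posrE ?expR_gt0 ?expR_ge1Dx//; lra. Qed.

(** Domination by the density of standard deviation 2s, known to be integrable. The quotient of the
    exponentials is e^(-y) with y = 3 z^2 / (8 s^2), and e^(-y) <= 1 / (1 + y) absorbs |z| <= 1 +
    z^2. *)
Let zp_le z : `|z| * p z <= (1 + s ^+ 2 * 8 / 3) * (normal_peak s / normal_peak (2 * s)) * normal_pdf 0 (2 * s) z.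
Proof.
have s20 : 2 * s != 0 by rewrite mulf_neq0// pnatr_eq0.
rewrite pE normal_pdfE// /normal_fun subr0.
have pk := normal_peak_gt0 s20; have pk1 := normal_peak_gt0 s0.
set a := - z ^+ 2 / ((2 * s) ^+ 2 *+ 2).
have -> : - z ^+ 2 / (s ^+ 2 *+ 2) = a + - (3 * z ^+ 2 / (8 * s ^+ 2)).
  have e1 : s ^+ 2 *+ 2 = 2 * s ^+ 2 by rewrite mulr_natl.
  have e2 : (2 * s) ^+ 2 *+ 2 = 8 * s ^+ 2 by rewrite exprMn -mulr_natl; ring.
  by rewrite /a e1 e2; field.
rewrite expRD.
have y0 : 0 <= 3 * z ^+ 2 / (8 * s ^+ 2).
  by apply: divr_ge0; apply: mulr_ge0 => //; rewrite ?sqr_ge0// ltW.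
have h := expRN_inv y0.
have -> : (1 + s ^+ 2 * 8 / 3) * (normal_peak s / normal_peak (2 * s)) *
  (normal_peak (2 * s) * expR a) = (1 + s ^+ 2 * 8 / 3) * (normal_peak s * expR a).
  by field; rewrite gt_eqF.
have -> : `|z| * (normal_peak s * (expR a * expR (- (3 * z ^+ 2 / (8 * s ^+ 2))))) =
   (`|z| * expR (- (3 * z ^+ 2 / (8 * s ^+ 2)))) * (normal_peak s * expR a) by ring.
apply: ler_wpM2r; first by rewrite mulr_ge0 ?expR_ge0// ltW.
apply: (@le_trans _ _ (`|z| * (1 + 3 * z ^+ 2 / (8 * s ^+ 2))^-1)).
  by rewrite ler_wpM2l.
rewrite ler_pdivrMr; last by lra.
have : `|z| <= 1 + z ^+ 2.
  rewrite -(real_normK (num_real z)); move: `|z| (normr_ge0 z) => u u0.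
  have : 0 <= (u - 2^-1) ^+ 2 by rewrite sqr_ge0.
  by rewrite sqrrB; lra.
move=> h1; apply: (le_trans h1).
have -> : (1 + s ^+ 2 * 8 / 3) * (1 + 3 * z ^+ 2 / (8 * s ^+ 2)) =
  1 + z ^+ 2 + (s ^+ 2 * 8 / 3 + 3 * z ^+ 2 / (8 * s ^+ 2)) by field.
by rewrite lerDl addr_ge0// divr_ge0// mulr_ge0// ltW.
Qed.

Let izp : leb.-integrable setT (EFin \o (fun z => `|z| * p z)).
Proof.
apply: (@le_integrable _ _ _ leb setT measurableT _ (fun z => ((1 + s ^+ 2 * 8 / 3) * (normal_peak s / normal_peak (2 * s)))%:E * (normal_pdf 0 (2 * s) z)%:E)%E).
- by apply/measurable_EFinP; apply: measurable_funM.
- move=> z _; rewrite -EFinM /= lee_fin ger0_norm ?mulr_ge0//.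
  by apply: (le_trans (zp_le z)); exact: ler_norm.
- by apply: integrableZl => //; exact: integrable_normal_pdf.
Qed.

Let F th x := \int[leb]_z (cos (x * z + th) * p z).

Let icos x th : leb.-integrable setT (EFin \o (fun z => cos (x * z + th) * p z)).
Proof.
apply: (@le_integrable _ _ _ leb setT measurableT _ (EFin \o p)) => //.
- apply/measurable_EFinP; apply: measurable_funM => //; by case: (bmeas_cos x th).
- move=> z _; rewrite /= lee_fin normrM ler_piMl//; exact: cos_max.
Qed.

Let izsin x th : leb.-integrable setT (EFin \o (fun z => z * sin (x * z + th) * p z)).
Proof.
apply: (@le_integrable _ _ _ leb setT measurableT _ (EFin \o (fun z => `|z| * p z))) => //.
- apply/measurable_EFinP; apply: measurable_funM => //; apply: measurable_funM => //.
  by case: (bmeas_sin x th).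
- move=> z _; rewrite /= lee_fin !normrM normr_id ler_wpM2r// ler_piMr//; exact: sin_max.
Qed.

(** Integration by parts on the line: the primitive h = s^2 sin(x z + th) p(z) tends to 0 at both
    ends, so the integral of its derivative is 0. *)
Let parts x th : \int[leb]_z (z * sin (x * z + th) * p z) = s ^+ 2 * x * F th x.
Proof.
pose h z := s ^+ 2 * (sin (x * z + th) * p z).
pose h' z := s ^+ 2 * x * (cos (x * z + th) * p z) - z * sin (x * z + th) * p z.
have hh' (z : R) : is_derive z 1 h (h' z).
  have H := @is_deriveM R _ _ _ z 1 _ _ (is_derive_sin_affine x th z) (is_derive_p z).
  have H2 := @is_deriveZ R R R _ (s ^+ 2) z 1 _ H.
  apply: (is_derive_eq H2); rewrite /h' /GRing.scale /=.
  by field.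
have ch' : continuous h'.
  move=> z; apply: cvgB; apply: cvgM; first exact: cvg_cst.
  - by apply: cvgM; [exact: continuous_cos_affine|exact: cp].
  - by apply: cvgM; [exact: cvg_id|exact: continuous_sin_affine].
  - exact: cp.
have ih' : leb.-integrable setT (EFin \o h').
  have i1 : leb.-integrable setT (fun z => (s ^+ 2 * x)%:E * (cos (x * z + th) * p z)%:E)%E.
    by apply: integrableZl => //; exact: icos.
  exact: (integrableB measurableT i1 (izsin x th)).
have int0 : (\int[leb]_z (h' z)%:E = 0)%E.
  have c1 : (\int[leb]_(z in `[(- n.+1%:R)%R, n.+1%:R%R]) (h' z)%:E @[n --> \oo] --> \int[leb]_z (h' z)%:E)%E.
    under eq_fun do rewrite integral_mkcond.
    apply: (@dominated_cvg _ _ _ leb setT measurableT _ _ (fun z => `|h' z|%:E)) => //.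
    - move=> n; apply/(measurable_restrict _ _ _).1 => //; apply/measurable_EFinP/measurable_funTS.
      exact: continuous_measurable_fun.
    - move=> z _; apply: cvg_near_cst; near=> n; rewrite patchE ifT// inE /= in_itv /=.
      rewrite -ler_norml; apply: (@le_trans _ _ (n%:R : R)); last by rewrite ler_nat.
      by near: n; exact: nbhs_infty_ger.
    - have /integrable_norm := ih'; exact.
    - move=> n z _; rewrite patchE; case: ifP => _; first by rewrite /= lexx.
      by rewrite abse0 lee_fin normr_ge0.
  have c2 : (\int[leb]_(z in `[(- n.+1%:R)%R, n.+1%:R%R]) (h' z)%:E @[n --> \oo] --> 0)%E.
    have E n : (\int[leb]_(z in `[(- n.+1%:R)%R, n.+1%:R%R]) (h' z)%:E = (h n.+1%:R - h (- n.+1%:R))%:E)%E.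
      apply: FTC_C1 => //; have : (0 : R) < n.+1%:R by rewrite ltr0n.
      lra.
    under eq_fun do rewrite E.
    apply: cvg_EFin; first exact: nearW.
    have pN (z : R) : p (- z) = p z by rewrite !pE sqrrN.
    have pb n : p n.+1%:R <= normal_peak s * (s ^+ 2 *+ 2) * harmonic n.
      rewrite pE /= -mulrA ler_wpM2l ?normal_peak_ge0// mulNr.
      set N := (n.+1%:R : R); have N1 : 1 <= N by rewrite ler1n.
      have s22 : 0 < s ^+ 2 *+ 2 by rewrite pmulrn_lgt0.
      have y0 : 0 < N ^+ 2 / (s ^+ 2 *+ 2) by rewrite divr_gt0// exprn_gt0//; lra.
      apply: (le_trans (expRN_inv (ltW y0))).
      apply: (@le_trans _ _ (N ^+ 2 / (s ^+ 2 *+ 2))^-1).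
        by rewrite lef_pV2 ?posrE//; lra.
      rewrite invfM invrK mulrC ler_wpM2l ?(ltW s22)// lef_pV2 ?posrE ?exprn_gt0//; try lra.
      by rewrite expr2 ler_peMl//; lra.
    have hb n : `|h n.+1%:R - h (- n.+1%:R)| <= 2 * s ^+ 2 * (normal_peak s * (s ^+ 2 *+ 2)) * harmonic n.
      have hz z : `|h z| <= s ^+ 2 * p z.
        rewrite /h normrM (ger0_norm (ltW s2)) ler_wpM2l ?(ltW s2)// normrM (ger0_norm (p_ge0 z)).
        by rewrite ler_piMl//; exact: sin_max.
      apply: (le_trans (ler_normB _ _)); apply: (le_trans (lerD (hz _) (hz _))).
      rewrite pN -mulrDr; have := pb n; move: (p _) (harmonic n) => u v uv.
      rewrite (_ : 2 * s ^+ 2 * _ * v = s ^+ 2 * (2 * (normal_peak s * (s ^+ 2 *+ 2) * v))); last by ring.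
      by rewrite ler_wpM2l ?(ltW s2)//; lra.
    apply: norm_cvg0; apply: (@squeeze_cvgr _ _ _ _ (cst 0) _ _ _ _ (cvg_cst 0) _).
      by apply: nearW => n; rewrite normr_ge0 /=; exact: hb.
    rewrite -[X in _ --> X](mulr0 (2 * s ^+ 2 * (normal_peak s * (s ^+ 2 *+ 2)))).
    by apply: cvgM; [exact: cvg_cst|exact: cvg_harmonic].
  exact: (cvg_unique _ c1 c2).
have : \int[leb]_z h' z = 0 by rewrite /Rintegral int0.
rewrite RintegralB//; last first.
  by rewrite /comp; under eq_fun do rewrite EFinM; apply: integrableZl => //; exact: icos.
rewrite RintegralZl//.
by move/eqP; rewrite subr_eq0 => /eqP <-.
Unshelve. all: by end_near. Qed.

(** Differentiation under the integral sign, dominated by |z| p(z), followed by [parts]: F' = -s^2 x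
    F. *)
Let dF (x : R) th : is_derive x 1 (F th) (- (s ^+ 2 * x * F th x)).
Proof.
rewrite -parts.
have Ix : (`]x - 1, x + 1[ : set R) x by rewrite /= in_itv /=; lra.
have der (y z : R) : is_derive y 1 (fun y => cos (y * z + th) * p z) (- (z * sin (y * z + th) * p z)).
  have H := @is_deriveZ R R R _ (p z) y 1 _ (is_derive_cos_affine z th y).
  have E : (fun y => cos (y * z + th) * p z) = (p z \*: (fun y : R => cos (z * y + th))).
    by apply/funext => u; rewrite /GRing.scale /= /GRing.scale /= mulrC (mulrC u).
  by rewrite E; apply: (is_derive_eq H); rewrite /GRing.scale /= (mulrC y); ring.
have intf y : (`]x - 1, x + 1[ : set R) y -> leb.-integrable setT (EFin \o (fun z => cos (y * z + th) * p z)).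
  by move=> _; exact: icos.
have derf y z : (`]x - 1, x + 1[ : set R) y -> setT z -> derivable ((fun y z => cos (y * z + th) * p z)^~ z) y 1.
  by move=> _ _; case: (der y z).
have Gub y z : (`]x - 1, x + 1[ : set R) y -> setT z ->
   `|partial1of2 (fun y z => cos (y * z + th) * p z) y z| <= `|z| * p z.
  move=> _ _; rewrite partial1of2E; have [_ ->] := der y z.
  by rewrite normrN !normrM (ger0_norm (p_ge0 z)) ler_wpM2r// ler_piMr//; exact: sin_max.
have G0 z : 0 <= `|z| * p z by rewrite mulr_ge0.
apply: DeriveDef.
  exact: (derivable_under_integral measurableT Ix intf derf G0 izp Gub).
rewrite -derive1E (differentiation_under_integral measurableT Ix intf derf G0 izp Gub).
have -> : (fun z : R => (fun z0 => partial1of2 (fun y z => cos (y * z + th) * p z) ^~ z0) z x) =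
   (fun z => -1 * (z * sin (x * z + th) * p z)).
  by apply/funext => z; rewrite partial1of2E; have [_ ->] := der x z; rewrite mulN1r.
rewrite RintegralZl ?mulN1r//; exact: izsin.
Qed.

Lemma has_cf_normal : has_cf (normal_prob 0 s) (fun x => expR (- (s ^+ 2 * x ^+ 2 / 2))).
Proof.
move=> x th; rewrite /Rintegral (@integral_density _ _ p) //; last first.
- exact: bmeas_cos.
- exact: normal_prob_dominates.
rewrite -[fine _]/(F th x).
(* Multiplying by the inverse of the expected solution leaves a function with zero derivative. *)
pose G x := F th x * expR (s ^+ 2 / 2 * x ^+ 2).
have dG (y : R) : is_derive y 1 G 0.
  have H1 := is_derive_powM (s ^+ 2 / 2) 1 y.
  have H2 := @is_derive1_comp _ expR _ y _ _ (is_derive_expR (s ^+ 2 / 2 * y ^+ 2)) H1.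
  have H := @is_deriveM R _ _ _ y 1 _ _ (dF y th) H2.
  by apply: (is_derive_eq H); rewrite /GRing.scale /=; field.
have G0 : G x = G 0 by apply: is_derive_0_is_cst.
have F0 : F th 0 = cos th.
  rewrite /F; under eq_Rintegral do rewrite mul0r add0r.
  by rewrite RintegralZl// /Rintegral integral_normal_pdf /= mulr1.
move: G0; rewrite /G F0 expr0n /= mulr0 expR0 mulr1 => <-.
rewrite -[RHS]mulrA -expRD (_ : _ + _ = 0) ?expR0 ?mulr1//; by field.
Qed.

End NormalCharacteristicFunction.

Definition mkRV {d} {T : measurableType d} {R : realType} (P : probability T R)
    (f : T -> R) (mf : measurable_fun setT f) : {RV P >-> R} :=
  HB.pack_for {mfun T >-> R} f (isMeasurableFun.Build _ _ _ _ f mf).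

(** * Laws, independence and characteristic functions of sums *)

Section Laws.
Context {R : realType}.
Local Notation RR := (measurableTypeR R).

Lemma prod_measure_unique {d1 d2 : measure_display} {T1 : measurableType d1}
    {T2 : measurableType d2} (m1 m2 : {measure set (T1 * T2) -> \bar R}) :
  (m1 setT < +oo)%E ->
  (forall A B, measurable A -> measurable B -> m1 (A `*` B) = m2 (A `*` B)) ->
  forall X, measurable X -> m1 X = m2 X.
Proof.
move=> fin m12 X mX.
pose C : set (set (T1 * T2)) := [set A `*` B | A in measurable & B in measurable].
apply: (measure_unique C (fun=> setT)) => //.
- exact: measurable_prod_measurableType.
- move=> _ _ [A1 mA1 [A2 mA2 <-]] [B1 mB1 [B2 mB2 <-]]; rewrite -setXI.
  by exists (A1 `&` B1); [exact: measurableI|exists (A2 `&` B2); [exact: measurableI|]].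
- by move=> _; exists setT => //; exists setT => //; rewrite setXTT.
- by rewrite bigcup_const.
- by move=> _ [A mA [B mB <-]]; exact: m12.
Qed.

Context {d : measure_display} {T : measurableType d} {P : probability T R}.
Implicit Types X Y Z : {RV P >-> R}.

(* R and measurableTypeR R have the same measurable sets but different displays. *)
Definition toRR X : {mfun T >-> RR} :=
  HB.pack_for {mfun T >-> RR} (X : T -> RR)
    (isMeasurableFun.Build _ _ T RR X (measurable_funPT X)).

Definition law X : probability RR R := distribution P (toRR X).

Lemma law_Rintegral X (mu : probability RR R) (f : R -> R) : has_law X mu ->
  bmeas (f : RR -> R) -> \int[mu]_y f y = \int[P]_w f (X w).
Proof.
move=> XL bf; have [mf [M fM]] := bf.
have bfX : bmeas (f \o X).
  split; first by apply: measurableT_comp => //.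
  by exists M => y; exact: fM.
rewrite /Rintegral (@eq_measure_integral _ _ _ _ (law X)); last first.
  by move=> A mA _; exact/esym/XL.
rewrite (@integral_distribution _ _ _ _ _ P (toRR X))//; first exact/measurable_EFinP.
exact: (bmeas_integrable P bfX).
Qed.

Definition indep2 X Y : Prop := forall A B : set RR, measurable A -> measurable B ->
  P (X @^-1` A `&` Y @^-1` B) = (P (X @^-1` A) * P (Y @^-1` B))%E.

Lemma independent_indep2 X Y : independent X Y -> indep2 X Y.
Proof.
move=> XY A B mA mB.
have := XY [:: true; false] (fun b => if b then A else B) isT.
rewrite !big_cons big_nil mule1 => <-; last by case.
congr (P _); apply/seteqP; split => w /=.
  by move=> [XA YB] b _; case: b.
by move=> h; split; [exact: (h true (mem_head _ _))|exact: (h false)].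
Qed.

Lemma measurable_RV_preimage X (A : set RR) : measurable A -> measurable (X @^-1` A).
Proof. by move=> mA; rewrite -[X in measurable X]setTI; exact: (measurable_funPT X). Qed.

Definition pairRV X Y : {mfun T >-> (RR * RR)%type} :=
  HB.pack_for {mfun T >-> (RR * RR)%type} (fun w => (X w, Y w))
    (isMeasurableFun.Build _ _ T (RR * RR)%type (fun w => (X w, Y w))
      (@measurable_fun_pair _ _ _ T RR RR (toRR X) (toRR Y)
         (measurable_funPT (toRR X)) (measurable_funPT (toRR Y)))).

Lemma indep2_prod X Y : indep2 X Y -> forall B : set (RR * RR), measurable B ->
  distribution P (pairRV X Y) B = (law X \x law Y)%E B.
Proof.
move=> XY B mB; apply/esym.
by apply: (@product_measure_unique _ _ _ _ _ (law X) (law Y) (distribution P (pairRV X Y))) => // A C mA mC; exact: XY.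
Qed.

Definition RV_cf X (phi : R -> R) : Prop :=
  forall x th : R, \int[P]_w cos (x * X w + th) = cos th * phi x.

Lemma has_law_cf X mu phi : has_law X mu -> has_cf mu phi <-> RV_cf X phi.
Proof.
move=> XL; split=> h x th; first by rewrite -h (law_Rintegral XL)//; exact: bmeas_cos.
by rewrite -h (law_Rintegral XL)//; exact: bmeas_cos.
Qed.

(** By Fubini, integrating over Y with X = a fixed is an instance of the hypothesis on Y at the
    phase x a + th; the result is again a cosine in a. *)
Lemma indep2_sum_cf X Y Z phi psi : (forall w, Z w = X w + Y w) -> indep2 X Y ->
  RV_cf X phi -> RV_cf Y psi -> RV_cf Z (fun x => phi x * psi x).
Proof.
move=> ZE XY Xphi Ypsi x th.
have -> : (fun w => cos (x * Z w + th)) = (fun w => cos (x * (X w + Y w) + th)).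
  by apply/funext => w; rewrite ZE.
pose g (z : RR * RR) : R := cos (x * (z.1 + z.2) + th).
pose f (z : RR * RR) := (g z)%:E.
have mg : measurable_fun setT g.
  apply: (@measurableT_comp _ _ _ _ _ _ (fun y : RR => cos (x * y + th))); first by case: (bmeas_cos x th).
  by apply: measurable_funD; [exact: measurable_fst|exact: measurable_snd].
have mf : measurable_fun setT f by exact/measurable_EFinP.
have bZ : P.-integrable setT (f \o pairRV X Y).
  have bg : bmeas (g \o pairRV X Y).
    split; first by apply: measurableT_comp => //; exact: (measurable_funPT (pairRV X Y)).
    by exists 1 => w; exact: cos_max.
  exact: (bmeas_integrable P bg).
have fin : (law X \x law Y)%E.-integrable setT f.
  apply: (@le_integrable _ _ _ _ _ _ _ (cst 1%E)) => //.
    by move=> z _; rewrite /f /= lee_fin normr1; exact: cos_max.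
  apply/integrableP; split; first exact: measurable_cst.
  rewrite integral_cst//= normr1 mul1e -[setT]setXTT product_measure1E//.
  apply: (@le_lt_trans _ _ (1 * 1)%E); last by rewrite mule1 ltry.
  by apply: lee_pmul => //; exact: probability_le1.
have XL : has_law X (law X) by [].
have YL : has_law Y (law Y) by [].
have cX := (has_law_cf phi XL).2 Xphi; have cY := (has_law_cf psi YL).2 Ypsi.
rewrite {1}/Rintegral -[X in fine X]/(\int[P]_w (f \o pairRV X Y) w)%E.
rewrite -integral_distribution//.
rewrite (@eq_measure_integral _ _ _ _ (law X \x law Y)%E); last first.
  by move=> B mB _; exact: indep2_prod.
rewrite -integral12_prod_meas1// /fubini_F.
have ce (u v : R) : x * v + (x * u + th) = x * (u + v) + th by ring.
have E a : (\int[law Y]_b f (a, b) = (psi x * cos (x * a + th))%:E)%E.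
  rewrite /f /= -[LHS]fineK; last first.
    apply: integrable_fin_num => //.
    have := bmeas_integrable (law Y) (bmeas_cos x (x * a + th)).
    by apply: eq_integrable => // b _; rewrite /g /=; congr (cos _)%:E; exact: ce.
  rewrite (mulrC (psi x)) -(cY x (x * a + th)) /Rintegral; congr (fine _)%:E.
  by apply: eq_integral => b _; rewrite /g /=; congr (cos _)%:E; exact/esym/ce.
under eq_integral do rewrite E.
rewrite -[fine _]/(\int[law X]_a (psi x * cos (x * a + th))) RintegralZl//; last first.
  exact: bmeas_integrable (bmeas_cos _ _).
by rewrite cX; ring.
Qed.

Section PartialSums.
Variable U : nat -> {RV P >-> R}.
Hypothesis Uind : mutually_independent U.

Definition psum (j : nat) : {RV P >-> R} :=
  mkRV P (measurable_sum (index_enum 'I_j) (fun k : 'I_j => measurable_funPT (U k))).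

Lemma psumE j w : psum j w = \sum_(k < j) U k w.
Proof. by []. Qed.

Let ev (s : seq nat) (A : nat -> set RR) := \bigcap_(i in [set` s]) (U i @^-1` A i).

Let mev s A : (forall i, measurable (A i)) -> measurable (ev s A).
Proof.
move=> mA; rewrite /ev bigcap_seq; apply: bigsetI_measurable => i _.
exact: measurable_RV_preimage.
Qed.

(** The tail event on the variables of index at least j is carried along so that the next variable
    can be moved out of it and into the partial sum. *)
Lemma psum_indep j (s : seq nat) (A : nat -> set RR) (B : set RR) :
  uniq s -> {in s, forall i, (j <= i)%N} -> (forall i, measurable (A i)) -> measurable B ->
  P (psum j @^-1` B `&` ev s A) = (P (psum j @^-1` B) * P (ev s A))%E.
Proof.
elim: j s A B => [|j IH] s A B us js mA mB.
  have [B0|B0] := pselect (B 0).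
    have -> : psum 0 @^-1` B = setT.
      by apply/seteqP; split => w // _; rewrite /= big_ord0.
    by rewrite setTI probability_setT mul1e.
  have -> : psum 0 @^-1` B = set0.
    by apply/seteqP; split => w //; rewrite /= big_ord0.
  by rewrite set0I measure0 mul0e.
have mE := mev s mA.
have pE_ge0 : 0 <= fine (P (ev s A)) by rewrite fine_ge0.
(* [m1] is the law of the pair (partial sum, next variable) restricted to the tail event, [m2] the
   unrestricted law scaled by the probability of that event. They agree on rectangles by the
   induction hypothesis, hence also on the set of pairs whose sum lies in B. *)
pose m0 : {measure set (RR * RR) -> \bar R} :=
  pushforward (mrestr P mE) (pairRV (psum j) (U j)).
pose m1 := m0 (measurable_funPT (pairRV (psum j) (U j))).
pose m2 : {measure set (RR * RR) -> \bar R} := mscale (NngNum pE_ge0) (distribution P (pairRV (psum j) (U j))).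
have PEfin : P (ev s A) = (fine (P (ev s A)))%:E by rewrite fineK// fin_num_measure.
have jns : j \notin s by apply/negP => /js; rewrite ltnn.
have evS (A2 : set RR) A' : (forall i, A' i = if i == j then A2 else A i) ->
    ev (j :: s) A' = U j @^-1` A2 `&` ev s A.
  move=> A'E; apply/seteqP; split => w.
    move=> h; split; first by have := h j (mem_head _ _); rewrite A'E eqxx.
    move=> i /= si; have := h i; rewrite /= in_cons si orbT A'E => /(_ isT).
    by case: eqP => // ij; move: jns; rewrite -ij si.
  move=> [h1 h2] i /=; rewrite in_cons A'E; case: eqP => [-> _//|_ /= si].
  exact: h2.
have m12 : forall A1 A2, measurable A1 -> measurable A2 -> m1 (A1 `*` A2) = m2 (A1 `*` A2).
  move=> A1 A2 mA1 mA2.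
  pose A' i := if i == j then A2 else A i.
  have mA' i : measurable (A' i) by rewrite /A'; case: ifP.
  have ujs : uniq (j :: s) by rewrite /= jns.
  have ge (t : seq nat) : {in t, forall i, (j < i)%N} -> {in j :: t, forall i, (j <= i)%N}.
    by move=> ht i; rewrite in_cons => /predU1P[->//|/ht/ltnW].
  have e1 := IH (j :: s) A' A1 ujs (ge _ js) mA' mA1.
  have e2 := IH [:: j] A' A1 isT (ge [::] (fun i => fun h => match notF h with end)) mA' mA1.
  rewrite (evS A2) // in e1.
  have evj : ev [:: j] A' = U j @^-1` A2.
    apply/seteqP; split => w.
      by move=> /(_ j (mem_head _ _)); rewrite /= /A' eqxx.
    by move=> h i /=; rewrite inE => /eqP ->; rewrite /A' eqxx.
  rewrite evj in e2.
  have e3 : P (U j @^-1` A2 `&` ev s A) = (P (U j @^-1` A2) * P (ev s A))%E.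
    have := Uind ujs mA'; rewrite -/(ev _ _) (evS A2)// big_cons => ->.
    rewrite {1}/A' eqxx; congr (_ * _)%E; rewrite /ev Uind//.
    by apply: eq_big_seq => i si; rewrite /A'; case: eqP => // ij; move: jns; rewrite -ij si.
  rewrite /m1 /m0 /m2 /= /pushforward /mrestr /mscale /= -setIA.
  rewrite [LHS]e1 e3 -PEfin muleA muleC; congr (_ * _)%E.
  exact/esym/e2.
have m1fin : (m1 setT < +oo)%E.
  rewrite /m1 /m0 /= /pushforward /mrestr /=; apply: le_lt_trans (ltry 1).
  by apply: probability_le1; rewrite preimage_setT setTI.
pose D : set (RR * RR) := (fun z => z.1 + z.2) @^-1` B.
have mD : measurable D.
  rewrite -[D]setTI.
  by apply: (measurable_funD (@measurable_fst _ _ RR RR) (@measurable_snd _ _ RR RR)).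
have e : pairRV (psum j) (U j) @^-1` D = psum j.+1 @^-1` B.
  by apply/seteqP; split => w /=; rewrite /D /= big_ord_recr.
transitivity (m1 D).
  by rewrite /m1 /m0 /= /pushforward /mrestr; congr (P (_ `&` _)); exact/esym/e.
rewrite (prod_measure_unique m1fin m12 mD) /m2 /= /mscale /= -PEfin muleC.
by congr (P _ * _)%E; exact: e.
Qed.

Lemma psum_cf (phi : nat -> R -> R) j : (forall k, RV_cf (U k) (phi k)) ->
  RV_cf (psum j) (fun x => \prod_(k < j) phi k x).
Proof.
move=> Uphi; elim: j => [|j IH] x th.
  under eq_Rintegral do rewrite psumE big_ord0 mulr0 add0r.
  by rewrite Rintegral_prob_cst big_ord0 mulr1.
have hsum w : psum j.+1 w = psum j w + U j w by rewrite !psumE big_ord_recr.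
suff ind : indep2 (psum j) (U j).
  by rewrite (indep2_sum_cf hsum ind IH (Uphi j)) big_ord_recr.
move=> A B mA mB; have := @psum_indep j [:: j] (fun=> B) A isT.
have -> : ev [:: j] (fun=> B) = U j @^-1` B.
  apply/seteqP; split => w; first by move=> /(_ j (mem_head _ _)).
  by move=> h i /=; rewrite inE => /eqP ->.
by apply => // i; rewrite inE => /eqP ->.
Qed.

End PartialSums.

End Laws.

Section DustpanLaw.
Context {R : realType}.
Local Notation RR := (measurableTypeR R).
Implicit Types (t : nat -> R).

Lemma poweR_sqrt_sq (x : \bar R) : (0 <= x)%E -> (poweR x 2^-1 ^+ 2 = x)%E.
Proof.
rewrite -[X in X = _]/(poweR x 2^-1 * poweR x 2^-1)%E.
case: x => [r| |//] r0.
  rewrite poweR_EFin -EFinM powR12_sqrt// -expr2 sqr_sqrtr//.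
by rewrite poweRyr ?mulyy// invr_neq0.
Qed.

Lemma lp_norm2_sq t : (lp_norm 2 t ^+ 2 = \sum_(0 <= k <oo) (t k ^+ 2)%:E)%E.
Proof.
by rewrite /lp_norm poweR_sqrt_sq// nneseries_ge0// => k _ _; rewrite lee_fin sqr_ge0.
Qed.

Lemma partial_sum_sq t K : (\sum_(0 <= k < K) (t k ^+ 2)%:E = (\sum_(k < K) t k ^+ 2)%:E)%E.
Proof. by rewrite sumEFin big_mkord. Qed.

Lemma predust_dustpan t : predust t -> dustpan t.
Proof.
move=> [t0 td t12]; split => //; rewrite lp_norm2_sq.
apply: lime_le; first by apply: is_cvg_nneseries => k _ _; rewrite lee_fin sqr_ge0.
by apply: nearW => K; rewrite partial_sum_sq lee_fin.
Qed.

Lemma dustpan_predust t : dustpan t -> predust t.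
Proof.
move=> [t0 td]; rewrite lp_norm2_sq => t12; split => // K.
rewrite -lee_fin -partial_sum_sq; apply: le_trans t12.
by apply: nneseries_lim_ge => k _ _; rewrite lee_fin sqr_ge0.
Qed.

Lemma dustpan_cvg_sq t : dustpan t ->
  \sum_(k < K) t k ^+ 2 @[K --> \oo] --> fine (lp_norm 2 t ^+ 2)%E.
Proof.
move=> [t0 td]; rewrite lp_norm2_sq => t12.
have c : (\sum_(0 <= k < K) (t k ^+ 2)%:E @[K --> \oo] --> \sum_(0 <= k <oo) (t k ^+ 2)%:E)%E.
  by apply: is_cvg_nneseries => k _ _; rewrite lee_fin sqr_ge0.
have fin : (\sum_(0 <= k <oo) (t k ^+ 2)%:E)%E \is a fin_num.
  rewrite ge0_fin_numE; first exact: le_lt_trans t12 (ltry _).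
  by apply: nneseries_ge0 => k _ _; rewrite lee_fin sqr_ge0.
rewrite -(fineK fin) in c; move/fine_cvgP : c => [_].
suff -> : (fine \o (fun K => \sum_(0 <= k < K) (t k ^+ 2)%:E)%E) = (fun K => \sum_(k < K) t k ^+ 2) by [].
by apply/funext => K; rewrite /= partial_sum_sq.
Qed.

Lemma dustpan_var_ge0 t : dustpan t -> 0 <= 1 - fine (lp_norm 2 t ^+ 2)%E / 12.
Proof.
move=> dt; have [_ _ t12] := dt; rewrite subr_ge0 ler_pdivrMr// mul1r.
have h := dustpan_cvg_sq dt; have [_ _ p12] := dustpan_predust dt.
by apply: (cvgr_to_le h); apply: nearW => K; exact: p12.
Qed.

Lemma has_cf_centered_normal (s : R) :
  has_cf (centered_normal s) (fun x => expR (- (s ^+ 2 * x ^+ 2 / 2))).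
Proof.
rewrite /centered_normal; case: eqVneq => [->|s0]; last exact: has_cf_normal.
by move=> x th; rewrite has_cf_dirac0 expr0n /= !mul0r oppr0 expR0.
Qed.

(** Dominated convergence passes the products of sinc to the almost sure sum S, and the independent
    normal contributes the exponential. The truncations defining [dcf] have the same limit, because
    their variance converges to that of Z. *)
Lemma dustpan_law_cf t (mu : probability RR R) :
  dustpan t -> dustpan_law t mu -> has_cf mu (dcf t).
Proof.
move=> dt [d [T [P [U [S [Z [[Uind Ulaw] Scvg Zlaw SZ SZlaw]]]]]]].
have pt := dustpan_predust dt; have [t0 _ _] := pt.
pose a (K : nat) (x : R) := \prod_(k < K) sinc (t k * x / 2).
have Ucf k : RV_cf (U k) (fun x => sinc (t k * x / 2)).
  by apply/(has_law_cf _ (Ulaw k)); exact: has_cf_centered_uniform.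
have Scf : forall x th, a K x * cos th @[K --> \oo] --> \int[P]_w cos (x * S w + th).
  move=> x th; under eq_fun do rewrite mulrC -(psum_cf Uind _ Ucf).
  have mcos (Y : {RV P >-> R}) : measurable_fun setT (fun w => cos (x * Y w + th)).
    apply: (@measurableT_comp _ _ _ _ _ _ (fun y : RR => cos (x * y + th)) setT (toRR Y)) => //.
    by case: (bmeas_cos x th).
  have := @dominated_convergence _ _ _ P setT measurableT
    (fun K w => (cos (x * psum U K w + th))%:E) (fun w => (cos (x * S w + th))%:E) (cst 1%E).
  case.
  - by move=> K; apply/measurable_EFinP; exact: mcos.
  - by apply/measurable_EFinP; exact: mcos.
  - apply: filterS Scvg => w Sw _; apply: cvg_EFin; first exact: nearW.
    have c : continuous (fun y : R => cos (x * y + th)) by exact: continuous_cos_affine.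
    exact: (continuous_cvg _ (c (S w)) Sw).
  - exact: finite_measure_integrable_cst.
  - by apply: aeW => w K _; rewrite lee_fin; exact: cos_max.
  - move=> iS _ h; apply: fine_cvg; rewrite fineK; first exact: h.
    exact: integrable_fin_num.
pose psi x := \int[P]_w cos (x * S w + 0).
have acvg x : a K x @[K --> \oo] --> psi x.
  by have := Scf x 0; under eq_fun do rewrite cos0 mulr1.
have Spsi : RV_cf S psi.
  move=> x th; have h : a K x * cos th @[K --> \oo] --> cos th * psi x.
    by rewrite mulrC; apply: cvgM; [exact: acvg|exact: cvg_cst].
  exact: (cvg_unique _ (Scf x th) h).
pose s := Num.sqrt (1 - fine (lp_norm 2 t ^+ 2)%E / 12).
have Zcf : RV_cf Z (fun x => expR (- (s ^+ 2 * x ^+ 2 / 2))).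
  by apply/(has_law_cf _ Zlaw); exact: has_cf_centered_normal.
apply/(has_law_cf _ SZlaw).
suff -> : dcf t = (fun x => psi x * expR (- (s ^+ 2 * x ^+ 2 / 2))).
  by apply: (indep2_sum_cf _ (independent_indep2 SZ) Spsi Zcf).
apply/funext => x; apply/cvg_lim => //; apply: cvgM; first exact: acvg.
apply: continuous_cvg; first exact: continuous_expR.
rewrite /s sqr_sqrtr; last exact: dustpan_var_ge0.
apply: cvgN; apply: cvgM; last exact: cvg_cst.
apply: cvgM; last exact: cvg_cst.
apply: cvgB; first exact: cvg_cst.
by apply: cvgM; [exact: dustpan_cvg_sq|exact: cvg_cst].
Qed.

End DustpanLaw.

(** * A sequence of independent uniform variables *)

Section CdfUnique.
Context {R : realType}.
Local Notation RR := (measurableTypeR R).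

(** The half-lines ]x, +oo[ are stable under intersection and generate the Borel sets. The statement
    covers finite measures because it is applied to restrictions of a probability. *)
Lemma measure_cdf_unique (m1 m2 : {measure set RR -> \bar R}) :
  (m1 setT < +oo)%E -> m1 setT = m2 setT ->
  (forall x : R, m1 `]-oo, x] = m2 `]-oo, x]) ->
  forall A, measurable A -> m1 A = m2 A.
Proof.
move=> fin mT m12 A mA.
have mI (x : R) : measurable (`]x, +oo[ : set RR) by exact: measurable_itv.
have m2fin : (m2 setT < +oo)%E by rewrite -mT.
have mN (m : {measure set RR -> \bar R}) (x : R) : (m setT < +oo)%E ->
    m `]x, +oo[ = (m setT - m `]-oo, x])%E.
  move=> mfin; have <- : setT `\` `]-oo, x] = (`]x, +oo[ : set RR).
    by rewrite setTD setCitvl.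
  by rewrite measureD ?setTI//; exact: measurable_itv.
apply: (@measure_unique _ R RR (@RGenOInfty.G R) (fun n => `](- n%:R)%R, +oo[%classic) _ _ _ _ m1 m2) => //.
- exact: RGenOInfty.measurableE.
- move=> _ _ [x ->] [y ->]; exists (Num.max x y).
  by apply/seteqP; split => z /=; rewrite !in_itv /= !andbT gt_max => /andP.
- by move=> n; exists (- n%:R).
- apply/seteqP; split => x // _; exists (Num.truncn `|x|).+1 => //=.
  rewrite in_itv /= andbT ltrNl; apply: le_lt_trans (truncnS_gt `|x|).
  by rewrite -normrN ler_norm.
- by move=> _ [x ->]; rewrite !mN// mT m12.
- by move=> n; apply: le_lt_trans fin; apply: le_measure; rewrite ?inE//; exact: measurableT.
Qed.

(** The distribution function of the uniform law on [0, 1]. *)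
Definition clamp (x : R) : R := Num.max 0 (Num.min x 1).

Lemma clampE x : clamp x = if x < 0 then 0 else if x < 1 then x else 1.
Proof.
rewrite /clamp; have [x0|x0] := ltP x 0.
  by rewrite min_l ?max_l//; lra.
by have [x1|x1] := ltP x 1; rewrite max_r//; lra.
Qed.

Lemma clamp_lt0 x : x < 0 -> clamp x = 0.
Proof. by rewrite clampE => ->. Qed.

Lemma clamp_ge1 x : 1 <= x -> clamp x = 1.
Proof. by move=> x1; rewrite clampE !ifF//; apply/negbTE; rewrite -leNgt//; lra. Qed.

Lemma clamp_id x : 0 <= x <= 1 -> clamp x = x.
Proof. by move=> /andP[x0 x1]; rewrite /clamp min_l// max_r. Qed.

Lemma uniform_cdf (a b x : R) (ab : a < b) :
  uniform_prob ab `]-oo, x] = (clamp ((x - a) / (b - a)))%:E.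
Proof.
rewrite /uniform_prob integral_uniform_pdf.
have ba : 0 < b - a by rewrite subr_gt0.
rewrite (eq_integral (fun=> (b - a)^-1%:E)); last first.
  by move=> y; rewrite inE /= !in_itv /= /uniform_pdf => -[_ ->].
rewrite integral_cst//=; last by apply: measurableI; exact: measurable_itv.
rewrite clampE ltr_pdivrMr// mul0r ltr_pdivrMr// mul1r.
have [xa|xa] := ltP (x - a) 0.
  have -> : (`]-oo, x] `&` `[a, b] : set R) = set0.
    by apply/seteqP; split => y //= []; rewrite !in_itv /=; lra.
  by rewrite measure0 mule0.
have [xb|xb] := ltP (x - a) (b - a).
  have -> : (`]-oo, x] `&` `[a, b] : set R) = `[a, x].
    apply/seteqP; split => y /=; rewrite !in_itv /=; first by move=> [? /andP[? ?]]; apply/andP.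
    by move=> /andP[? ?]; split => //; apply/andP; split => //; lra.
  rewrite lebesgue_measure_itv /= lte_fin; case: ltP => ax; first by rewrite -EFinB -EFinM mulrC.
  by rewrite mule0 (_ : x - a = 0) ?mul0r//; lra.
have -> : (`]-oo, x] `&` `[a, b] : set R) = `[a, b].
  apply/seteqP; split => y /=; rewrite !in_itv /=; first by case.
  by move=> /andP[? ?]; split; [lra|apply/andP].
by rewrite lebesgue_measure_itv /= lte_fin ab -EFinB -EFinM mulVf// gt_eqF.
Qed.

End CdfUnique.

Section Digits.
Context {R : realType}.
Local Notation RR := (measurableTypeR R).

Definition u01 : probability RR R := uniform_prob (@ltr01 R).

Lemma u01_cdf x : u01 `]-oo, x] = (clamp x)%:E.
Proof. by have := uniform_cdf x (@ltr01 R); rewrite !subr0 divr1. Qed.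

(* The first two binary digits of u. Splitting the digits of u into those of
   even and of odd rank turns one uniform variable into two independent ones. *)
Definition bit0 (u : RR) : R := if u < 2^-1 then 0 else 1.
Definition bit1 (u : RR) : R :=
  if u < 4^-1 then 0 else if u < 2^-1 then 1 else if u < 3 / 4 then 0 else 1.
Definition shift2 (u : RR) : RR := 4 * u - (2 * bit0 u + bit1 u).

Lemma measurable_if_lt (c : R) (f g : RR -> R) :
  measurable_fun setT f -> measurable_fun setT g ->
  measurable_fun setT (fun u : RR => if u < c then f u else g u).
Proof.
move=> mf mg; apply: measurable_fun_if => //.
- by apply: measurable_fun_ltr => //; exact: measurable_cst.
- exact: measurable_funTS.
- exact: measurable_funTS.
Qed.

Lemma measurable_bit0 : measurable_fun setT bit0.
Proof. by apply: measurable_if_lt; exact: measurable_cst. Qed.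

Lemma measurable_bit1 : measurable_fun setT bit1.
Proof. by do 3!(apply: measurable_if_lt; first exact: measurable_cst); exact: measurable_cst. Qed.

Lemma measurable_shift2 : measurable_fun setT (shift2 : RR -> R).
Proof.
apply: measurable_funB; first by apply: measurable_funM.
apply: measurable_funD; last exact: measurable_bit1.
by apply: measurable_funM => //; exact: measurable_bit0.
Qed.

Lemma bit0_01 u : 0 <= bit0 u <= 1.
Proof. by rewrite /bit0; case: ifP; rewrite ?lexx ?ler01. Qed.

Lemma bit1_01 u : 0 <= bit1 u <= 1.
Proof. by rewrite /bit1; do !case: ifP; rewrite ?lexx ?ler01. Qed.

Section Digit.
Variable b : RR -> R.
Hypothesis b01 : forall u, 0 <= b u <= 1.
Hypothesis mb : measurable_fun setT b.

(** The dyadic number whose i-th binary digit is read by b from the i-th pair of digits of u. *)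
Fixpoint digit_trunc (n : nat) (u : RR) : R :=
  if n is m.+1 then (b u + digit_trunc m (shift2 u)) / 2 else 0.

Lemma digit_trunc_01 n u : 0 <= digit_trunc n u <= 1.
Proof.
elim: n u => [|n IH] u /=; first by rewrite lexx ler01.
by have := b01 u; have := IH (shift2 u); lra.
Qed.

Lemma digit_trunc_nd u : nondecreasing_seq (digit_trunc ^~ u).
Proof.
apply/nondecreasing_seqP => n; elim: n u => [|n IH] u.
  by have := digit_trunc_01 1 u; case/andP.
by rewrite /= ler_wpM2r// lerD2l IH.
Qed.

Definition digit (u : RR) : R := lim (digit_trunc n u @[n --> \oo]).

Lemma cvg_digit u : digit_trunc n u @[n --> \oo] --> digit u.
Proof.
apply: nondecreasing_is_cvgn; first exact: digit_trunc_nd.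
by exists 1 => _ [n _ <-]; have /andP[] := digit_trunc_01 n u.
Qed.

Lemma digit_01 u : 0 <= digit u <= 1.
Proof.
have c := @cvg_digit u; apply/andP; split.
  by apply: (cvgr_to_ge c); apply: nearW => n; have /andP[] := digit_trunc_01 n u.
by apply: (cvgr_to_le c); apply: nearW => n; have /andP[] := digit_trunc_01 n u.
Qed.

Lemma digit_rec u : digit u = (b u + digit (shift2 u)) / 2.
Proof.
have c : digit_trunc n.+1 u @[n --> \oo] --> (b u + digit (shift2 u)) / 2.
  rewrite /=; apply: cvgM; last exact: cvg_cst.
  by apply: cvgD; [exact: cvg_cst|exact: cvg_digit].
have c2 : digit_trunc n.+1 u @[n --> \oo] --> digit u by rewrite (cvg_shiftS (digit_trunc ^~ u)); exact: cvg_digit.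
exact: (cvg_unique _ c2 c).
Qed.

Lemma measurable_digit : measurable_fun setT digit.
Proof.
apply: (@measurable_fun_cvg _ _ _ setT digit_trunc) => [n|u _]; last exact: cvg_digit.
elim: n => [|n IH] /=; first exact: measurable_cst.
apply: measurable_funM => //; apply: measurable_funD => //.
by apply: measurableT_comp => //; exact: measurable_shift2.
Qed.

End Digit.

Definition dig1 : RR -> RR := digit bit0.
Definition dig2 : RR -> RR := digit bit1.

Lemma mdig1 : measurable_fun setT dig1.
Proof. exact: (measurable_digit bit0_01 measurable_bit0). Qed.

Lemma mdig2 : measurable_fun setT dig2.
Proof. exact: (measurable_digit bit1_01 measurable_bit1). Qed.

Definition quarter (j : nat) : set RR := `[(j%:R / 4 : R), (j.+1%:R / 4 : R)[.

Lemma u01_le1_fin (A : set RR) : measurable A -> u01 A = (fine (u01 A))%:E.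
Proof. by move=> mA; rewrite fineK// fin_num_measure. Qed.

(** Identifies the image under f of the uniform law restricted to E as c times the uniform law, from
    distribution functions alone. *)
Lemma push_u01 (f : RR -> RR) (E : set RR) (c : R) :
  measurable_fun setT f -> measurable E -> 0 <= c -> u01 E = c%:E ->
  (forall x : R, u01 (f @^-1` `]-oo, x] `&` E) = (c * clamp x)%:E) ->
  forall A : set RR, measurable A -> u01 (f @^-1` A `&` E) = (c%:E * u01 A)%E.
Proof.
move=> mf mE c0 Ec h A mA.
pose m0 : {measure set RR -> \bar R} := pushforward (mrestr u01 mE) f.
pose m1 := m0 mf.
pose m2 : {measure set RR -> \bar R} := mscale (NngNum c0) u01.
have m1T : m1 setT = c%:E by rewrite /m1 /m0 /= /pushforward /mrestr preimage_setT setTI.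
have m2T : m2 setT = c%:E.
  rewrite /m2 /= /mscale /= (_ : uniform_prob _ _ = 1%E) ?mule1//.
  exact: (probability_setT u01).
apply: (@measure_cdf_unique _ m1 m2) => //; first by rewrite m1T ltry.
  by rewrite m1T m2T.
by move=> x; rewrite /m1 /m0 /= /pushforward /mrestr h /m2 /= /mscale /= EFinM -u01_cdf.
Qed.

Lemma u01_sub01 (B : set RR) : measurable B -> B `<=` `[0, 1] -> u01 B = lebesgue_measure B.
Proof.
move=> mB B01; rewrite -[LHS]/(uniform_prob _ B) /uniform_prob.
rewrite (eq_integral (fun=> 1%E)) ?integral_cst ?mul1e//.
move=> y; rewrite inE => /B01 /=; rewrite in_itv /= /uniform_pdf => ->.
by rewrite subr0 invr1.
Qed.

Lemma measurable_quarter j : measurable (quarter j).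
Proof. exact: measurable_itv. Qed.

Lemma bits_quarter (j : 'I_4) u : quarter j u -> bit0 u = (j./2)%:R /\ bit1 u = (odd j)%:R.
Proof.
rewrite /quarter /= in_itv /= /bit0 /bit1.
case: j => [[|[|[|[|//]]]]] /= _ /andP[h1 h2]; split;
  case: (ltP u 2^-1) => ?; case: (ltP u 4^-1) => ?; case: (ltP u (3 / 4)) => ? //=; lra.
Qed.

Lemma shift2_quarterE (j : 'I_4) u : quarter j u -> shift2 u = 4 * u - j%:R.
Proof.
move=> /bits_quarter[b0 b1]; rewrite /shift2 b0 b1; congr (_ - _).
by case: j {b0 b1} => [[|[|[|[|//]]]]] /= _; ring.
Qed.

(** Each quarter is mapped affinely onto [0, 1[. This self-similarity is the source of the
    functional equation for the joint law of the two digit sequences. *)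
Lemma shift2_quarter (j : 'I_4) (A : set RR) : measurable A ->
  u01 (shift2 @^-1` A `&` quarter j) = (4^-1%:E * u01 A)%E.
Proof.
have j4 : (j.+1%:R : R) <= 4 by rewrite (ler_nat R j.+1 4).
have jS : (j.+1%:R : R) = j%:R + 1 by rewrite natr1.
have j0 : 0 <= (j%:R : R) by rewrite ler0n.
have sub (B : set RR) : B `<=` quarter j -> B `<=` `[0, 1].
  by move=> Bq u /Bq; rewrite /quarter /= !in_itv /= => /andP[? ?]; apply/andP; split; lra.
apply: push_u01 => //.
- exact: measurable_shift2.
- exact: measurable_quarter.
- rewrite u01_sub01; [|exact: measurable_quarter|exact: sub].
  rewrite /quarter lebesgue_measure_itv /= lte_fin ifT; last by lra.
  by rewrite -EFinB; congr EFin; rewrite jS; field.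
- move=> x; rewrite u01_sub01; [| |by apply: sub => u []]; last first.
    apply: measurableI; last exact: measurable_quarter.
    by rewrite -[X in measurable X]setTI; apply: measurable_shift2 => //; exact: measurable_itv.
  rewrite clampE; have [x0|x0] := ltP x 0.
    have -> : shift2 @^-1` `]-oo, x] `&` quarter j = set0.
      apply/seteqP; split => u //= [h uq]; move: h; rewrite (shift2_quarterE uq) in_itv /=.
      by move: uq; rewrite /quarter /= in_itv /= => /andP[? ?]; lra.
    by rewrite measure0 mulr0.
  have [x1|x1] := ltP x 1.
    have -> : shift2 @^-1` `]-oo, x] `&` quarter j = `[(j%:R / 4 : R), ((j%:R + x) / 4 : R)].
      apply/seteqP; split => u /=.
        move=> [+ uq]; rewrite (shift2_quarterE uq) !in_itv /=.
        by move: uq; rewrite /quarter /= in_itv /= => /andP[? ?] ?; apply/andP; split; lra.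
      rewrite in_itv /= => /andP[? ?].
      have uq : quarter j u by rewrite /quarter /= in_itv /=; apply/andP; split; lra.
      by split => //; rewrite (shift2_quarterE uq) in_itv /=; lra.
    rewrite lebesgue_measure_itv /= lte_fin; case: ltP => hx; first by rewrite -EFinB; congr EFin; field.
    by congr EFin; lra.
  have -> : shift2 @^-1` `]-oo, x] `&` quarter j = quarter j.
    apply/seteqP; split => u; first by case.
    move=> uq; split => //=; rewrite (shift2_quarterE uq) in_itv /=.
    by move: uq; rewrite /quarter /= in_itv /= => /andP[? ?]; lra.
  rewrite /quarter lebesgue_measure_itv /= lte_fin ifT; last by lra.
  by rewrite -EFinB; congr EFin; rewrite jS; field.
Qed.

(** The half-open quarters cover [0, 1] except the point 1, which has measure 0, and the law has no
    mass outside [0, 1]. *)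
Lemma u01_quarters (A : set RR) : measurable A ->
  u01 A = (\sum_(j < 4) u01 (A `&` quarter j))%E.
Proof.
move=> mA; pose Q (j : 'I_4) := A `&` quarter j.
have mQ j : measurable (Q j) by apply: measurableI => //; exact: measurable_quarter.
have tQ : trivIset setT Q.
  apply/trivIsetP => i j _ _ ij; apply/seteqP; split => u //= [[_ ui] [_ uj]].
  have /eqP := ij; apply; apply: val_inj.
  by move: ui uj => /bits_quarter[a1 a2] /bits_quarter[b1 b2];
    move: a1 a2; rewrite b1 b2 => /eqP + /eqP; rewrite !eqr_nat;
    case: (i) => [[|[|[|[|//]]]]] /= _; case: (j) => [[|[|[|[|//]]]]].
have mU : measurable (\big[setU/set0]_(j < 4) Q j) by exact: bigsetU_measurable.
have sub : \big[setU/set0]_(j < 4) Q j `<=` A.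
  by rewrite !big_ord_recl big_ord0 => u; rewrite /Q /=; tauto.
suff nul : u01 (A `\` \big[setU/set0]_(j < 4) Q j) = 0%E.
  transitivity (u01 (\big[setU/set0]_(j < 4) Q j) + u01 (A `\` \big[setU/set0]_(j < 4) Q j))%E.
    rewrite -[in LHS](setDUK sub) measureU//; first exact: measurableD.
    by rewrite setDIK.
  by rewrite nul adde0; exact: (@measure_semi_additive_ord _ _ _ u01 4 Q mQ tQ mU).
rewrite -[LHS]/(uniform_prob _ _) /uniform_prob integral_uniform_pdf.
have mD : measurable ((A `\` \big[setU/set0]_(j < 4) Q j) `&` `[(0:R), 1]).
  by apply: measurableI; [exact: measurableD|exact: measurable_itv].
apply: null_set_integral => //.
- by apply: measurable_funTS; apply/measurable_EFinP; exact: measurable_uniform_pdf.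
- apply/eqP; rewrite eq_le measure_ge0 andbT.
  rewrite -(@lebesgue_measure_set1 R 1); apply: le_measure; rewrite ?inE//.
  move=> u [[uA nQ]] /=; rewrite in_itv /= => /andP[u0 u1]; apply: contrapT => un1; apply: nQ.
  have {un1}u1 : u < 1 by rewrite lt_neqAle u1 andbT; apply/eqP.
  rewrite !big_ord_recl big_ord0 /Q /quarter /= !in_itv /= /bump !leq0n !add1n.
  case: (ltP u 4^-1) => ?; first by left; split => //; apply/andP; split; lra.
  case: (ltP u 2^-1) => ?; first by right; left; split => //; apply/andP; split; lra.
  case: (ltP u (3/4)) => ?; first by right; right; left; split => //; apply/andP; split; lra.
  by right; right; right; left; split => //; apply/andP; split; lra.
Qed.

Let H (x y : R) : R := fine (u01 (dig1 @^-1` `]-oo, x] `&` dig2 @^-1` `]-oo, y])).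

Let mH (x y : R) : measurable (dig1 @^-1` `]-oo, x] `&` dig2 @^-1` `]-oo, y] : set RR).
Proof.
apply: measurableI; rewrite -[X in measurable X]setTI; [apply: mdig1|apply: mdig2] => //; exact: measurable_itv.
Qed.

(** On the quarter j both digit numbers are (bit + new number) / 2 with known bits, so the
    thresholds x and y become 2x and 2y minus those bits. *)
Let H_rec x y : H x y = 4^-1 * (H (2 * x) (2 * y) + H (2 * x) (2 * y - 1) +
   H (2 * x - 1) (2 * y) + H (2 * x - 1) (2 * y - 1)).
Proof.
pose E a c : set RR := dig1 @^-1` `]-oo, a] `&` dig2 @^-1` `]-oo, c].
have Ej (j : 'I_4) : fine (u01 (E x y `&` quarter j)) =
    4^-1 * H (2 * x - (j./2)%:R) (2 * y - (odd j)%:R).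
  have -> : E x y `&` quarter j = shift2 @^-1` E (2 * x - (j./2)%:R) (2 * y - (odd j)%:R) `&` quarter j.
    apply/seteqP; split => u [uE uq]; split => //; have [b0 b1] := bits_quarter uq;
    move: uE; rewrite /E /= !in_itv /= /dig1 /dig2 (digit_rec bit0_01 u) (digit_rec bit1_01 u) b0 b1;
    by move=> [? ?]; split; lra.
  rewrite shift2_quarter; last exact: mH.
  by rewrite fineM//; exact: fin_num_measure (mH _ _).
rewrite {1}/H -/(E x y) u01_quarters; last exact: mH.
rewrite (eq_bigr (fun j : 'I_4 => (fine (u01 (E x y `&` quarter j)))%:E)); last first.
  by move=> j _; rewrite -u01_le1_fin//; apply: measurableI; [exact: mH|exact: measurable_quarter].
rewrite sumEFin [LHS]/= (eq_bigr _ (fun j _ => Ej j)) -mulr_sumr; congr (_ * _).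
by rewrite !big_ord_recl big_ord0 /= !subr0 addr0 !addrA.
Qed.

(** Hence the product of two clamps solves the same functional equation as H. *)
Let clamp_rec (x : R) : clamp x = 2^-1 * (clamp (2 * x) + clamp (2 * x - 1)).
Proof.
have [x0|x0] := ltP x 0; first by rewrite !clamp_lt0 ?addr0 ?mulr0//; lra.
have [x1|x1] := ltP x 2^-1.
  by rewrite (@clamp_id _ x) ?(@clamp_id _ (2 * x)) ?(@clamp_lt0 _ (2 * x - 1)); lra.
have [x2|x2] := ltP x 1.
  by rewrite (@clamp_id _ x) ?(@clamp_ge1 _ (2 * x)) ?(@clamp_id _ (2 * x - 1)); lra.
by rewrite !clamp_ge1; lra.
Qed.

Let H01 x y : 0 <= H x y <= 1.
Proof.
rewrite /H fine_ge0//= -[leRHS]/(fine 1%E); apply: fine_le => //; last exact: (probability_le1 u01 (mH _ _)).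
exact: fin_num_measure (mH _ _).
Qed.

Let dig_ge0 u : 0 <= dig1 u /\ 0 <= dig2 u.
Proof. by have /andP[] := digit_01 bit0_01 u; have /andP[] := digit_01 bit1_01 u. Qed.

Let dig_le1 u : dig1 u <= 1 /\ dig2 u <= 1.
Proof. by have /andP[] := digit_01 bit0_01 u; have /andP[] := digit_01 bit1_01 u. Qed.

Let Hneg x y : x < 0 \/ y < 0 -> H x y = 0.
Proof.
move=> xy; rewrite /H (_ : _ `&` _ = set0) ?measure0//.
apply/seteqP; split => u //=; rewrite !in_itv /= => -[? ?].
by have [? ?] := dig_ge0 u; case: xy; lra.
Qed.

Let Hone x y : 1 <= x -> 1 <= y -> H x y = 1.
Proof.
move=> x1 y1; rewrite /H (_ : _ `&` _ = setT).
  by rewrite -[RHS]/(fine 1%E); congr fine; exact: (probability_setT u01).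
apply/seteqP; split => u // _; rewrite /= !in_itv /=.
by have [? ?] := dig_le1 u; split; lra.
Qed.

Let clamp01 (x : R) : 0 <= clamp x <= 1.
Proof. by rewrite clampE; case: (ltP x 0) => ?; case: (ltP x 1) => ?; rewrite /=; lra. Qed.

(* On each of the four quarters the recursion involves the error at a rescaled
   point, and at one of these points the error vanishes. *)
Let D_bound n x y : `|H x y - clamp x * clamp y| <= (3 / 4) ^+ n.
Proof.
elim: n x y => [|n IH] x y.
  have /andP[? ?] := H01 x y; have /andP[cx0 cx1] := clamp01 x; have /andP[cy0 cy1] := clamp01 y.
  have ? : 0 <= clamp x * clamp y by rewrite mulr_ge0.
  have ? : clamp x * clamp y <= 1 by rewrite mulr_ile1.
  by rewrite expr0 ler_norml; lra.
pose D a c := H a c - clamp a * clamp c.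
have -> : H x y - clamp x * clamp y = 4^-1 * (D (2 * x) (2 * y) + D (2 * x) (2 * y - 1) +
   D (2 * x - 1) (2 * y) + D (2 * x - 1) (2 * y - 1)).
  by rewrite H_rec (clamp_rec x) (clamp_rec y) /D; field.
have Dneg a c : a < 0 \/ c < 0 -> D a c = 0.
  move=> ac; rewrite /D Hneg// !clampE.
  by case: ac => ->; rewrite ?mul0r ?mulr0 subrr.
have Done a c : 1 <= a -> 1 <= c -> D a c = 0.
  by move=> a1 c1; rewrite /D Hone// !clamp_ge1// mulr1 subrr.
have IHD a c : - (3 / 4) ^+ n <= D a c <= (3 / 4) ^+ n by rewrite -ler_norml; exact: IH.
have h00 := IHD (2 * x) (2 * y); have h01 := IHD (2 * x) (2 * y - 1).
have h10 := IHD (2 * x - 1) (2 * y); have h11 := IHD (2 * x - 1) (2 * y - 1).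
have p0 : 0 <= (3 / 4 : R) ^+ n by rewrite exprn_ge0//; lra.
rewrite exprS ler_norml.
have [x2|x2] := ltP x 2^-1.
  have e1 : D (2 * x - 1) (2 * y) = 0 by apply: Dneg; left; lra.
  by rewrite e1; apply/andP; split; lra.
have [y2|y2] := ltP y 2^-1.
  have e1 : D (2 * x - 1) (2 * y - 1) = 0 by apply: Dneg; right; lra.
  by rewrite e1; apply/andP; split; lra.
have e1 : D (2 * x) (2 * y) = 0 by apply: Done; lra.
by rewrite e1; apply/andP; split; lra.
Qed.

(** The difference is bounded by (3/4)^n for every n, hence is 0. *)
Lemma dig_cdf x y : u01 (dig1 @^-1` `]-oo, x] `&` dig2 @^-1` `]-oo, y]) = (clamp x * clamp y)%:E.
Proof.
rewrite u01_le1_fin; last exact: mH.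
congr EFin; apply/eqP; rewrite -subr_eq0 -normr_le0; apply/eqP.
have c : (3 / 4 : R) ^+ n @[n --> \oo] --> 0 by apply: cvg_expr; rewrite ger0_norm; lra.
by apply/eqP; apply: (cvgr_to_ge c); apply: nearW => n; exact: D_bound.
Qed.

(** Two applications of [push_u01] extend the product formula from half-lines to Borel sets: the
    first coordinate with the second still a half-line, then the second restricted to the event
    already obtained. *)
Lemma dig_indep (A B : set RR) : measurable A -> measurable B ->
  u01 (dig1 @^-1` A `&` dig2 @^-1` B) = (u01 A * u01 B)%E.
Proof.
move=> mA mB.
have m1 (C : set RR) : measurable C -> measurable (dig1 @^-1` C).
  by move=> mC; rewrite -[X in measurable X]setTI; exact: mdig1.
have m2 (C : set RR) : measurable C -> measurable (dig2 @^-1` C).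
  by move=> mC; rewrite -[X in measurable X]setTI; exact: mdig2.
have mI (x : R) : measurable (`]-oo, x] : set RR) by exact: measurable_itv.
have T1 : dig1 @^-1` `]-oo, 1] = setT.
  by apply/seteqP; split => u // _; rewrite /= in_itv /=; case: (dig_le1 u).
have T2 : dig2 @^-1` `]-oo, 1] = setT.
  by apply/seteqP; split => u // _; rewrite /= in_itv /=; case: (dig_le1 u).
have c1 : clamp (1 : R) = 1 by exact: clamp_ge1.
have step1 y : u01 (dig1 @^-1` A `&` dig2 @^-1` `]-oo, y]) = ((clamp y)%:E * u01 A)%E.
  apply: push_u01 => //.
  - exact: mdig1.
  - exact: m2.
  - by have /andP[] := clamp01 y.
  - by have := dig_cdf 1 y; rewrite T1 setTI c1 mul1r.
  - by move=> x; rewrite dig_cdf mulrC.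
have A1 : u01 (dig1 @^-1` A) = u01 A.
  by have := step1 1; rewrite T2 setIT c1 mul1e.
rewrite setIC [in RHS](u01_le1_fin mA); apply: push_u01 => //.
- exact: mdig2.
- exact: m1.
- exact: fine_ge0.
- by rewrite A1 -u01_le1_fin.
- by move=> y; rewrite setIC step1 muleC EFinM -u01_le1_fin.
Qed.

End Digits.

(** * Random series of independent uniforms and their almost sure convergence *)

Section IidUniforms.
Context {R : realType}.
Local Notation RR := (measurableTypeR R).
Local Notation u01 := (@u01 R).

(** Each application of [dig2] keeps a uniform variable independent of the [dig1] just read off, so
    the splitting can be repeated forever. *)
Definition useq (k : nat) (w : RR) : RR := dig1 (iter k (@dig2 R) w).

Lemma useq0 w : useq 0 w = dig1 w. Proof. by []. Qed.

Lemma useqS k w : useq k.+1 w = useq k (dig2 w).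
Proof. by rewrite /useq iterSr. Qed.

Lemma measurable_useq k : measurable_fun setT (useq k).
Proof.
elim: k => [|k IH]; first exact: mdig1.
rewrite (_ : useq k.+1 = useq k \o @dig2 R); last by apply/funext => w; exact: useqS.
by apply: measurableT_comp => //; exact: mdig2.
Qed.

Lemma measurable_useq_preimage k (A : set RR) : measurable A -> measurable (useq k @^-1` A).
Proof. by move=> mA; rewrite -[X in measurable X]setTI; exact: measurable_useq. Qed.

Lemma u01_dig1 (A : set RR) : measurable A -> u01 (@dig1 R @^-1` A) = u01 A.
Proof.
move=> mA; have := @dig_indep R A setT mA measurableT.
rewrite preimage_setT setIT => ->.
by rewrite -[X in (_ * X)%E]/(u01 setT) (_ : u01 setT = 1%E) ?mule1//; exact: (probability_setT u01).
Qed.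

Lemma u01_dig2 (A : set RR) : measurable A -> u01 (@dig2 R @^-1` A) = u01 A.
Proof.
move=> mA; have := @dig_indep R setT A measurableT mA.
rewrite preimage_setT setTI => ->.
by rewrite (_ : u01 setT = 1%E) ?mul1e//; exact: (probability_setT u01).
Qed.

Lemma u01_useq k (A : set RR) : measurable A -> u01 (useq k @^-1` A) = u01 A.
Proof.
move=> mA; elim: k => [|k IH]; first exact: u01_dig1.
rewrite -[RHS]IH -(u01_dig2 (measurable_useq_preimage k mA)).
by congr (u01 _); apply/funext => w; rewrite /preimage /= useqS.
Qed.

Lemma useq_indep n (A : nat -> set RR) : (forall i, measurable (A i)) ->
  u01 (\bigcap_(i in `I_n) useq i @^-1` A i) = (\prod_(i < n) u01 (A i))%E.
Proof.
elim: n A => [|n IH] A mA.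
  by rewrite II0 bigcap_set0 big_ord0; exact: (probability_setT u01).
have mB : measurable (\bigcap_(i in `I_n) useq i @^-1` A i.+1).
  by apply: bigcap_measurableType => i _; exact: measurable_useq_preimage.
rewrite big_ord_recl -(IH (fun i => A i.+1))// -dig_indep//.
congr (u01 _); apply/seteqP; split => w /=.
  by move=> h; split=> [|i ni]; [exact: (h 0%N)|rewrite /= -useqS; apply: h].
by move=> [h0 h] [|i] ni; [exact: h0|rewrite /= useqS; exact: h].
Qed.

Lemma u01_pair (B : set (RR * RR)) : measurable B ->
  u01 [set w | B (dig1 w, dig2 w)] = (u01 \x u01)%E B.
Proof.
move=> mB.
pose X := mkRV u01 (@mdig1 R : measurable_fun setT (@dig1 R : RR -> R)).
pose Y := mkRV u01 (@mdig2 R : measurable_fun setT (@dig2 R : RR -> R)).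
apply/esym.
apply: (@product_measure_unique _ _ _ _ _ u01 u01 (distribution u01 (pairRV X Y))) => // A C mA mC.
exact: dig_indep.
Qed.

Definition usum (a : nat -> R) (k : nat) (w : RR) : R :=
  \sum_(i < k) a i * (useq i w - 2^-1).

Lemma usumS a k w : usum a k.+1 w = a 0%N * (dig1 w - 2^-1) + usum (fun i => a i.+1) k (dig2 w).
Proof.
by rewrite /usum big_ord_recl useq0; congr (_ + _); apply: eq_bigr => i _; rewrite -useqS.
Qed.

Lemma measurable_usum a k : measurable_fun setT (usum a k).
Proof.
apply: measurable_sum => i; apply: measurable_funM => //.
by apply: measurable_funB => //; exact: measurable_useq.
Qed.

(** The walk with increments a_i (u_i - 1/2), started at x, leaves ]-e, e[ within n steps. The
    starting point is free so that the walk can be restarted after its first step. *)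
Definition exceed (a : nat -> R) (e : R) (n : nat) (x : R) : set RR :=
  [set w | exists2 k, (k <= n)%N & e <= `|x + usum a k w|].

Lemma measurable_exceed a e n x : measurable (exceed a e n x).
Proof.
have -> : exceed a e n x = \bigcup_(k in `I_n.+1) [set w | e <= `|x + usum a k w|].
  by apply/seteqP; split => w /= -[k kn h]; exists k.
apply: bigcup_measurable => k _.
have := @measurable_fun_ler _ RR R setT (fun=> e) (fun w => `|x + usum a k w|).
move=> /(_ (measurable_cst _)) h.
rewrite -[X in measurable X]setTI; apply: (h _ measurableT [set true]) => //.
apply: measurableT_comp => //; apply: measurable_funD => //; exact: measurable_usum.
Qed.

(** The term a^2 / 12 is the variance of the increment; c stands for the variance of the later
    steps. *)
Lemma u01_integral_sq (x a c : R) : 0 <= c ->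
  (\int[u01]_v ((x + a * (v - 2^-1)) ^+ 2 + c)%:E)%E = (x ^+ 2 + a ^+ 2 / 12 + c)%:E.
Proof.
move=> c0.
pose F (v : R) := ((a ^+ 2 / 3) * v ^+ 3 + (a * (x - a / 2)) * v ^+ 2) + ((x - a / 2) ^+ 2 + c) * v ^+ 1.
pose f (v : R) := (x + a * (v - 2^-1)) ^+ 2 + c.
have cf : continuous f.
  move=> v; apply: cvgD; last exact: cvg_cst.
  by rewrite /f expr2; apply: cvgM; (apply: cvgD; first exact: cvg_cst);
   (apply: cvgM; first exact: cvg_cst); apply: cvgB; [exact: cvg_id|exact: cvg_cst|exact: cvg_id|exact: cvg_cst].
rewrite integral_uniform; last 2 first.
- by apply/measurable_EFinP; exact: continuous_measurable_fun.
- by move=> v; rewrite lee_fin addr_ge0// sqr_ge0.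
have dF (v : R) : is_derive v 1 F (f v).
  have H := @is_deriveD R _ _ _ _ v 1 _ _ (@is_deriveD R _ _ _ _ v 1 _ _
    (is_derive_powM (a ^+ 2 / 3) 2 v) (is_derive_powM (a * (x - a / 2)) 1 v))
    (is_derive_powM ((x - a / 2) ^+ 2 + c) 0 v).
  by apply: (is_derive_eq H); rewrite /f; field.
rewrite -[X in (_ * X)%E]/(\int[lebesgue_measure]_(v in `[0%R, 1%R]) (f v)%:E)%E.
rewrite (@FTC_C1 _ F f 0 1 ltr01 dF cf).
by rewrite -EFinM; congr EFin; rewrite /F !expr1n !expr0n /=; field.
Qed.

(* Kolmogorov's inequality, by conditioning on the first summand. *)
Lemma maximal_inequality (a : nat -> R) (e : R) n x : 0 < e ->
  (u01 (exceed a e n x) <= ((x ^+ 2 + (\sum_(i < n) a i ^+ 2) / 12) / e ^+ 2)%:E)%E.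
Proof.
move=> e0; elim: n a x => [|n IH] a x.
all: have e20 : 0 < e ^+ 2 by rewrite exprn_gt0.
all: have sq_ge (s : R) : 0 <= s -> e <= `|x| -> 1 <= (x ^+ 2 + s / 12) / e ^+ 2.
  1,3: move=> s0 ex; rewrite ler_pdivlMr// mul1r ler_wpDr ?divr_ge0//.
  1,2: by rewrite -(real_normK (num_real x)) ler_sqr ?nnegrE// ltW.
all: have [ex|xe] := leP e `|x|.
1,3: apply: le_trans (probability_le1 u01 (measurable_exceed _ _ _ _)) _.
1,2: by rewrite lee_fin sq_ge// sumr_ge0// => i _; exact: sqr_ge0.
  have -> : exceed a e 0 x = set0.
    apply/seteqP; split => w //= -[k]; rewrite leqn0 => /eqP ->.
    by rewrite /usum big_ord0 addr0 leNgt xe.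
  by rewrite measure0 lee_fin divr_ge0// ?(ltW e20)// addr_ge0 ?sqr_ge0// big_ord0 mul0r.
pose b i := a i.+1.
(* Since |x| < e, the exit happens after the first step: it is an exit of the walk with shifted
   coefficients, driven by the independent [dig2] and started at x + a_0 (u - 1/2). *)
pose B : set (RR * RR) := [set z | exceed b e n (x + a 0%N * (z.1 - 2^-1)) z.2].
have -> : exceed a e n.+1 x = [set w | B (dig1 w, dig2 w)].
  apply/seteqP; split => w.
    move=> [[|k] kn]; first by rewrite /usum big_ord0 addr0 leNgt xe.
    by rewrite usumS addrA => h; exists k.
  by move=> [k kn h]; exists k.+1 => //; rewrite usumS addrA.
have mB : measurable B.
  have -> : B = \bigcup_(k in `I_n.+1) [set z | e <= `|x + a 0%N * (z.1 - 2^-1) + usum b k z.2|].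
    by apply/seteqP; split => w /= -[k kn h]; exists k.
  apply: bigcup_measurable => k _.
  have := @measurable_fun_ler _ (RR * RR)%type R setT (fun=> e)
    (fun z => `|x + a 0%N * (z.1 - 2^-1) + usum b k z.2|).
  move=> /(_ (measurable_cst _)) h.
  rewrite -[X in measurable X]setTI; apply: (h _ measurableT [set true]) => //.
  apply: measurableT_comp => //; apply: measurable_funD; last first.
    by apply: (@measurableT_comp _ _ _ _ _ _ (usum b k)); [exact: measurable_usum|exact: measurable_snd].
  apply: measurable_funD => //; apply: measurable_funM => //.
  by apply: measurable_funB => //; exact: measurable_fst.
rewrite u01_pair//.
pose s := (\sum_(i < n) b i ^+ 2) / 12.
have s0 : 0 <= s by rewrite divr_ge0// sumr_ge0// => i _; exact: sqr_ge0.
have xs v : xsection B v = exceed b e n (x + a 0%N * (v - 2^-1)).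
  by apply/seteqP; split => w; rewrite /xsection /= inE.
apply: (@le_trans _ _ (\int[u01]_v ((e ^- 2)%:E * ((x + a 0%N * (v - 2^-1)) ^+ 2 + s)%:E))%E).
  rewrite [leLHS]/product_measure1; apply: ge0_le_integral => //.
  - exact: measurable_fun_xsection.
  - apply/measurable_EFinP; apply: measurable_funM => //.
    apply: measurable_funD => //; apply: measurable_funX; apply: measurable_funD => //.
    by apply: measurable_funM => //; apply: measurable_funB.
  - by move=> v _; rewrite /= xs (le_trans (IH _ _))// -EFinM lee_fin mulrC.
rewrite ge0_integralZl//; last 3 first.
- apply/measurable_EFinP; apply: measurable_funD => //; apply: measurable_funX; apply: measurable_funD => //.
  by apply: measurable_funM => //; apply: measurable_funB.
- by move=> v _; rewrite lee_fin addr_ge0// sqr_ge0.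
- by rewrite lee_fin invr_ge0 ltW.
rewrite u01_integral_sq// -EFinM lee_fin mulrC ler_pM2r ?invr_gt0//.
by rewrite big_ord_recl mulrDl addrA /s.
Qed.

Section Convergence.
Variables (a : nat -> R) (V : R).
Hypothesis cvgV : (\sum_(i < n) a i ^+ 2) @[n --> \oo] --> V.

Let tail m i := if (i < m)%N then 0 else a i.

Let sum_le_V n : \sum_(i < n) a i ^+ 2 <= V.
Proof.
rewrite -(cvg_lim _ cvgV)//.
apply: (@nondecreasing_cvgn_le _ (fun n => \sum_(i < n) a i ^+ 2)).
  by apply/nondecreasing_seqP => k; rewrite big_ord_recr lerDl sqr_ge0.
by apply/cvg_ex; exists V.
Qed.

Let tail_sq m n : \sum_(i < n) tail m i ^+ 2 <= V - \sum_(i < m) a i ^+ 2.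
Proof.
rewrite lerBrDr; apply: le_trans (sum_le_V (n + m)).
have mn : (m <= n + m)%N by rewrite leq_addl.
rewrite -(big_mkord xpredT (fun i => tail m i ^+ 2)) -!(big_mkord xpredT (fun i => a i ^+ 2)).
have -> : \sum_(0 <= i < n + m) a i ^+ 2 = \sum_(0 <= i < m) a i ^+ 2 + \sum_(m <= i < n + m) a i ^+ 2.
  by rewrite (big_cat_nat _ mn).
rewrite addrC lerD2l.
have -> : \sum_(m <= i < n + m) a i ^+ 2 = \sum_(0 <= i < n + m) tail m i ^+ 2.
  rewrite [RHS](big_cat_nat _ mn)//= [X in _ = X + _]big_nat_cond [X in _ = X + _]big1 ?add0r.
    by apply: eq_big_nat => i /andP[mi _]; rewrite /tail ltnNge mi.
  by move=> i; rewrite andbT => /andP[_ im]; rewrite /tail im expr0n.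
rewrite [leRHS](@big_cat_nat _ _ _ n)//= ?leq_addr// lerDl.
by apply: sumr_ge0 => i _; exact: sqr_ge0.
Qed.

Let usum_tail m k w : (m <= k)%N -> usum (tail m) k w = usum a k w - usum a m w.
Proof.
move=> mk; rewrite /usum -!(big_mkord xpredT (fun i => a i * (useq i w - 2^-1))).
rewrite -(big_mkord xpredT (fun i => tail m i * (useq i w - 2^-1))).
rewrite [\sum_(0 <= i < k) a i * _](big_cat_nat _ mk)//= addrAC subrr add0r.
rewrite (big_cat_nat _ mk)//= [X in X + _]big_nat_cond big1 ?add0r.
  by apply: eq_big_nat => i /andP[mi _]; rewrite /tail ltnNge mi.
by move=> i; rewrite andbT => /andP[_ im]; rewrite /tail im mul0r.
Qed.

(** The event that some later partial sum is at distance at least e from the m-th one. *)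
Let osc m e := \bigcup_n exceed (tail m) e n 0.

Let measurable_osc m e : measurable (osc m e).
Proof. by apply: bigcup_measurable => n _; exact: measurable_exceed. Qed.

Let osc_le m e : 0 < e ->
  (u01 (osc m e) <= ((V - \sum_(i < m) a i ^+ 2) / e ^+ 2)%:E)%E.
Proof.
move=> e0; have c : u01 (exceed (tail m) e n 0) @[n --> \oo] --> u01 (osc m e).
  apply: nondecreasing_cvg_mu => [n||n p np]; [exact: measurable_exceed|exact: measurable_osc|].
  by apply/subsetPset => w [k kn h]; exists k => //; exact: leq_trans np.
apply: (cvge_to_le c); apply: nearW => n.
apply: le_trans (maximal_inequality _ _ _ e0) _; rewrite lee_fin.
rewrite expr0n /= add0r ler_pM2r ?invr_gt0 ?exprn_gt0//.
have := tail_sq m n; have : 0 <= \sum_(i < n) tail m i ^+ 2.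
  by apply: sumr_ge0 => i _; exact: sqr_ge0.
lra.
Qed.

Let osc_null e : 0 < e -> u01 (\bigcap_m osc m e) = 0%E.
Proof.
move=> e0; apply/eqP; rewrite eq_le measure_ge0 andbT.
have c : (((V - \sum_(i < m) a i ^+ 2) / e ^+ 2)%:E)%E @[m --> \oo] --> 0%:E.
  apply: cvg_EFin; first exact: nearW.
  rewrite (_ : nbhs 0 = nbhs ((V - V) / e ^+ 2)); last by rewrite subrr mul0r.
  by apply: cvgM; [apply: cvgB => //; exact: cvg_cst|exact: cvg_cst].
apply: (cvge_to_ge c); apply: nearW => m.
apply: le_trans (osc_le m e0); apply: le_measure; rewrite ?inE//.
  by apply: bigcap_measurableType => k _; exact: measurable_osc.
exact: bigcap_inf.
Qed.

(** Kolmogorov's inequality bounds [osc m e] by the remaining variance over e^2, which tends to 0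
    with m. Off the null union of the intersections over m, taken along e = 1 / (j + 1), the partial
    sums are Cauchy. *)
Lemma usum_cvg_ae : {ae u01, forall w, cvgn (usum a ^~ w)}.
Proof.
pose N := \bigcup_j \bigcap_m osc m j.+1%:R^-1.
have j0 (j : nat) : 0 < (j.+1%:R^-1 : R) by rewrite invr_gt0 ltr0n.
have : u01.-negligible N.
  apply: negligible_bigcup => j; apply/negligibleP; last exact: osc_null.
  by apply: bigcap_measurableType => k _; exact: measurable_osc.
apply: negligibleS => w /= ncv; apply: contrapT => nN; apply: ncv.
apply/cauchy_cvgP/cauchy_exP => e e_gt0.
have [j je] : exists j : nat, (j.+1%:R^-1 : R) < e.
  exists (Num.truncn e^-1); rewrite -[ltRHS]invrK ltf_pV2 ?posrE ?ltr0n ?invr_gt0//.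
  exact: truncnS_gt.
have [m hm] : exists m, ~ osc m j.+1%:R^-1 w.
  apply: contrapT => h; apply: nN; exists j => // m _.
  by apply: contrapT => h'; apply: h; exists m.
exists (usum a m w); exists m => // k /= mk.
rewrite /ball /= distrC; apply: lt_trans je; rewrite ltNge; apply/negP => h.
by apply: hm; exists k => //; exists k => //; rewrite add0r usum_tail.
Qed.

(** The upper limit is measurable and defined everywhere; it is the limit wherever that exists. *)
Definition usum_lim (w : RR) : R := fine (limn_esup (fun n => (usum a n w)%:E)).

Lemma measurable_usum_lim : measurable_fun setT usum_lim.
Proof.
apply: (@measurableT_comp _ _ _ _ _ _ (@fine R)); first exact: fine_measurable.
by apply: measurable_fun_limn_esup => n; apply/measurable_EFinP; exact: measurable_usum.
Qed.

Lemma usum_lim_ae : {ae u01, forall w, usum a n w @[n --> \oo] --> usum_lim w}.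
Proof.
apply: filterS usum_cvg_ae => w /cvg_ex[l cl].
have cE : (usum a n w)%:E @[n --> \oo] --> l%:E by apply: cvg_EFin => //; exact: nearW.
by rewrite /usum_lim (cvg_limn_einf_sup cE).2.
Qed.

End Convergence.

End IidUniforms.

(** * Existence of the law of the series plus an independent normal *)

Section DustpanLaw.
Context {R : realType}.
Local Notation RR := (measurableTypeR R).
Local Notation u01 := (@u01 R).

Lemma has_law_cdf {d} {T : measurableType d} (P : probability T R) (X : {RV P >-> R})
    (mu : probability RR R) :
  (forall x : R, P (X @^-1` `]-oo, x]) = mu `]-oo, x]) -> has_law X mu.
Proof.
move=> h A mA; apply: (@measure_cdf_unique _ (law X) mu) => //.
- exact: le_lt_trans (probability_le1 (law X) measurableT) (ltry _).
- transitivity (1%E : \bar R); first exact: (probability_setT (law X)).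
  by apply/esym; exact: (probability_setT mu).
Qed.

Variable t : nat -> R.
Hypothesis td : dustpan t.

Let t0 k : 0 <= t k. Proof. by case: td. Qed.

Let sg := Num.sqrt (1 - fine (lp_norm 2 t ^+ 2)%E / 12).
Let P : probability (RR * RR)%type R := (u01 \x centered_normal sg)%E.

Let Psection1 (A : set RR) : measurable A -> P (fst @^-1` A) = u01 A.
Proof.
move=> mA; have -> : fst @^-1` A = A `*` (setT : set RR).
  by apply/seteqP; split => -[x y] //= [].
rewrite [LHS]product_measure1E//.
rewrite -[RHS]mule1; congr (_ * _)%E; exact: (probability_setT (centered_normal sg)).
Qed.

Let mU k : measurable_fun setT (fun w : RR * RR => t k * (useq k w.1 - 2^-1)).
Proof.
apply: measurable_funM => //; apply: measurable_funB => //.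
by apply: (@measurableT_comp _ _ _ _ _ _ (@useq R k)); [exact: measurable_useq|exact: measurable_fst].
Qed.

Let mS : measurable_fun setT (fun w : RR * RR => usum_lim t w.1).
Proof.
by apply: (@measurableT_comp _ _ _ _ _ _ (@usum_lim R t)); [exact: measurable_usum_lim|exact: measurable_fst].
Qed.

Let mZ : measurable_fun setT (fun w : RR * RR => w.2 : R).
Proof. exact: measurable_snd. Qed.

Let U k := mkRV P (mU k).
Let S := mkRV P mS.
Let Z := mkRV P mZ.

Let mB k (A : set RR) : measurable A -> measurable [set v : RR | A (t k * (v - 2^-1))].
Proof.
move=> mA; rewrite -[X in measurable X]setTI.
have m : measurable_fun setT (fun v : RR => t k * (v - 2^-1) : RR).
  by apply: measurable_funM => //; apply: measurable_funB.
exact: m.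
Qed.

Let PU k (A : set RR) : measurable A -> P (U k @^-1` A) = u01 [set v : RR | A (t k * (v - 2^-1))].
Proof.
move=> mA; rewrite -(u01_useq k (mB k mA)) -Psection1//.
by apply: measurable_useq_preimage; exact: mB.
Qed.

(** A finite index set is enlarged to an initial segment, with the trivial condition [setT] at the
    added indices. *)
Let U_indep : mutually_independent U.
Proof.
move=> s A us mA.
have [n sn] : exists n, forall i, i \in s -> (i < n)%N.
  by exists (\max_(i <- s) i).+1 => i si; rewrite ltnS (@leq_bigmax_seq _ s xpredT id).
pose B i : set RR := if i \in s then [set v | A i (t i * (v - 2^-1))] else setT.
have mBi i : measurable (B i) by rewrite /B; case: ifP => // _; exact: (mB i (mA i)).
have -> : \bigcap_(i in [set` s]) U i @^-1` A i = fst @^-1` (\bigcap_(i in `I_n) useq i @^-1` B i).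
  apply/seteqP; split => w /= h i /= si; last first.
    by have := h i (sn i si); rewrite /B si.
  by rewrite /B; case: ifP => // /h.
rewrite Psection1; last by apply: bigcap_measurableType => i _; exact: measurable_useq_preimage.
rewrite useq_indep// -(big_mkord xpredT (fun i => u01 (B i))).
have pe : perm_eq s [seq i <- index_iota 0 n | i \in s].
  apply: uniq_perm => // [|i]; first by rewrite filter_uniq// iota_uniq.
  by rewrite mem_filter mem_index_iota /= andb_idr// => /sn.
rewrite [RHS](perm_big _ pe) big_filter [RHS]big_mkcond.
apply: eq_bigr => i _; rewrite /B; case: ifP => si; first by apply/esym; exact: (PU i (mA i)).
exact: (probability_setT u01).
Qed.

Let U_law k : has_law (U k) (centered_uniform (t k)).
Proof.
have := t0 k; rewrite le_eqVlt => /predU1P[tk0|tk0].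
  move=> A mA; rewrite /centered_uniform; case: pselect => [h|_].
    by exfalso; move: h; rewrite -tk0 mul0r oppr0 ltxx.
  rewrite PU// -tk0; under eq_set do rewrite mul0r.
  rewrite /= diracE; have [A0|A0] := boolP (0 \in A).
    rewrite (_ : [set _ | _] = setT); first exact: (probability_setT u01).
    by apply/seteqP; split => // v _ /=; rewrite inE in A0.
  rewrite (_ : [set _ | _] = set0) ?measure0//.
  by apply/seteqP; split => // v /= h; move: A0; rewrite notin_setE.
apply: has_law_cdf => x; rewrite /centered_uniform; case: pselect => [h|]; last first.
  by move=> h; exfalso; apply: h; lra.
rewrite PU; last exact: measurable_itv.
rewrite [RHS]uniform_cdf.
have -> : [set v : RR | `]-oo, x] (t k * (v - 2^-1))] = `]-oo, ((x + t k / 2) / t k)%R].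
  apply/seteqP; split => v /=; rewrite !in_itv /= ler_pdivlMr//; lra.
rewrite u01_cdf; congr (clamp _)%:E; congr (_ / _); lra.
Qed.

Let SZ_indep (A B : set RR) : measurable A -> measurable B ->
  P (S @^-1` A `&` Z @^-1` B) = (P (S @^-1` A) * P (Z @^-1` B))%E.
Proof.
move=> mA mB'.
have mSA : measurable ((usum_lim t : RR -> R) @^-1` A).
  by rewrite -[X in measurable X]setTI; exact: measurable_usum_lim.
have E1 : P (S @^-1` A) = u01 ((usum_lim t : RR -> R) @^-1` A) by rewrite -Psection1.
have E2 (C D : set RR) : measurable C -> measurable D -> P (C `*` D) = (u01 C * centered_normal sg D)%E.
  by move=> mC mD; rewrite [LHS]product_measure1E.
have E3 : P (Z @^-1` B) = centered_normal sg B.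
  have -> : Z @^-1` B = (setT : set RR) `*` B by apply/seteqP; split => -[x y] //= [].
  by rewrite E2// -[RHS]mul1e; congr (_ * _)%E; exact: (probability_setT u01).
by rewrite E1 E3 -E2.
Qed.

Lemma dustpan_law_exists : exists mu : probability RR R, dustpan_law t mu.
Proof.
pose W : {RV P >-> R} := (S \+ Z)%R.
exists (law W); exists _, (RR * RR)%type, P, U, S, Z; split.
- by split; [exact: U_indep|exact: U_law].
- have := usum_lim_ae (dustpan_cvg_sq td).
  move=> [N [mN N0 sub]]; exists (fst @^-1` N); split.
  + by rewrite -[X in measurable X]setTI; exact: measurable_fst.
  + by rewrite Psection1.
  + by move=> w h; apply: sub => /= h'; apply: h; exact: h'.
- move=> A mA; have -> : Z @^-1` A = (setT : set RR) `*` A by apply/seteqP; split => -[x y] //= [].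
  by rewrite [LHS]product_measure1E// -[RHS]mul1e; congr (_ * _)%E; exact: (probability_setT u01).
- move=> s A us mA.
  have PT : P setT = 1%E by exact: (probability_setT P).
  have s1 b : \bigcap_(i in [set` [:: b]]) (if i then S else Z) @^-1` A i = (if b then S else Z) @^-1` A b.
    by apply/seteqP; split => w; [move=> /(_ b (mem_head _ _))|move=> h i /=; rewrite inE => /eqP ->].
  have s2 b c : \bigcap_(i in [set` [:: b; c]]) (if i then S else Z) @^-1` A i =
     (if b then S else Z) @^-1` A b `&` (if c then S else Z) @^-1` A c.
    apply/seteqP; split => w.
      by move=> h; split; apply: h; rewrite /= !inE eqxx ?orbT.
    by move=> [h1 h2] i /=; rewrite !inE => /orP[] /eqP ->.
  case: s us => [|b [|c [|e s]]] us.
  + rewrite big_nil (_ : \bigcap_(i in _) _ = setT)//.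
    by apply/seteqP; split => // w _ i.
  + by rewrite big_seq1 s1.
  + rewrite s2 !big_cons big_nil mule1; case: b us => us; case: c us => //= _; first exact: (SZ_indep (mA true) (mA false)).
    by rewrite setIC muleC; exact: (SZ_indep (mA true) (mA false)).
  + by exfalso; move: us; rewrite /= !inE; case: b; case: c; case: e; rewrite ?andbF ?orbT.
- by [].
Qed.

End DustpanLaw.

(** * Uniqueness of limits *)

Section WeakLimits.
Context {R : realType}.
Local Notation RR := (measurableTypeR R).
Implicit Types mu : probability RR R.

Let Fd mu (y : R) : R := fine (mu `]-oo, y]).

Let FdE mu y : mu `]-oo, y] = (Fd mu y)%:E.
Proof. by rewrite /Fd fineK// fin_num_measure//; exact: measurable_itv. Qed.

Let Fd_right mu (x : R) : Fd mu y @[y --> x^'+] --> Fd mu x.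
Proof.
pose X := mkRV mu (@measurable_id _ RR setT : measurable_fun setT (id : RR -> R)).
have := @cdf_right_continuous _ _ _ mu X x.
rewrite (_ : cdf X = fun y => (Fd mu y)%:E); first by move/fine_cvg.
by apply/funext => y; rewrite -FdE.
Qed.

Let Fd_le mu (x y : R) : x <= y -> Fd mu x <= Fd mu y.
Proof.
move=> xy; rewrite -lee_fin -!FdE; apply: le_measure; rewrite ?inE; [exact: measurable_itv..|].
by move=> z /=; rewrite !in_itv /= => /le_trans; apply.
Qed.

Let Fd_left mu (x : R) : mu [set x] = 0%E -> Fd mu y @[y --> x^'-] --> Fd mu x.
Proof.
move=> mu0; apply/cvgrPdist_le => e e0.
pose A (n : nat) : set RR := `]-oo, (x - n.+1%:R^-1)%R].
have AU : \bigcup_n A n = `]-oo, x[.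
  apply/seteqP; split => y.
    move=> [n _]; rewrite /A /= !in_itv /= => h; apply: le_lt_trans h _.
    by rewrite ltrBlDr ltrDl invr_gt0 ltr0n.
  rewrite /= in_itv /= => yx; exists (Num.truncn (x - y)^-1) => //.
  have xy : 0 < x - y by rewrite subr_gt0.
  rewrite /A /= in_itv /= lerBrDr -lerBrDl -[leRHS]invrK lef_pV2 ?posrE ?ltr0n ?invr_gt0//.
  by apply: ltW; exact: truncnS_gt.
have c : mu (A n) @[n --> \oo] --> mu `]-oo, x[.
  rewrite -AU; apply: nondecreasing_cvg_mu => [n||n m nm]; first exact: measurable_itv.
    by apply: bigcup_measurable => n _; exact: measurable_itv.
  apply/subsetPset => y; rewrite /A /= !in_itv /= => h; apply: le_trans h _.
  by rewrite lerD2l lerN2 lef_pV2 ?posrE ?ltr0n// ler_nat.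
have muE : mu `]-oo, x[ = (Fd mu x)%:E.
  rewrite -FdE (_ : `]-oo, x] = `]-oo, x[ `|` [set x] :> set RR); last first.
    apply/seteqP; split => y; rewrite /= !in_itv /= le_eqVlt.
      by move=> /orP[/eqP|]; [right|left].
    by move=> [->|->]; rewrite ?eqxx ?orbT.
  transitivity (mu `]-oo, x[ + mu [set x])%E; first by rewrite mu0 adde0.
  apply/esym; apply: measureU => //.
  by apply/seteqP; split => y //= []; rewrite in_itv /= => + yx; rewrite yx ltxx.
have {}c : Fd mu (x - n.+1%:R^-1) @[n --> \oo] --> Fd mu x.
  by move: c; rewrite muE => /fine_cvg.
have /cvgrPdist_le/(_ e e0)[n _ /(_ n (leqnn n)) /= hn] := c.
near=> y.
have yx : y <= x by near: y; exact: nbhs_left_le.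
have ny : x - n.+1%:R^-1 <= y.
  by apply: ltW; near: y; apply: nbhs_left_gt; rewrite ltrBlDr ltrDl invr_gt0 ltr0n.
have := Fd_le mu yx; have := Fd_le mu ny; move: hn.
by rewrite !ler_norml => /andP[? ?] ? ?; apply/andP; split; lra.
Unshelve. all: by end_near. Qed.

Lemma atomless_cdf_continuous mu (x : R) : mu [set x] = 0%E ->
  {for x, continuous (fun y : R => mu `]-oo, y])}.
Proof.
move=> mu0; rewrite (_ : (fun y : R => mu `]-oo, y]) = EFin \o Fd mu); last first.
  by apply/funext => y; exact: FdE.
apply: continuous_comp; last exact: cvg_id.
by apply/left_right_continuousP; split; [exact: Fd_left|exact: Fd_right].
Qed.

Let atoms mu : set R := [set x | (0 < fine (mu [set x]))%R].

Let countable_atoms mu : countable (atoms mu).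
Proof.
pose X := mkRV mu (@measurable_id _ RR setT : measurable_fun setT (id : RR -> R)).
exact: (@pmf_gt0_countable _ _ _ mu X).
Qed.

Let notin_atoms mu x : ~ atoms mu x -> mu [set x] = 0%E.
Proof.
move=> h; have fin : mu [set x] \is a fin_num.
  by apply: fin_num_measure; exact: measurable_set1.
rewrite -(fineK fin); congr EFin; apply/eqP; rewrite eq_le fine_ge0// andbT leNgt.
by apply/negP.
Qed.

(** The atoms of both laws are countable in number, whereas the interval has positive Lebesgue
    measure. *)
Let common_point mu mu' (x y : R) : x < y ->
  exists2 z, x < z < y & mu [set z] = 0%E /\ mu' [set z] = 0%E.
Proof.
move=> xy; apply: contrapT => h.
have sub : `]x, y[ `<=` atoms mu `|` atoms mu'.
  move=> z /=; rewrite in_itv /= => xzy; apply: contrapT => /not_orP[h1 h2].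
  by apply: h; exists z => //; split; exact: notin_atoms.
have : countable (`]x, y[ : set R).
  apply: sub_countable (subset_card_le sub) _; rewrite -bigcup2E.
  apply: bigcup_countable => // i _; rewrite /bigcup2.
  by case: i => [|[|i]] /=; [exact: countable_atoms|exact: countable_atoms|exact: countable0].
move=> /countable_lebesgue_measure0; rewrite lebesgue_measure_itv /= lte_fin xy => /eqP.
by rewrite -EFinB eqe subr_eq0 gt_eqF.
Qed.

(** If the distribution functions differ at x, right continuity makes them differ on an interval to
    the right of x. It contains a point that is an atom of neither law, where both are limits of the
    same values. *)
Lemma weak_limit_unique {I : Type} {F : set_system I} {PF : ProperFilter F}
    (h : I -> R -> \bar R) mu mu' :
  (forall x : R, {for x, continuous (fun y : R => mu `]-oo, y])} -> h i x @[i --> F] --> mu `]-oo, x]) ->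
  (forall x : R, {for x, continuous (fun y : R => mu' `]-oo, y])} -> h i x @[i --> F] --> mu' `]-oo, x]) ->
  forall A, measurable A -> mu A = mu' A.
Proof.
move=> c1 c2; apply: measure_cdf_unique.
- exact: le_lt_trans (probability_le1 mu measurableT) (ltry _).
- transitivity (1%E : \bar R); first exact: (probability_setT mu).
  by apply/esym; exact: (probability_setT mu').
move=> x.
transitivity (Fd mu x)%:E; first exact: FdE.
transitivity (Fd mu' x)%:E; last by apply/esym; exact: FdE.
congr EFin; apply: contrapT => /eqP ne.
pose d := `|Fd mu x - Fd mu' x|.
have d0 : 0 < d by rewrite normr_gt0 subr_eq0.
have d2 : 0 < d / 2 by rewrite divr_gt0.
have /cvgrPdist_lt/(_ _ d2) n1 := @Fd_right mu x.
have /cvgrPdist_lt/(_ _ d2) n2 := @Fd_right mu' x.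
have : \forall z \near x^'+, Fd mu z != Fd mu' z.
  near=> z; apply/eqP => e12.
  have h1 : `|Fd mu x - Fd mu z| < d / 2 by near: z; exact: n1.
  have h2 : `|Fd mu' x - Fd mu' z| < d / 2 by near: z; exact: n2.
  have := ler_normB (Fd mu x - Fd mu z) (Fd mu' x - Fd mu' z).
  have -> : Fd mu x - Fd mu z - (Fd mu' x - Fd mu' z) = Fd mu x - Fd mu' x by rewrite e12; ring.
  by rewrite -/d; lra.
move=> [e /= e0 he].
have [z /andP[xz ze] [z1 z2]] : exists2 z, x < z < x + e & mu [set z] = 0%E /\ mu' [set z] = 0%E.
  by apply: common_point; rewrite ltrDl.
have /eqP : Fd mu z != Fd mu' z by apply: he => //=; rewrite ltr_distlC; lra.
apply; apply: EFin_inj; rewrite -!FdE.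
apply: (cvg_unique _ (c1 z (atomless_cdf_continuous z1)) (c2 z (atomless_cdf_continuous z2))).
Unshelve. all: by end_near. Qed.

End WeakLimits.

(** * The characteristic function determines t *)

Section DcfInjective.
Context {R : realType}.
Implicit Types (t : nat -> R).

Lemma sinc_ge_expR (th : R) : 0 <= th -> th < pi ->
  exists2 C : R, 0 <= C & forall y, `|y| <= th -> expR (- (C * y ^+ 2)) <= sinc y.
Proof.
move=> th0 thpi.
have ws : {within `[0, th], continuous (@sinc R)}.
  by apply: continuous_subspaceT => x; exact: continuous_sinc.
have [c cth cmin] := EVT_min th0 ws.
have sc0 : 0 < sinc c.
  by apply: sinc_gt0; move: cth; rewrite in_itv /= => /andP[c0 c1]; rewrite ger0_norm//; lra.
have sc1 : sinc c <= 1 by have := cmin 0; rewrite sinc0; apply; rewrite in_itv /= lexx.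
have ln0 : ln (sinc c) <= 0 by apply: ln_le0.
(* Where y^2 >= 1 the summand - ln(min sinc) suffices. Where y^2 < 1 the summand 1 does, as e^(-y^2)
   <= 1 - y^2 + y^4 / 2 <= 1 - y^2 / 6. *)
exists (1 - ln (sinc c)); first lra.
move=> y yth; have [y1|y1] := leP 1 (y ^+ 2).
  apply: (@le_trans _ _ (sinc c)).
    rewrite -[leRHS]lnK ?posrE// ler_expR.
    have : 0 <= (y ^+ 2 - 1) * (- ln (sinc c)) by rewrite mulr_ge0//; lra.
    lra.
  rewrite -[leRHS]sinc_norm; apply: cmin; by rewrite in_itv /= normr_ge0.
have y0 : 0 <= y ^+ 2 := sqr_ge0 y.
apply: le_trans (sinc_ge y).
apply: (@le_trans _ _ (expR (- (1 * y ^+ 2)))).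
  rewrite ler_expR lerN2 ler_wpM2r//; lra.
rewrite mul1r; apply: le_trans (expRN_le y0) _.
have : 0 <= y ^+ 2 * (1 - y ^+ 2) by rewrite mulr_ge0//; lra.
rewrite [(y ^+ 2) ^+ 2]expr2; lra.
Qed.

(** The interval is shrunk once per factor, around a point where the new factor does not vanish. *)
Lemma sinc_prod_neq0 (t : nat -> R) n (a b : R) : 0 < a -> a < b ->
  exists2 x, a < x < b & \prod_(i < n) sinc (t i * x / 2) != 0.
Proof.
move=> a0 ab.
suff [a' [b' [aa' a'b' bb' h]]] : exists a' b', [/\ a <= a', a' < b', b' <= b &
    forall x, a' < x < b' -> \prod_(i < n) sinc (t i * x / 2) != 0].
  exists ((a' + b') / 2); last by apply: h; lra.
  lra.
elim: n => [|n [a' [b' [aa' a'b' bb' h]]]].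
  by exists a, b; split => // x _; rewrite big_ord0 oner_neq0.
have [tn0|tn0] := eqVneq (t n) 0.
  exists a', b'; split => // x xab; rewrite big_ord_recr /= tn0 !mul0r sinc0 mulr1.
  exact: h.
have [x1 x1ab sx1] : exists2 x1, a' < x1 < b' & sin (t n * x1 / 2) != 0.
  pose c := (a' + b') / 2.
  have [sc|sc] := eqVneq (sin (t n * c / 2)) 0; last by exists c => //; rewrite /c; lra.
  (* At a zero of the sine, a shift by dl turns it into the product of a nonzero cosine and the sine
     of an angle of absolute value in ]0, pi/2]. *)
  pose dl := Num.min ((b' - a') / 4) (pi / `|t n|).
  have tn : 0 < `|t n| by rewrite normr_gt0.
  have dl0 : 0 < dl by rewrite lt_min !divr_gt0 ?pi_gt0// subr_gt0.
  have dl1 : dl <= (b' - a') / 4 by rewrite ge_min lexx.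
  have dl2 : `|t n| * dl <= pi by rewrite mulrC -ler_pdivlMr// ge_min lexx orbT.
  exists (c + dl); first by rewrite /c; apply/andP; split; lra.
  rewrite mulrDr mulrDl sinD sc mul0r add0r mulf_neq0//.
    apply/eqP => cc; have := cos2Dsin2 (t n * c / 2); rewrite cc sc expr0n /= addr0 => /eqP.
    by rewrite eq_sym oner_eq0.
  have : 0 < sin (`|t n| * dl / 2).
    apply: sin_gt0_pi; apply/andP; split; first by rewrite divr_gt0// mulr_gt0.
    have := pi_gt0 R; lra.
  case: (ltgtP (t n) 0) tn0 => // tn0 _.
    by rewrite ltr0_norm// mulNr mulNr sinN oppr_gt0 => h'; rewrite lt_eqF.
  by rewrite gtr0_norm// => h'; rewrite gt_eqF.
have : \forall x \near x1, sin (t n * x / 2) != 0.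
  have c : (fun x : R => sin (t n * x / 2)) @ x1 --> sin (t n * x1 / 2).
    apply: continuous_comp; last exact: continuous_sin.
    by apply: cvgM; [apply: cvgM; [exact: cvg_cst|exact: cvg_id]|exact: cvg_cst].
  by have := cvgr_neq0 _ c sx1; apply.
move=> [e /= e0 he].
exists (Num.max a' (x1 - e)), (Num.min b' (x1 + e)); split.
- by rewrite le_max aa'.
- by rewrite gt_max !lt_min; lra.
- by rewrite ge_min bb'.
- move=> x; rewrite gt_max lt_min => /andP[/andP[x2 x3] /andP[x4 x5]].
  rewrite big_ord_recr mulf_neq0//=; first by apply: h; rewrite x2.
  have : sin (t n * x / 2) != 0 by apply: he; rewrite /ball /= ltr_distlC; lra.
  by rewrite -sincM mulf_eq0 negb_or => /andP[].
Qed.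

Let rest t j K x : R := \prod_(k < K) sinc (t (j + k)%N * x / 2) *
  expR (- ((1 - (\sum_(k < j + K) t k ^+ 2) / 12) * x ^+ 2 / 2)).

Let dcf_trunc_split t j K x :
  dcf_trunc t (j + K) x = \prod_(k < j) sinc (t k * x / 2) * rest t j K x.
Proof. by rewrite /dcf_trunc /rest big_split_ord /= mulrA. Qed.

(* Off the zeros of the common factors, the remaining product for t is small
   near 2 pi / t_j whereas that for t' is bounded below. *)
Lemma dcf_lt_neq t t' j : predust t -> predust t' ->
  (forall i, (i < j)%N -> t i = t' i) -> t' j < t j -> dcf t = dcf t' -> False.
Proof.
move=> pt pt' tt' jlt dE.
have [t0 _ t12] := pt; have [t'0 _ t'12] := pt'.
have tj : 0 < t j by apply: le_lt_trans (t'0 j) jlt.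
(* The first positive zero of sinc(t_j x / 2). As t'_j < t_j, the arguments of the remaining factors
   for t' stay away from pi up to x0. *)
pose x0 := 2 * pi / t j.
have x00 : 0 < x0 by rewrite divr_gt0// mulr_gt0// pi_gt0.
have p0 := pi_gt0 R.
have thpi : t' j * x0 / 2 < pi.
  rewrite (_ : pi = t j * x0 / 2); last by rewrite /x0; field; rewrite gt_eqF.
  by rewrite ltr_pM2r// ltr_pM2r.
have [|C C0 hC] := @sinc_ge_expR (t' j * x0 / 2) _ thpi.
  by rewrite divr_ge0// mulr_ge0// ltW.
(* The remaining sinc factors for t' contribute at most C 12 x0^2 / 4 = 3 C x0^2 to the exponent,
   and the normal factor at most x0^2 / 2. *)
pose c := expR (- ((3 * C + 1) * x0 ^+ 2)).
have c0 : 0 < c := expR_gt0 _.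
have rest_ge K x : 0 < x < x0 -> c <= rest t' j K x.
  move=> /andP[x_gt0 xx0].
  have h1 : expR (- (C * (\sum_(k < K) t' (j + k)%N ^+ 2) * x ^+ 2 / 4)) <=
      \prod_(k < K) sinc (t' (j + k)%N * x / 2).
    elim: K => [|K IH]; first by rewrite !big_ord0 mulr0 !mul0r oppr0 expR0.
    rewrite !big_ord_recr /= mulrDr !mulrDl opprD expRD ler_pM ?expR_ge0//.
    rewrite (_ : C * _ * _ / 4 = C * (t' (j + K)%N * x / 2) ^+ 2); last by field.
    apply: hC; rewrite ger0_norm; last by rewrite divr_ge0// mulr_ge0// ltW.
    rewrite ler_pM2r//; apply: ler_pM => //; [exact: ltW| |exact: ltW].
    by apply: predust_nonincr => //; exact: leq_addr.
  have s12 : \sum_(k < K) t' (j + k)%N ^+ 2 <= 12.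
    apply: le_trans (t'12 (j + K)%N); rewrite big_split_ord /= lerDr.
    by apply: sumr_ge0 => i _; exact: sqr_ge0.
  have s0 : 0 <= \sum_(k < K) t' (j + k)%N ^+ 2 by apply: sumr_ge0 => i _; exact: sqr_ge0.
  have v0 : 0 <= \sum_(k < j + K) t' k ^+ 2 by apply: sumr_ge0 => i _; exact: sqr_ge0.
  have xx : x ^+ 2 <= x0 ^+ 2 by rewrite ler_sqr ?nnegrE ltW.
  have x20 : 0 <= x ^+ 2 := sqr_ge0 x.
  apply: (@le_trans _ _ (expR (- (C * (\sum_(k < K) t' (j + k)%N ^+ 2) * x ^+ 2 / 4)) *
     expR (- ((1 - (\sum_(k < j + K) t' k ^+ 2) / 12) * x ^+ 2 / 2)))); last first.
    by rewrite ler_pM2r ?expR_gt0.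
  rewrite -expRD ler_expR -opprD lerN2.
  set s := \sum_(k < K) _ in s12 s0 *; set v := \sum_(k < _) _ in v0 *.
  have e1 : C * s * x ^+ 2 <= C * 12 * x0 ^+ 2.
    apply: (@le_trans _ _ (C * s * x0 ^+ 2)); first by rewrite ler_wpM2l// mulr_ge0.
    by rewrite ler_wpM2r ?sqr_ge0// ler_wpM2l.
  have e2 : (1 - v / 12) * x ^+ 2 <= 1 * x0 ^+ 2.
    apply: (@le_trans _ _ (1 * x ^+ 2)); last by rewrite ler_wpM2l.
    by rewrite ler_wpM2r//; lra.
  have : 0 <= x0 ^+ 2 := sqr_ge0 x0.
  lra.
have rest_le K x : `|rest t j K.+1 x| <= `|sinc (t j * x / 2)|.
  rewrite /rest big_ord_recl addn0 -mulrA normrM ler_piMr// normrM mulr_ile1//.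
    exact: (@ler_norm_prod _ (fun i => sinc (t (j + i.+1)%N * x / 2)) K (fun=> sinc_abs_le1 _)).
  rewrite ger0_norm ?expR_ge0// -[leRHS]expR0 ler_expR oppr_le0 divr_ge0// mulr_ge0 ?sqr_ge0//.
  by have := t12 (j + K.+1)%N; lra.
have [e e0 he] : exists2 e, 0 < e & forall x, `|x0 - x| < e -> `|sinc (t j * x / 2)| < c.
  have h : `|sinc (t j * x / 2)| @[x --> x0] --> `|sinc (t j * x0 / 2)|.
    apply: cvg_norm; apply: continuous_cvg; first exact: continuous_sinc.
    by apply: cvgM; [apply: cvgM; [exact: cvg_cst|exact: cvg_id]|exact: cvg_cst].
  have s0 : `|sinc (t j * x0 / 2)| < c.
    rewrite (_ : t j * x0 / 2 = pi); last by rewrite /x0; field; rewrite gt_eqF.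
    by rewrite sinc_pi normr0.
  by have [e /= e0 he] := cvgr_lt _ h _ s0; exists e.
have [x /andP[xa xx0] A0] : exists2 x, Num.max (x0 / 2) (x0 - e) < x < x0 &
    \prod_(i < j) sinc (t i * x / 2) != 0.
  by apply: sinc_prod_neq0; [rewrite lt_max divr_gt0|rewrite gt_max; apply/andP; split; lra].
move: xa; rewrite gt_max => /andP[xa xe].
set A := \prod_(i < j) _ in A0.
have AE : \prod_(i < j) sinc (t' i * x / 2) = A.
  by apply: eq_bigr => i _; rewrite tt'.
have lim_rest (s : nat -> R) : predust s -> \prod_(i < j) sinc (s i * x / 2) = A ->
    rest s j K x @[K --> \oo] --> dcf s x / A.
  move=> ps sA.
  have h : dcf_trunc s (K + j) x @[K --> \oo] --> dcf s x.
    by rewrite (cvg_shiftn j (fun K => dcf_trunc s K x)); exact: cvg_dcf.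
  have -> : (fun K => rest s j K x) = (fun K => dcf_trunc s (K + j) x / A).
    by apply/funext => K; rewrite addnC dcf_trunc_split sA mulrAC mulfV// mul1r.
  by apply: cvgM => //; exact: cvg_cst.
have l1 : c <= dcf t x / A.
  rewrite dE; apply: (cvgr_to_ge (lim_rest t' pt' AE)); apply: nearW => K.
  by apply: rest_ge; lra.
have l2 : dcf t x / A <= `|sinc (t j * x / 2)|.
  apply: (cvgr_to_le (lim_rest t pt erefl)); exists 1%N => // -[//|K] _ /=.
  by apply: le_trans (rest_le K x); exact: ler_norm.
have : `|sinc (t j * x / 2)| < c by apply: he; rewrite ger0_norm; lra.
lra.
Qed.

Lemma dcf_inj t t' : predust t -> predust t' -> dcf t = dcf t' -> t = t'.
Proof.
move=> pt pt' dE; apply/funext => n; elim/ltn_ind: n => j IH.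
case: (ltgtP (t j) (t' j)) => // h; exfalso.
  by apply: (dcf_lt_neq pt' pt _ h) => // i /IH ->.
exact: (dcf_lt_neq pt pt' IH h).
Qed.

End DcfInjective.

(** * Random variables with a factored generating polynomial *)

Section CosineTransform.
Context {R : realType}.
Implicit Types (p q : {poly R}) (x al : R).

(** The real part of e^(i al) p(e^(i x)). *)
Definition cos_transform x al p : R := \sum_(k < size p) p`_k * cos (k%:R * x + al).

Lemma cos_transform_widen x al p N : (size p <= N)%N ->
  cos_transform x al p = \sum_(k < N) p`_k * cos (k%:R * x + al).
Proof.
move=> pN; rewrite /cos_transform (big_ord_widen _ (fun k => p`_k * cos (k%:R * x + al)) pN).
rewrite big_mkcond /=; apply: eq_bigr => k _; case: ltnP => // pk.
by rewrite nth_default// mul0r.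
Qed.

Lemma cos_transformD x al p q :
  cos_transform x al (p + q) = cos_transform x al p + cos_transform x al q.
Proof.
pose N := maxn (size (p + q)%R) (maxn (size p) (size q)).
rewrite !(@cos_transform_widen x al _ N) ?leq_max ?leqnn ?orbT// -big_split /=.
by apply: eq_bigr => k _; rewrite coefD mulrDl.
Qed.

Lemma cos_transform0 x al : cos_transform x al 0 = 0.
Proof. by rewrite /cos_transform size_poly0 big_ord0. Qed.

Lemma cos_transform1 x al : cos_transform x al 1 = cos al.
Proof. by rewrite /cos_transform size_poly1 big_ord1 coef1 mul0r add0r mul1r. Qed.

Lemma cos_transformXn x al p i :
  cos_transform x al (p * 'X^i) = cos_transform x (i%:R * x + al) p.
Proof.
rewrite (@cos_transform_widen x al _ (i + size p)); last first.
  have [->|p0] := eqVneq p 0; first by rewrite mul0r size_poly0.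
  by rewrite size_mulXn.
rewrite big_split_ord /= big1 ?add0r => [|k _]; last by rewrite coefMXn ltn_ord mul0r.
apply: eq_bigr => k _; rewrite coefMXn ltnNge leq_addr /= addKn natrD mulrDl.
by congr (_ * cos _); ring.
Qed.

(** The Dirichlet kernel, multiplied out so that it remains valid where sin(x/2) = 0. *)
Lemma dirichlet_cos (h : nat) x al :
  (\sum_(i < h) cos (i%:R * x + al)) * sin (x / 2) =
  sin (h%:R * x / 2) * cos (al + (h%:R - 1) * x / 2).
Proof.
elim: h => [|h IH]; first by rewrite big_ord0 !mul0r sin0 mul0r.
rewrite big_ord_recr mulrDl IH /=.
have E (a b : R) : sin a * cos b = (sin (a + b) + sin (a - b)) / 2.
  by rewrite sinD sinB; field.
rewrite ![cos _ * sin _]mulrC !E -mulrDl; congr (_ / 2).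
have -> : h.+1%:R = h%:R + 1 :> R by rewrite -natr1.
have -> : h%:R * x / 2 - (al + (h%:R - 1) * x / 2) = x / 2 - al by field.
have -> : (h%:R + 1) * x / 2 - (al + (h%:R + 1 - 1) * x / 2) = x / 2 - al by field.
have -> : (h%:R + 1) * x / 2 + (al + (h%:R + 1 - 1) * x / 2) = x / 2 + (h%:R * x + al) by field.
have -> : h%:R * x / 2 + (al + (h%:R - 1) * x / 2) = h%:R * x + al - x / 2 by field.
have -> : x / 2 - (h%:R * x + al) = - (h%:R * x + al - x / 2) by ring.
by rewrite sinN; ring.
Qed.

(** On the unit circle [h] is sin(hx/2) / sin(x/2) times the phase (h - 1) x / 2, which moves into
    the angle al. *)
Lemma cos_transform_qint x al p h :
  cos_transform x al (p * qint R h) * sin (x / 2) =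
  sin (h%:R * x / 2) * cos_transform x (al + (h%:R - 1) * x / 2) p.
Proof.
rewrite /qint mulr_sumr.
have -> : cos_transform x al (\sum_(i < h) p * 'X^i) =
    \sum_(i < h) cos_transform x (i%:R * x + al) p.
  elim: h => [|h IH]; first by rewrite !big_ord0 cos_transform0.
  by rewrite !big_ord_recr /= cos_transformD IH cos_transformXn.
rewrite /cos_transform exchange_big /= mulr_suml mulr_sumr; apply: eq_bigr => k _.
rewrite -mulr_sumr -mulrA.
have -> : \sum_(i < h) cos (k%:R * x + (i%:R * x + al)) = \sum_(i < h) cos (i%:R * x + (k%:R * x + al)).
  by apply: eq_bigr => i _; congr cos; ring.
by rewrite dirichlet_cos mulrCA addrA.
Qed.

Lemma cos_transform_qints x al p (s : seq nat) :
  cos_transform x al (p * \prod_(h <- s) qint R h) * sin (x / 2) ^+ size s =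
  (\prod_(h <- s) sin (h%:R * x / 2)) *
  cos_transform x (al + (\sum_(h <- s) (h%:R - 1)) * x / 2) p.
Proof.
elim: s p al => [|h s IH] p al.
  by rewrite !big_nil mulr1 expr0 mul1r mulr1 !mul0r addr0.
rewrite !big_cons exprS mulrA mulrA.
have -> : p * qint R h * \prod_(j <- s) qint R j = (p * \prod_(j <- s) qint R j) * qint R h by rewrite mulrAC.
rewrite cos_transform_qint -mulrA IH mulrA; congr (_ * cos_transform _ _ _); ring.
Qed.

End CosineTransform.

Definition power_sum {R : realType} (n : nat) (s : seq nat) : R := \sum_(k <- s) k%:R ^+ n.

Section PolynomialLaw.
Context {R : realType} {d : measure_display} {T : measurableType d}.
Variables (P : probability T R) (X : {RV P >-> R}) (L : {poly R}).
Hypothesis L1 : L.[1] != 0.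
Hypothesis X_law : forall k : nat, P (X @^-1` [set k%:R]) = (L`_k / L.[1])%:E.
Local Notation RR := (measurableTypeR R).

Let p k : R := L`_k / L.[1].

Lemma plaw_mass : \sum_(k < size L) L`_k / L.[1] = 1.
Proof.
rewrite -mulr_suml (_ : \sum_(k < size L) L`_k = L.[1]) ?divff//.
by rewrite horner_coef; apply: eq_bigr => k _; rewrite expr1n mulr1.
Qed.

Let p_ge0 k : 0 <= p k.
Proof. by rewrite -lee_fin -X_law measure_ge0. Qed.

Let p_sum : \sum_(k < size L) p k = 1.
Proof. exact: plaw_mass. Qed.

Let at_ (k : nat) : set T := X @^-1` [set k%:R].

Let m_at k : measurable (at_ k).
Proof. exact: measurable_RV_preimage (measurable_set1 _). Qed.

Let supp : set T := \big[setU/set0]_(k < size L) at_ k.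

Let suppP w : supp w -> exists k : 'I_(size L), X w = k%:R.
Proof.
rewrite /supp; elim/big_ind: _ => //= [A B hA hB [/hA|/hB]//|k _ wk].
by exists k.
Qed.

Let m_supp : measurable supp.
Proof. exact: bigsetU_measurable. Qed.

(** The hypothesis on X only gives the masses at the natural numbers. Those below [size L] already
    add up to 1, so X takes one of these values almost surely and its integrals are finite sums. *)
Let supp_null : P (~` supp) = 0%E.
Proof.
have tA : trivIset setT (fun k : 'I_(size L) => at_ k).
  apply/trivIsetP => i j _ _ ij; apply/seteqP; split => w //= [Xi Xj].
  have /eqP : i%:R = j%:R :> R by rewrite -Xi -Xj.
  by rewrite eqr_nat => /eqP/val_inj/eqP; rewrite (negbTE ij).
have e1 : P supp = 1%E.
  rewrite (@measure_semi_additive_ord _ _ _ P (size L) (fun k => at_ k))//.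
  rewrite (eq_bigr (fun k : 'I_(size L) => (p k)%:E)) ?sumEFin ?p_sum// => k _.
  exact: X_law.
by rewrite probability_setC// e1 subee.
Qed.

Lemma integral_polynomial_law (g : RR -> R) : measurable_fun setT g ->
  (\int[P]_w (g (X w))%:E = (\sum_(k < size L) g k%:R * (L`_k / L.[1]))%:E)%E.
Proof.
move=> mg.
pose h w := (\sum_(k < size L) (g k%:R * \1_(at_ k) w)%:E)%E.
have bk (k : 'I_(size L)) : bmeas (fun w => g k%:R * \1_(at_ k) w : R).
  by apply: bmeasZ; exact: bmeas_indic.
have mh : measurable_fun setT h.
  by apply: emeasurable_sum => k; apply/measurable_EFinP; case: (bk k).
have mgX : measurable_fun setT (fun w => (g (X w))%:E).
  by apply/measurable_EFinP; apply: (@measurableT_comp _ _ _ _ _ _ g) => //; exact: (measurable_funPT (toRR X)).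
rewrite (ae_eq_integral h)//; last first.
  exists (~` supp); split => //; first exact: measurableC.
  move=> w /= nh sw; apply: nh => _; have [k Xk] := suppP sw.
  rewrite /h sumEFin; congr EFin; rewrite (bigD1 k)//= big1 => [|j jk].
    by rewrite indicE mem_set ?mulr1 ?addr0 ?Xk.
  rewrite indicE memNset ?mulr0// /at_ /= Xk => /eqP; rewrite eqr_nat => /eqP/val_inj kj.
  by move: jk; rewrite kj eqxx.
have ik (k : 'I_(size L)) : P.-integrable setT (fun w => (g k%:R * \1_(at_ k) w)%:E).
  exact: bmeas_integrable.
rewrite /h (integral_sum measurableT ik) -sumEFin.
apply: eq_bigr => k _; under eq_integral do rewrite EFinM.
rewrite integralZl//; last by apply: bmeas_integrable; exact: bmeas_indic.
by rewrite integral_indic// setIT EFinM -X_law.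
Qed.

Definition plaw_mean : R := \sum_(k < size L) k%:R * (L`_k / L.[1]).
Definition plaw_var : R := \sum_(k < size L) (k%:R - plaw_mean) ^+ 2 * (L`_k / L.[1]).

Lemma plaw_expectation : ('E_P[X])%E = plaw_mean%:E.
Proof. by rewrite expectation_def (@integral_polynomial_law id). Qed.

Lemma plaw_variance : ('V_P[X])%E = plaw_var%:E.
Proof.
rewrite /variance unlock plaw_expectation /= unlock.
rewrite -(@integral_polynomial_law (fun y => (y - plaw_mean) ^+ 2)) //.
by apply: measurable_funX; apply: measurable_funB.
Qed.

Lemma plaw_mgf s : fine ('M_P X s) = L.[expR s] / L.[1].
Proof.
rewrite /mmt_gen_fun unlock.
rewrite (@integral_polynomial_law (fun y => expR (y * s))); last first.
  by apply: measurableT_comp => //; apply: measurable_funM.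
rewrite [L.[expR s]]horner_coef mulr_suml [LHS]/=; apply: eq_bigr => k _.
by rewrite expRM_natl; ring.
Qed.

Lemma standardizeE w : standardize X w = (X w - plaw_mean) / Num.sqrt plaw_var.
Proof. by rewrite /standardize /= plaw_expectation plaw_variance. Qed.

(** Chebyshev's inequality for the standardized variable. *)
Lemma plaw_tight (l : R) : 0 < l -> fine (P [set w | l < `|standardize X w|]) <= l ^- 2.
Proof.
move=> l0.
pose Y (y : R) := (y - plaw_mean) / Num.sqrt plaw_var.
have mY : measurable_fun setT (Y : RR -> R).
  by apply: measurable_funM => //; apply: measurable_funB.
have mA : measurable [set y : RR | l < `|Y y|].
  have h := @measurable_fun_ltr _ RR R setT (fun=> l) (fun y => `|Y y|) (measurable_cst _).
  rewrite -[X in measurable X]setTI; apply: (h _ measurableT [set true]) => //.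
  exact: measurableT_comp.
have -> : fine (P [set w | l < `|standardize X w|]) =
   \sum_(k < size L) \1_[set y : RR | l < `|Y y|] (k%:R) * (L`_k / L.[1]).
  rewrite -[RHS]/(fine (_)%:E) -integral_polynomial_law; last exact: measurable_indic.
  have -> : [set w | l < `|standardize X w|] = X @^-1` [set y : RR | l < `|Y y|].
    by apply/funext => w; rewrite /mkset /preimage standardizeE.
  rewrite -[in LHS](setIT (X @^-1` _)) -integral_indic//; first exact: measurable_RV_preimage.
have h (k : nat) : \1_[set y : RR | l < `|Y y|] (k%:R : RR) <= Y k%:R ^+ 2 / l ^+ 2.
  rewrite indicE; case: (boolP (_ \in _)) => [|_]; last by rewrite divr_ge0 ?sqr_ge0.
  rewrite inE /= => lY; rewrite ler_pdivlMr ?exprn_gt0// mul1r -[leRHS]real_normK ?num_real//.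
  by rewrite ler_sqr ?nnegrE ?normr_ge0 ?(ltW lY) ?(ltW l0).
apply: (@le_trans _ _ (\sum_(k < size L) Y k%:R ^+ 2 / l ^+ 2 * (L`_k / L.[1]))).
  by apply: ler_sum => k _; rewrite ler_wpM2r// p_ge0.
have v0 : 0 <= plaw_var by apply: sumr_ge0 => k _; rewrite mulr_ge0 ?sqr_ge0 ?p_ge0.
have -> : \sum_(k < size L) Y k%:R ^+ 2 / l ^+ 2 * (L`_k / L.[1]) = plaw_var / plaw_var / l ^+ 2.
  rewrite {1}/plaw_var !mulr_suml; apply: eq_bigr => k _.
  by rewrite /Y expr_div_n sqr_sqrtr//; ring.
(* The quotient of the variance by itself is 1, or 0 in the degenerate case; at most 1 in both. *)
apply: ler_piMl; first by rewrite invr_ge0 exprn_ge0 ?ltW.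
by have [->|v] := eqVneq plaw_var 0; rewrite ?mul0r ?divff.
Qed.

Section Factored.
Local Notation power_sum := (@power_sum R).
Variables (fs hs : seq nat).
Hypothesis size_fh : size fs = size hs.
Hypothesis fs0 : all (leq 1) fs.
Hypothesis hs0 : all (leq 1) hs.
Hypothesis Lfac : L * \prod_(h <- hs) qint R h = \prod_(f <- fs) qint R f.

Let mu : R := (power_sum 1 fs - power_sum 1 hs) / 2.

(** [cos_transform_qints] is applied to both sides of the factorization. As there are as many f as
    h, the powers of sin(x/2) cancel formally, and the difference of the phases is the centring by
    [mu]. The product over h stays on the left because it may vanish. *)
Lemma plaw_cos x th :
  (\sum_(k < size L) cos (x * (k%:R - mu) + th) * (L`_k / L.[1])) *
    \prod_(h <- hs) sinc (h%:R * x / 2) =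
  cos th * \prod_(f <- fs) sinc (f%:R * x / 2).
Proof.
have [->|x0] := eqVneq x 0.
  rewrite [X in _ * X]big1 ?[X in _ = _ * X]big1 ?mulr1; [|by move=> k _; rewrite mulr0 mul0r sinc0..].
  under eq_bigr do rewrite mul0r add0r.
  by rewrite -mulr_sumr p_sum mulr1.
have L1E : L.[1] * \prod_(h <- hs) h%:R = \prod_(f <- fs) f%:R.
  have := congr1 (horner^~ 1) Lfac; rewrite hornerM !horner_prod.
  by under eq_bigr do rewrite qint_horner1; under [in RHS]eq_bigr do rewrite qint_horner1.
have nz (s : seq nat) : all (leq 1) s -> \prod_(h <- s) h%:R != 0 :> R.
  move=> /allP s0; rewrite prodf_seq_neq0; apply/allP => h /s0 h0 /=.
  by rewrite pnatr_eq0 -lt0n.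
have sinE (s : seq nat) : \prod_(h <- s) sin (h%:R * x / 2) =
    (\prod_(h <- s) sinc (h%:R * x / 2)) * (\prod_(h <- s) h%:R) * (x / 2) ^+ size s.
  elim: s => [|h s IH]; first by rewrite !big_nil expr0 !mulr1.
  by rewrite !big_cons IH /= exprS -sincM; ring.
pose al := th - (\sum_(f <- fs) (f%:R - 1)) * x / 2.
have := cos_transform_qints x al 1 fs; rewrite mul1r -Lfac size_fh cos_transform_qints.
rewrite cos_transform1 !sinE /al subrK size_fh.
have x2 : (x / 2) ^+ size hs != 0 by rewrite expf_neq0// mulf_neq0// invr_neq0.
have -> : th - (\sum_(f <- fs) (f%:R - 1)) * x / 2 + (\sum_(h <- hs) (h%:R - 1)) * x / 2 = th - mu * x.
  have sumE (s : seq nat) : \sum_(f <- s) (f%:R - 1) = power_sum 1 s - (size s)%:R :> R.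
    rewrite big_split /= sumrN big_const_seq count_predT iter_addr_0; congr (_ - _).
  by rewrite !sumE /mu size_fh; field.
move=> H; apply: (mulIf x2); apply: (mulIf (nz _ fs0)).
have -> : \sum_(k < size L) cos (x * (k%:R - mu) + th) * (L`_k / L.[1]) =
    cos_transform x (th - mu * x) L / L.[1].
  rewrite /cos_transform mulr_suml; apply: eq_bigr => k _.
  rewrite mulrC -mulrA [L.[1]^-1 * _]mulrC mulrA; congr (_ * cos _ / _); ring.
rewrite -[in LHS]L1E.
have -> : cos_transform x (th - mu * x) L / L.[1] * \prod_(h <- hs) sinc (h%:R * x / 2) *
    (x / 2) ^+ size hs * (L.[1] * \prod_(h <- hs) h%:R) =
    \prod_(h <- hs) sinc (h%:R * x / 2) * \prod_(h <- hs) h%:R * (x / 2) ^+ size hs *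
    cos_transform x (th - mu * x) L by field.
by rewrite H; ring.
Qed.

Let lsum (F : nat -> R -> R) (s : seq nat) (y : R) : R := \sum_(k <- s) F k y.

Let is_derive_lsum s (y : R) : all (leq 1) s ->
  is_derive y 1 (lsum (fun k s => ln (qexp k s)) s) (lsum (@dlnq R) s y).
Proof.
elim: s => [|k s IH].
  move=> _; rewrite /lsum; have -> : (fun y : R => \sum_(k <- [::]) ln (qexp k y)) = cst 0.
    by apply/funext => z; rewrite big_nil.
  by rewrite big_nil; exact: is_derive_cst.
move=> /= /andP[k0 s0]; rewrite /lsum.
have -> : (fun y : R => \sum_(k <- k :: s) ln (qexp k y)) =
   (fun y => ln (qexp k y)) \+ lsum (fun k s => ln (qexp k s)) s.
  by apply/funext => z; rewrite big_cons.
rewrite big_cons; apply: is_deriveD; [exact: is_derive_ln_qexp|exact: IH].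
Qed.

Let lsum_cons F k s : lsum F (k :: s) = F k \+ lsum F s.
Proof. by apply/funext => z; rewrite /lsum big_cons. Qed.

Let lsum_nil F : lsum F [::] = cst 0.
Proof. by apply/funext => z; rewrite /lsum big_nil. Qed.

Let Cn_lsum n s : all (leq 1) s -> Cn n (lsum (@dlnq R) s).
Proof.
elim: s => [|k s IH] /=; first by rewrite lsum_nil => _; exact: Cn_cst.
by move=> /andP[k0 s0]; rewrite lsum_cons; apply: CnD; [exact: Cn_dlnq|exact: IH].
Qed.

Let taylor_lsum n s : all (leq 1) s ->
  taylor (lsum (@dlnq R) s) n = (power_sum n.+1 s - (size s)%:R) * bernoulli_number R n.+1 / n.+1`!%:R +
    (n == 0%N)%:R * (power_sum 1 s - (size s)%:R).
Proof.
elim: s => [|k s IH] /=.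
  by rewrite lsum_nil taylor_cst /power_sum !big_nil subrr mulr0 !mul0r addr0; case: n.
move=> /andP[k0 s0]; rewrite lsum_cons taylorD; [|exact: Cn_dlnq|exact: Cn_lsum].
rewrite IH// taylor_dlnq// /power_sum !big_cons expr1 -natr1.
have := pnatr_eq0 R n.+1`!; rewrite gtn_eqF ?fact_gt0// => /negbT fn0.
by field.
Qed.

Let M (y : R) : R := L.[expR y] / L.[1].

Let qexp_prod_gt0 s (y : R) : all (leq 1) s -> 0 < \prod_(k <- s) qexp k y.
Proof.
by move=> /allP s0; rewrite big_seq; apply: prodr_gt0 => k /s0; exact: qexp_gt0.
Qed.

Let ln_prod s (y : R) : all (leq 1) s ->
  ln (\prod_(k <- s) qexp k y) = lsum (fun k s => ln (qexp k s)) s y.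
Proof.
elim: s => [|k s IH] /=; first by rewrite /lsum !big_nil ln1.
move=> /andP[k0 s0]; rewrite /lsum !big_cons lnM ?posrE ?qexp_gt0 ?qexp_prod_gt0//.
by rewrite IH.
Qed.

Let LE (y : R) : L.[expR y] * \prod_(k <- hs) qexp k y = \prod_(k <- fs) qexp k y.
Proof. by have := congr1 (horner^~ (expR y)) Lfac; rewrite hornerM !horner_prod. Qed.

Let L_gt0 (y : R) : 0 < L.[expR y].
Proof. by rewrite -(pmulr_lgt0 _ (qexp_prod_gt0 y hs0)) LE qexp_prod_gt0. Qed.

Let L1_gt0 : 0 < L.[1].
Proof. by have := L_gt0 0; rewrite expR0. Qed.

Let lnME (y : R) : ln (M y) = lsum (fun k s => ln (qexp k s)) fs y -
  lsum (fun k s => ln (qexp k s)) hs y - ln L.[1].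
Proof.
rewrite -!ln_prod//.
have -> : ln (\prod_(k <- fs) qexp k y) = ln L.[expR y] + ln (\prod_(k <- hs) qexp k y).
  by rewrite -LE lnM ?posrE ?qexp_prod_gt0.
rewrite addrK.
by rewrite /M ln_div ?posrE.
Qed.

Let D (y : R) : R := lsum (@dlnq R) fs y - lsum (@dlnq R) hs y.

Let is_derive_lnM (y : R) : is_derive y 1 (fun y => ln (M y)) (D y).
Proof.
have -> : (fun y => ln (M y)) = (lsum (fun k s => ln (qexp k s)) fs \-
  lsum (fun k s => ln (qexp k s)) hs) \- cst (ln L.[1]) by apply/funext => z; rewrite lnME.
have H := @is_deriveB R _ _ _ _ y 1 _ _ (@is_deriveB R _ _ _ _ y 1 _ _ (is_derive_lsum y fs0)
  (is_derive_lsum y hs0)) (is_derive_cst (ln L.[1]) y 1).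
by apply: (is_derive_eq H); rewrite subr0.
Qed.

Let cumulant_taylor n : cumulant X n.+1 = n`!%:R * taylor D n.
Proof.
rewrite /cumulant (_ : (fun s => _) = (fun y => ln (M y))); last first.
  by apply/funext => y; rewrite plaw_mgf.
have := taylorS n is_derive_lnM; rewrite /taylor => <-.
have := pnatr_eq0 R n`!; rewrite gtn_eqF ?fact_gt0// => /negbT fn0.
rewrite factS natrM; field.
by rewrite fn0 nat1r pnatr_eq0.
Qed.

(** Logarithms turn the factorization into a difference of sums of ln [k] at e^s, to which
    [taylor_dlnq] applies. The contributions -1 cancel since both lists have the same size; the
    extra term at n = 0 comes from the linear correction in the Bernoulli series. *)
Lemma plaw_cumulant n : cumulant X n.+1 =
  bernoulli_number R n.+1 / n.+1%:R * (power_sum n.+1 fs - power_sum n.+1 hs) +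
  (n == 0%N)%:R * (power_sum 1 fs - power_sum 1 hs).
Proof.
rewrite cumulant_taylor.
have -> : D = lsum (@dlnq R) fs \+ (cst (-1) \* lsum (@dlnq R) hs).
  by apply/funext => y; rewrite /D /= mulN1r.
have CN : Cn n (cst (-1) \* lsum (@dlnq R) hs) by apply: CnM; [exact: Cn_cst|exact: Cn_lsum].
rewrite taylorD//; last exact: Cn_lsum.
have -> : taylor (cst (-1) \* lsum (@dlnq R) hs) n = - taylor (lsum (@dlnq R) hs) n.
  have h : lsum (@dlnq R) hs \+ (cst (-1) \* lsum (@dlnq R) hs) = cst 0.
    by apply/funext => y; rewrite /= mulN1r subrr.
  have := congr1 (taylor^~ n) h; rewrite taylorD//; last exact: Cn_lsum.
  by rewrite taylor_cst => e; apply/eqP; rewrite -addr_eq0 addrC e; case: (n).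
rewrite !taylor_lsum// size_fh factS natrM.
have := pnatr_eq0 R n`!; rewrite gtn_eqF ?fact_gt0// => /negbT fn0.
have Fb : n`!%:R * (n == 0%N)%:R = (n == 0%N)%:R :> R.
  by case: (n) => [|j]; rewrite ?mulr0// fact0 mul1r.
have N0 : n.+1%:R != 0 :> R by rewrite pnatr_eq0.
rewrite -[in RHS]Fb; move: N0 fn0; move: (n.+1%:R : R) (n`!%:R : R) ((n == 0%N)%:R : R) => N F b N0 F0.
by field; rewrite F0 N0.
Qed.

(** The j-th derivative of the moment generating function; it links the first two cumulants to the
    mean and variance by which X is standardized. *)
Let Mk j (y : R) : R := \sum_(k < size L) (k%:R ^+ j * (L`_k / L.[1])) * expR (k%:R * y).

Let is_derive_Mk j (y : R) : is_derive y 1 (Mk j) (Mk j.+1 y).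
Proof.
have -> : Mk j = \sum_(k < size L) (fun y => (k%:R ^+ j * (L`_k / L.[1])) * expR (k%:R * y)).
  by apply/funext => x; rewrite /Mk fct_sumE.
rewrite /Mk.
have -> : \sum_(k < size L) k%:R ^+ j.+1 * (L`_k / L.[1]) * expR (k%:R * y) =
   \sum_(k < size L) (k%:R ^+ j * (L`_k / L.[1])) * (k%:R * expR (k%:R * y)).
  by apply: eq_bigr => k _; rewrite exprS; ring.
apply: is_derive_sum => k.
exact: (@is_deriveZ R R R _ _ y 1 _ (is_derive_expRM k%:R y)).
Qed.

Let Mk0E : Mk 0 = M.
Proof.
apply/funext => y; rewrite /Mk /M [L.[expR y]]horner_coef mulr_suml; apply: eq_bigr => k _.
by rewrite expRM_natl expr0; ring.
Qed.

Let M_gt0 (y : R) : 0 < M y.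
Proof. by rewrite /M divr_gt0. Qed.

Let DE : D = fun y => Mk 1 y / Mk 0 y.
Proof.
rewrite -(is_derive1E is_derive_lnM); apply: is_derive1E => y.
rewrite Mk0E; have dM : is_derive y 1 M (Mk 1 y) by rewrite -Mk0E; exact: is_derive_Mk.
have h := is_derive1_comp (is_derive1_ln (M_gt0 y)) dM.
by apply: (is_derive_eq h); rewrite mulrC.
Qed.

Let Mk_at0 j : Mk j 0 = \sum_(k < size L) k%:R ^+ j * (L`_k / L.[1]).
Proof. by apply: eq_bigr => k _; rewrite mulr0 expR0 mulr1. Qed.

Let Mk00 : Mk 0 0 = 1.
Proof. by rewrite Mk0E /M expR0 divff. Qed.

Lemma plaw_mean_cumulant : plaw_mean = cumulant X 1.
Proof.
rewrite cumulant_taylor fact0 mul1r taylor0 DE Mk00 divr1 Mk_at0.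
by apply: eq_bigr => k _; rewrite expr1.
Qed.

Lemma plaw_var_cumulant : plaw_var = cumulant X 2.
Proof.
pose D2 (y : R) := Mk 1 y * (- (Mk 0 y ^- 2 * Mk 1 y)) + (Mk 0 y)^-1 * Mk 2 y.
have dD (y : R) : is_derive y 1 D (D2 y).
  have M0 : Mk 0 y != 0 by rewrite Mk0E gt_eqF.
  have H := @is_deriveM R _ _ _ y 1 _ _ (is_derive_Mk 1 y)
    (is_deriveV M0 (is_derive_Mk 0 y)).
  rewrite DE; apply: (is_derive_eq H).
  by rewrite /D2 /GRing.scale /= mulNr.
rewrite cumulant_taylor factS fact0 muln1 mul1r (taylorSE 0 dD) taylor0 divr1 /D2 Mk00.
rewrite !expr1n !invr1 !mul1r !Mk_at0.
have -> : \sum_(k < size L) k%:R ^+ 1 * (L`_k / L.[1]) = plaw_mean.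
  by apply: eq_bigr => k _; rewrite expr1.
rewrite /plaw_var.
have key (c : R) : \sum_(k < size L) (k%:R - c) ^+ 2 * (L`_k / L.[1]) =
   \sum_(k < size L) k%:R ^+ 2 * (L`_k / L.[1]) - 2 * c * (\sum_(k < size L) k%:R * (L`_k / L.[1]))
   + c ^+ 2 * \sum_(k < size L) L`_k / L.[1].
  rewrite !mulr_sumr -sumrN -!big_split /=; apply: eq_bigr => k _; ring.
by rewrite key plaw_mass -/plaw_mean; ring.
Qed.

Lemma plaw_meanE : plaw_mean = mu.
Proof. by rewrite plaw_mean_cumulant plaw_cumulant bernoulli1 eqxx mul1r divr1 /mu; field. Qed.

Lemma standardize_cf x th :
  \int[P]_w cos (x * standardize X w + th) *
    \prod_(h <- hs) sinc (h%:R * (x / Num.sqrt plaw_var) / 2) =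
  cos th * \prod_(f <- fs) sinc (f%:R * (x / Num.sqrt plaw_var) / 2).
Proof.
rewrite -plaw_cos; congr (_ * _).
pose g (y : R) := cos (x / Num.sqrt plaw_var * y + (th - x / Num.sqrt plaw_var * mu)).
rewrite (_ : (fun w => cos _) = g \o X); last first.
  by apply/funext => w; rewrite /g /comp standardizeE plaw_meanE; congr cos; ring.
rewrite /Rintegral (@integral_polynomial_law g) /=; last by case: (bmeas_cos (x / Num.sqrt plaw_var) (th - x / Num.sqrt plaw_var * mu)).
by apply: eq_bigr => k _; congr (cos _ * _); ring.
Qed.

End Factored.
End PolynomialLaw.

(** * Asymptotics of trees *)

Section FiniteNorms.
Context {R : realType}.
Variables (t : nat -> R) (m : nat).
Hypothesis t_ge0 : forall k, 0 <= t k.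
Hypothesis t_fin : forall k, (m <= k)%N -> t k = 0.

Lemma lp_norm_finite p : (0 < p)%N ->
  lp_norm p t = ((\sum_(k < m) t k ^+ p) `^ p%:R^-1)%:E.
Proof.
move=> p0; rewrite /lp_norm -poweR_EFin; congr poweR.
apply/cvg_lim => //; apply: cvg_near_cst; near=> M.
have mM : (m <= M)%N by near: M; exact: nbhs_infty_ge.
rewrite sumEFin big_mkord -(subnKC mM) big_split_ord /=; congr EFin.
rewrite [X in _ + X]big1 ?addr0// => k _; rewrite t_fin ?leq_addr// expr0n.
by rewrite gtn_eqF.
Unshelve. all: by end_near. Qed.

Lemma lp_norm_finiteX p : (0 < p)%N -> fine (lp_norm p t) ^+ p = \sum_(k < m) t k ^+ p.
Proof.
move=> p0; have s0 : 0 <= \sum_(k < m) t k ^+ p by apply: sumr_ge0 => k _; exact: exprn_ge0.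
rewrite lp_norm_finite//= -powR_mulrn ?powR_ge0// -powRrM mulVf ?powRr1//.
by rewrite pnatr_eq0 -lt0n.
Qed.

Lemma lp_norm_finite_ge0 p : 0 <= fine (lp_norm p t).
Proof. by apply: fine_ge0; exact: poweR_ge0. Qed.

End FiniteNorms.

Lemma pow_diff_le {R : realType} (a b : R) d : 0 <= a -> 0 <= b ->
  (a + b) ^+ d.+1 - a ^+ d.+1 <= d.+1%:R * b * (a + b) ^+ d.
Proof.
move=> a0 b0; elim: d => [|d IH]; first by rewrite !expr1 expr0 mulr1 mul1r addrAC subrr add0r.
have -> : (a + b) ^+ d.+2 - a ^+ d.+2 = (a + b) * ((a + b) ^+ d.+1 - a ^+ d.+1) + b * a ^+ d.+1.
  by rewrite ![_ ^+ d.+2]exprS; ring.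
have ab : 0 <= a + b by rewrite addr_ge0.
have h1 : b * a ^+ d.+1 <= b * (a + b) ^+ d.+1.
  by rewrite ler_wpM2l// lerXn2r ?nnegrE// lerDl.
have h2 := ler_wpM2l ab IH.
apply: le_trans (lerD h2 h1) _; rewrite -[d.+2%:R]natr1 [(a + b) ^+ d.+1]exprS.
by rewrite le_eqVlt; apply/orP; left; apply/eqP; ring.
Qed.

(** * Estimates for a single tree *)

Section OneTree.
Context {R : realType} {disp : Order.disp_t} {P : finPOrderType disp} (C : {set P}).
Hypothesis P_std : standardized_tree P.
Hypothesis C_chain : is_chain C.
Hypothesis C_max : #|C| = poset_rank P.

Let e k := nth 0%N (desc_elevations C) k.
Let r := poset_rank P.

Definition off_chain := #|~: C|.
Local Notation m := off_chain.

Definition elev_sum d : R := \sum_(k < m) (e k)%:R ^+ d.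
Definition gaps := [seq chain_gap C k | k <- iota 0 m].
Definition off_hooks := [seq hook_length u | u <- enum (~: C)].
(** The relative error, up to a constant, made by keeping only the elevations in power sums and
    characteristic functions. *)
Definition tree_defect : R := m%:R ^+ 2 / (r.-1)%:R.

Let rho : R := (r.-1)%:R.

Let rho_ge1 : 1 <= rho.
Proof. by rewrite (ler_nat R 1); have := poset_rank_ge2 P_std C_chain C_max; rewrite /r; lia. Qed.

Let rho_gt0 : 0 < rho.
Proof. exact: lt_le_trans ltr01 rho_ge1. Qed.

Lemma off_chain_gt0 : (0 < m)%N.
Proof.
rewrite lt0n; apply/eqP => m0.
have := nth0_desc_elevations P_std C_chain C_max.
rewrite nth_default ?size_desc_elevations -/m ?m0// => h.
by have := poset_rank_ge2 P_std C_chain C_max; move: h; lia.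
Qed.

Let e_le k : (e k)%:R <= rho.
Proof. by rewrite ler_nat; have := nth_desc_elevations_lt P_std C_chain C_max k; rewrite /e /r; lia. Qed.

Let e0E : (e 0)%:R = rho.
Proof. by rewrite /e nth0_desc_elevations. Qed.

Let e_fin k : (m <= k)%N -> e k = 0%N.
Proof. by move=> mk; rewrite /e nth_default// size_desc_elevations. Qed.

(** The largest elevation alone contributes this much. *)
Lemma elev_sum_ge d : rho ^+ d <= elev_sum d.
Proof.
rewrite /elev_sum; case: off_chain (off_chain_gt0) => // m' _.
by rewrite big_ord_recl e0E lerDl sumr_ge0// => k _; rewrite exprn_ge0.
Qed.

Lemma elev_sum_gt0 d : 0 < elev_sum d.
Proof. by apply: lt_le_trans (elev_sum_ge d); rewrite exprn_gt0. Qed.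

Lemma tree_defect_ge0 : 0 <= tree_defect.
Proof. by rewrite divr_ge0 ?sqr_ge0// ltW. Qed.

Let gap_sumE d : power_sum d gaps = \sum_(k < m) (chain_gap C k)%:R ^+ d :> R.
Proof. by rewrite /power_sum /gaps big_map -(big_mkord xpredT (fun k => (chain_gap C k)%:R ^+ d)) /index_iota subn0. Qed.

Let gap_ge k : (e k <= chain_gap C k)%N. Proof. exact: leq_addr. Qed.
Let gap_le k : (chain_gap C k <= e k + m)%N. Proof. by rewrite leq_add2l leq_subr. Qed.

Hypothesis m_le : (m <= r.-1)%N.

Let m_rho : m%:R <= rho. Proof. by rewrite ler_nat. Qed.

Lemma gap_sum_ge d : elev_sum d <= power_sum d gaps.
Proof. by rewrite gap_sumE; apply: ler_sum => k _; rewrite lerXn2r ?nnegrE// ler_nat. Qed.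

(** Each of the m gaps exceeds its elevation by at most m and is at most 2 (r - 1), so the
    difference of powers is at most (d + 1) m (2 (r - 1))^d. The sum is m^2 / (r - 1) times (r -
    1)^(d + 1), up to a constant. *)
Lemma gap_sum_le d :
  power_sum d.+1 gaps - elev_sum d.+1 <= (d.+1 * 2 ^ d)%:R * tree_defect * elev_sum d.+1.
Proof.
have h : power_sum d.+1 gaps - elev_sum d.+1 <= \sum_(k < m) d.+1%:R * m%:R * (2 * rho) ^+ d.
  rewrite gap_sumE /elev_sum -sumrB; apply: ler_sum => k _.
  have le1 : (chain_gap C k)%:R ^+ d.+1 <= ((e k)%:R + m%:R) ^+ d.+1 :> R.
    by rewrite lerXn2r ?nnegrE// -natrD ler_nat.
  apply: (@le_trans _ _ (((e k)%:R + m%:R) ^+ d.+1 - (e k)%:R ^+ d.+1)); first by rewrite lerB.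
  apply: le_trans (pow_diff_le _ _ _) _ => //.
  rewrite ler_wpM2l ?mulr_ge0// lerXn2r ?nnegrE ?addr_ge0 ?mulr_ge0 ?(ltW rho_gt0)//.
  by rewrite mulr_natl mulr2n lerD// e_le.
apply: (le_trans h); rewrite sumr_const card_ord -[leLHS]mulr_natr.
have -> : d.+1%:R * m%:R * (2 * rho) ^+ d * m%:R = (d.+1 * 2 ^ d)%:R * tree_defect * rho ^+ d.+1.
  by rewrite /tree_defect -/rho natrM natrX exprMn [rho ^+ d.+1]exprS; field; rewrite gt_eqF.
by rewrite ler_wpM2l ?mulr_ge0 ?tree_defect_ge0// elev_sum_ge.
Qed.

(** There are m off-chain hooks, each at most m; one factor is bounded by m and the d others by r -
    1. *)
Lemma hook_sum_le d : power_sum d.+1 off_hooks <= tree_defect * elev_sum d.+1.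
Proof.
have h : power_sum d.+1 off_hooks <= \sum_(u in ~: C) m%:R * rho ^+ d :> R.
  rewrite /power_sum /off_hooks big_map big_enum /=; apply: ler_sum => u.
  rewrite inE => uC; have hu := off_chain_hook_le P_std C_chain C_max uC.
  rewrite exprS ler_pM// ?exprn_ge0// ?ler_nat// lerXn2r ?nnegrE ?(ltW rho_gt0)//.
  by rewrite ler_nat; exact: leq_trans hu m_le.
apply: (le_trans h); rewrite sumr_const -[leLHS]mulr_natr -/m.
have -> : m%:R * rho ^+ d * m%:R = tree_defect * rho ^+ d.+1.
  by rewrite /tree_defect -/rho [rho ^+ d.+1]exprS; field; rewrite gt_eqF.
by rewrite ler_wpM2l ?tree_defect_ge0// elev_sum_ge.
Qed.

Lemma hook_sum_ge0 d : 0 <= power_sum d off_hooks :> R.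
Proof. by apply: sumr_ge0 => k _; rewrite exprn_ge0. Qed.

Lemma gap_hook_dist d :
  `|power_sum d.+1 gaps - power_sum d.+1 off_hooks - elev_sum d.+1| <=
  (d.+1 * 2 ^ d).+1%:R * tree_defect * elev_sum d.+1.
Proof.
have h1 := gap_sum_ge d.+1; have h2 := gap_sum_le d.
have h3 := hook_sum_le d; have h4 := hook_sum_ge0 d.+1.
have dE : 0 <= tree_defect * elev_sum d.+1 by rewrite mulr_ge0 ?tree_defect_ge0// ltW ?elev_sum_gt0.
have K0 : 0 <= (d.+1 * 2 ^ d)%:R * (tree_defect * elev_sum d.+1) by rewrite mulr_ge0.
rewrite -[_ * tree_defect * _]mulrA -natr1 mulrDl mul1r; move: h2; rewrite -[_ * tree_defect * _]mulrA => h2.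
by rewrite ler_norml; apply/andP; split; lra.
Qed.

Let elevE k : @elevations R _ _ C k = (e k)%:R. Proof. by []. Qed.

Let elev_ge0 k : 0 <= @elevations R _ _ C k. Proof. by rewrite elevE. Qed.

Let elev_fin k : (m <= k)%N -> @elevations R _ _ C k = 0.
Proof. by move=> mk; rewrite elevE e_fin. Qed.

Lemma lp_norm2_elevations : fine (lp_norm 2 (@elevations R _ _ C)) = Num.sqrt (elev_sum 2).
Proof.
rewrite -[RHS]ger0_norm ?sqrtr_ge0// -sqrtr_sqr sqr_sqrtr ?(ltW (elev_sum_gt0 _))//.
rewrite /elev_sum -(lp_norm_finiteX elev_ge0 elev_fin)// sqrtr_sqr ger0_norm//.
exact: lp_norm_finite_ge0.
Qed.

Lemma normalized_elevationsE k : @normalized_elevations R _ _ C k =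
  Num.sqrt 12 * (e k)%:R / Num.sqrt (elev_sum 2).
Proof. by rewrite /normalized_elevations lp_norm2_elevations. Qed.

Lemma normalized_elevations0 :
  @normalized_elevations R _ _ C 0 = Num.sqrt 12 * (r.-1)%:R / Num.sqrt (elev_sum 2).
Proof. by rewrite normalized_elevationsE e0E. Qed.

Lemma normalized_elevations_ge0 k : 0 <= @normalized_elevations R _ _ C k.
Proof. by rewrite normalized_elevationsE divr_ge0 ?mulr_ge0 ?sqrtr_ge0. Qed.

Lemma normalized_elevations_fin k : (m <= k)%N -> @normalized_elevations R _ _ C k = 0.
Proof. by move=> mk; rewrite normalized_elevationsE e_fin// mulr0 mul0r. Qed.

Lemma normalized_elevations_sq k :
  @normalized_elevations R _ _ C k ^+ 2 = 12 * (e k)%:R ^+ 2 / elev_sum 2.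
Proof.
by rewrite normalized_elevationsE expr_div_n exprMn !sqr_sqrtr// ltW// elev_sum_gt0.
Qed.

Lemma normalized_elevations_sum_sq :
  \sum_(k < m) @normalized_elevations R _ _ C k ^+ 2 = 12.
Proof.
under eq_bigr do rewrite normalized_elevations_sq.
by rewrite -mulr_suml -mulr_sumr mulfK// gt_eqF ?elev_sum_gt0.
Qed.

Lemma normalized_elevations_predust : predust (@normalized_elevations R _ _ C).
Proof.
split=> [k|k|K]; first exact: normalized_elevations_ge0.
  rewrite !normalized_elevationsE ler_wpM2r ?invr_ge0 ?sqrtr_ge0// ler_wpM2l ?sqrtr_ge0// ler_nat.
  by apply: nth_desc_le => //; exact: desc_elevations_sorted.
have mono A B : (A <= B)%N -> \sum_(k < A) @normalized_elevations R _ _ C k ^+ 2 <=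
   \sum_(k < B) @normalized_elevations R _ _ C k ^+ 2.
  move=> /subnKC <-; rewrite big_split_ord /= lerDl; apply: sumr_ge0 => i _; exact: sqr_ge0.
apply: (le_trans (mono _ _ (leq_addr m K))).
rewrite addnC big_split_ord /= normalized_elevations_sum_sq big1 ?addr0// => i _.
by rewrite normalized_elevations_fin ?leq_addr// expr0n.
Qed.

Lemma scaled_sum_sq :
  (lp_norm 2 (@scaled_elevations R _ _ C) ^+ 2)%E = (elev_sum 2 / r%:R ^+ 2)%:E.
Proof.
have s0 k : 0 <= @scaled_elevations R _ _ C k by rewrite divr_ge0.
have sf k : (m <= k)%N -> @scaled_elevations R _ _ C k = 0.
  by move=> mk; rewrite /scaled_elevations elev_fin// mul0r.
rewrite (lp_norm_finite sf)// -[LHS]/(_ * _)%E -EFinM -expr2.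
have := lp_norm_finiteX s0 sf (isT : (0 < 2)%N); rewrite (lp_norm_finite sf)//= => ->.
congr EFin; rewrite /elev_sum mulr_suml; apply: eq_bigr => k _.
by rewrite /scaled_elevations elevE expr_div_n.
Qed.

Lemma elev_sumE d : elev_sum d = \sum_(u in ~: C) (elevation C u)%:R ^+ d.
Proof.
rewrite /elev_sum -(big_mkord xpredT (fun k => (e k)%:R ^+ d)).
rewrite /off_chain -size_desc_elevations -(big_nth 0%N xpredT (fun k : nat => k%:R ^+ d)).
have ps : perm_eq (desc_elevations C) [seq elevation C u | u <- enum (~: C)] by rewrite perm_sort.
by rewrite (perm_big _ ps) /= big_map big_enum.
Qed.

Section Cumulants.
Variable j : nat.
Hypothesis j_gt0 : (0 < j)%N.

Lemma scaled_ratio :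
  (fine (lp_norm j.*2 (@scaled_elevations R _ _ C)) /
   fine (lp_norm 2 (@scaled_elevations R _ _ C))) ^+ j.*2 = elev_sum j.*2 / elev_sum 2 ^+ j.
Proof.
have s0 k : 0 <= @scaled_elevations R _ _ C k by rewrite divr_ge0.
have sf k : (m <= k)%N -> @scaled_elevations R _ _ C k = 0.
  by move=> mk; rewrite /scaled_elevations elev_fin// mul0r.
have r0 : r%:R != 0 :> R by rewrite pnatr_eq0 -lt0n (leq_trans _ (poset_rank_ge2 P_std C_chain C_max)).
have sE d : \sum_(k < m) @scaled_elevations R _ _ C k ^+ d = elev_sum d / r%:R ^+ d.
  by rewrite /elev_sum mulr_suml; apply: eq_bigr => k _; rewrite /scaled_elevations elevE expr_div_n.
rewrite expr_div_n (lp_norm_finiteX s0 sf) ?double_gt0// -[in X in _ / X]mul2n exprM.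
rewrite (lp_norm_finiteX s0 sf)// !sE expr_div_n -exprM mul2n.
have E2 : elev_sum 2 != 0 by rewrite gt_eqF ?elev_sum_gt0.
by field; rewrite !expf_neq0.
Qed.

Lemma normalized_lp :
  fine (lp_norm j.*2 (@normalized_elevations R _ _ C)) ^+ j.*2 = 12 ^+ j * elev_sum j.*2 / elev_sum 2 ^+ j.
Proof.
rewrite (lp_norm_finiteX normalized_elevations_ge0 normalized_elevations_fin) ?double_gt0//.
rewrite /elev_sum mulr_sumr mulr_suml; apply: eq_bigr => k _.
by rewrite -mul2n exprM normalized_elevations_sq expr_div_n exprMn -exprM.
Qed.

Lemma bernoulli_power : (bernoulli_number R 2 / 2) `^ (j.*2%:R / 2) = 12 ^- j.
Proof.
rewrite bernoulli2 (_ : j.*2%:R / 2 = j%:R); last by rewrite -mul2n natrM mulrAC mulfV ?mul1r.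
rewrite powR_mulrn; last by rewrite divr_ge0.
by rewrite (_ : 6^-1 / 2 = 12^-1) ?exprVn//; field.
Qed.

Lemma cumulant_limitE :
  (bernoulli_number R j.*2 / j.*2%:R) / (bernoulli_number R 2 / 2) `^ (j.*2%:R / 2) *
  (fine (lp_norm j.*2 (@scaled_elevations R _ _ C)) /
   fine (lp_norm 2 (@scaled_elevations R _ _ C))) ^+ j.*2 =
  bernoulli_number R j.*2 / j.*2%:R * (12 ^+ j * elev_sum j.*2 / elev_sum 2 ^+ j).
Proof. by rewrite bernoulli_power scaled_ratio invrK; ring. Qed.

End Cumulants.

Section Law.
Context {d : measure_display} {T : measurableType d} {Pr : probability T R}.
Variable X : {RV Pr >-> R}.
Hypothesis X_law : forall k : nat,
  Pr (X @^-1` [set k%:R]) = ((qhook R P)`_k / (qhook R P).[1])%:E.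

Let L := qhook R P.

Let Lfac : L * \prod_(h <- off_hooks) qint R h = \prod_(f <- gaps) qint R f.
Proof.
rewrite /off_hooks /gaps !big_map big_enum /= (qhook_off_chain P_std C_chain C_max).
by rewrite -(big_mkord xpredT (fun k => qint R (chain_gap C k))) /index_iota subn0.
Qed.

Let size_gh : size gaps = size off_hooks.
Proof. by rewrite !size_map size_iota -cardE. Qed.

Let hooks_gt0 : all (leq 1) off_hooks.
Proof. by apply/allP => _ /mapP[u _ ->]; exact: hook_length_gt0. Qed.

Let gaps_gt0 : all (leq 1) gaps.
Proof.
apply/allP => f /mapP[k]; rewrite mem_iota add0n /= => km ->.
by rewrite /chain_gap addn_gt0 subn_gt0 km orbT.
Qed.

Let L1 : L.[1] != 0.
Proof.
have := congr1 (horner^~ 1) Lfac; rewrite hornerM !horner_prod => h.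
apply/eqP => L0; move: h; rewrite L0 mul0r => /esym/eqP; apply/negP.
rewrite prodf_seq_neq0; apply/allP => f /(allP gaps_gt0) f0 /=.
by rewrite qint_horner1 pnatr_eq0 -lt0n.
Qed.

Lemma tree_cumulant n : cumulant X n.+2 =
  bernoulli_number R n.+2 / n.+2%:R * (power_sum n.+2 gaps - power_sum n.+2 off_hooks).
Proof. by rewrite (plaw_cumulant L1 X_law size_gh gaps_gt0 hooks_gt0 Lfac) mul0r addr0. Qed.

Let varE : plaw_var L = (power_sum 2 gaps - power_sum 2 off_hooks) / 12.
Proof.
rewrite (plaw_var_cumulant L1 X_law gaps_gt0 hooks_gt0 Lfac) tree_cumulant bernoulli2.
by field.
Qed.

Lemma tree_tight (l : R) : 0 < l -> fine (Pr [set w | l < `|standardize X w|]) <= l ^- 2.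
Proof. exact: (plaw_tight L1 X_law). Qed.

Lemma tree_std_cumulant n j : n.+2 = j.*2 -> 0 <= power_sum 2 gaps - power_sum 2 off_hooks :> R ->
  std_cumulant X n.+2 = bernoulli_number R n.+2 / n.+2%:R *
   (12 ^+ j * (power_sum n.+2 gaps - power_sum n.+2 off_hooks) /
     (power_sum 2 gaps - power_sum 2 off_hooks) ^+ j).
Proof.
move=> nj A0; rewrite /std_cumulant !tree_cumulant bernoulli2.
have -> : n.+2%:R / 2 = j%:R :> R by rewrite nj -mul2n natrM mulrAC mulfV ?mul1r.
rewrite (_ : 6^-1 / 2 = 12^-1 :> R); last by field.
rewrite powR_mulrn ?mulr_ge0// exprMn exprVn invfM invrK; ring.
Qed.

(** F, H, E are the sums of squares of gaps, off-chain hooks and elevations. The smallness of the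
    defect ensures F - H >= 9 E / 10, which keeps the variance (F - H) / 12 comparable with E /
    12. *)
Lemma tree_cf (x th : R) : 10 * tree_defect <= 1 ->
  `|\int[Pr]_w cos (x * standardize X w + th) -
    cos th * dcf (@normalized_elevations R _ _ C) x| <= 31 * x ^+ 2 * tree_defect.
Proof.
move=> d10; have d0 := tree_defect_ge0.
have cf := standardize_cf L1 X_law size_gh gaps_gt0 hooks_gt0 Lfac x th.
rewrite (dcf_finite _ normalized_elevations_fin normalized_elevations_sum_sq).
set F : R := power_sum 2 gaps; set H : R := power_sum 2 off_hooks; set E := elev_sum 2.
have E0 : 0 < E := elev_sum_gt0 2.
have FE : E <= F := gap_sum_ge 2; have FE2 : F - E <= 4 * tree_defect * E := gap_sum_le 1.
have HE : H <= tree_defect * E := hook_sum_le 1; have H0 : 0 <= H := hook_sum_ge0 2.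
have dE : 10 * (tree_defect * E) <= E by rewrite mulrA -[leRHS]mul1r ler_wpM2r// ltW.
have A9 : 9 / 10 * E <= F - H by lra.
have A0 : 0 < F - H by lra.
pose sd := Num.sqrt (plaw_var L).
have sd2 : sd ^+ 2 = (F - H) / 12 by rewrite sqr_sqrtr varE// divr_ge0// ltW.
have sd0 : sd != 0.
  apply/eqP => s0; move: sd2; rewrite s0 expr0n /= => /eqP.
  by rewrite lt_eqF ?divr_gt0.
(* Squares of arguments suffice, since sinc is compared through [sinc_lip]; this removes the square
   root in the standard deviation. *)
have argE (f : nat) : (f%:R * (x / sd) / 2) ^+ 2 = 3 * x ^+ 2 * (f%:R ^+ 2 / (F - H)).
  by rewrite !expr_div_n exprMn expr_div_n sd2; field; rewrite gt_eqF.
have x20 : 0 <= x ^+ 2 := sqr_ge0 x.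
have hb_gen (s : seq nat) : `|1 - \prod_(h <- s) sinc (h%:R * (x / sd) / 2)| <=
    3 * x ^+ 2 * (power_sum 2 s / (F - H)).
  elim: s => [|h s IH]; first by rewrite /power_sum !big_nil subrr normr0 mul0r mulr0.
  have -> : power_sum 2 (h :: s) = h%:R ^+ 2 + power_sum 2 s :> R by rewrite /power_sum big_cons.
  rewrite big_cons [(_ + power_sum 2 s) / _]mulrDl [X in _ <= X]mulrDr.
  set a := sinc _; set b := \prod_(_ <- s) _ in IH *.
  have -> : 1 - a * b = (1 - a) + a * (1 - b) by ring.
  apply: le_trans (ler_normD _ _) _; apply: lerD.
    have := sinc_lip 0 (h%:R * (x / sd) / 2); rewrite sinc0 argE expr0n /= sub0r normrN.
    rewrite [X in _ <= X -> _]ger0_norm//.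
    by apply: mulr_ge0; [exact: mulr_ge0|rewrite divr_ge0 ?sqr_ge0// ltW].
  rewrite normrM; apply: le_trans IH; apply: ler_piMl => //; exact: sinc_abs_le1.
have hb := hb_gen off_hooks; rewrite -/H in hb.
have fb : `|\prod_(f <- gaps) sinc (f%:R * (x / sd) / 2) -
    \prod_(k < m) sinc (@normalized_elevations R _ _ C k * x / 2)| <=
    3 * x ^+ 2 * ((F - E) / (F - H) + `|E / (F - H) - 1|).
  rewrite /gaps big_map.
  have -> : \prod_(k <- iota 0 m) sinc ((chain_gap C k)%:R * (x / sd) / 2) =
     \prod_(k < m) sinc ((chain_gap C k)%:R * (x / sd) / 2).
    by rewrite -(big_mkord xpredT (fun k => sinc ((chain_gap C k)%:R * (x / sd) / 2))) /index_iota subn0.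
  apply: le_trans (ler_dist_prod (a := fun k => sinc ((chain_gap C k)%:R * (x / sd) / 2))
    (b := fun k => sinc (@normalized_elevations R _ _ C k * x / 2)) _ _ _) _ => [k|k|].
  - exact: sinc_abs_le1.
  - exact: sinc_abs_le1.
  have -> : 3 * x ^+ 2 * ((F - E) / (F - H) + `|E / (F - H) - 1|) =
     \sum_(k < m) 3 * x ^+ 2 * (((chain_gap C k)%:R ^+ 2 - (e k)%:R ^+ 2) / (F - H)
        + (e k)%:R ^+ 2 * `|(F - H)^-1 - E^-1|).
    rewrite -mulr_sumr big_split /= -!mulr_suml sumrB -gap_sumE -/F -/(elev_sum 2) -/E.
    congr (_ * (_ + _)).
    have -> : E / (F - H) - 1 = E * ((F - H)^-1 - E^-1) by rewrite mulrBr mulfV// gt_eqF.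
    by rewrite normrM ger0_norm// ltW.
  apply: ler_sum => k _; apply: (le_trans (sinc_lip _ _)).
  rewrite argE expr_div_n exprMn normalized_elevations_sq -/E.
  have -> : 3 * x ^+ 2 * ((chain_gap C k)%:R ^+ 2 / (F - H)) - 12 * (e k)%:R ^+ 2 / E * x ^+ 2 / 2 ^+ 2 =
    3 * x ^+ 2 * (((chain_gap C k)%:R ^+ 2 - (e k)%:R ^+ 2) / (F - H) +
       (e k)%:R ^+ 2 * ((F - H)^-1 - E^-1)).
    by field; rewrite !gt_eqF.
  have x3 : 0 <= 3 * x ^+ 2 by exact: mulr_ge0.
  rewrite normrM [`|3 * x ^+ 2|]ger0_norm//; apply: ler_wpM2l => //.
  apply: (le_trans (ler_normD _ _)); rewrite normrM [`|(F - H)^-1|]ger0_norm ?invr_ge0 ?(ltW A0)//.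
  rewrite ger0_norm ?subr_ge0 ?lerXn2r ?nnegrE ?ler_nat//.
  by rewrite normrM [`|(e k)%:R ^+ 2|]ger0_norm ?exprn_ge0.
(* The numerators are at most 4, 4 and 1 times the defect times E, the denominator at least 9 E /
   10. Altogether 3 (40 + 40 + 10) / 9 = 30, within the constant 31. *)
have q1 : (F - E) / (F - H) <= 40 / 9 * tree_defect by rewrite ler_pdivrMr//; nra.
have q2 : `|E / (F - H) - 1| <= 40 / 9 * tree_defect.
  have -> : E / (F - H) - 1 = (E - (F - H)) / (F - H) by field; rewrite gt_eqF.
  rewrite normrM [`|(F - H)^-1|]ger0_norm ?invr_ge0 ?(ltW A0)// ler_pdivrMr//.
  by rewrite ler_norml; apply/andP; split; nra.
have q3 : H / (F - H) <= 10 / 9 * tree_defect by rewrite ler_pdivrMr//; nra.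
move: cf; rewrite -/sd.
set phi := \int[Pr]_w _; set ph := \prod_(h <- off_hooks) _ in hb *.
set pf := \prod_(f <- gaps) _ in fb *; set pe := \prod_(k < m) _ in fb *.
move=> cf.
have phi1 : `|phi| <= 1.
  have bc : bmeas (fun w => cos (x * standardize X w + th)).
    split; last by exists 1 => w; exact: cos_max.
    by apply: (@measurableT_comp _ _ _ _ _ _ (fun y : measurableTypeR R => cos (x * y + th)));
      [case: (bmeas_cos x th)|exact: (measurable_funPT (toRR (standardize X)))].
  rewrite ler_norml -[X in X <= _](Rintegral_prob_cst Pr) -[X in _ && (_ <= X)](Rintegral_prob_cst Pr).
  apply/andP; split; apply: le_Rintegral => //;
    try (by apply: bmeas_integrable => //; exact: bmeas_cst);
    by move=> w _; have := cos_max (x * standardize X w + th); rewrite ler_norml => /andP[].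
have c1 : `|cos th| <= 1 := cos_max th.
(* Rewriting with phi ph = cos th pf avoids dividing by the product over the hooks. *)
have -> : phi - cos th * pe = phi * (1 - ph) + cos th * (pf - pe) by rewrite mulrBr mulrBr cf mulr1; ring.
apply: (le_trans (ler_normD _ _)); rewrite !normrM.
have n1 : `|phi| * `|1 - ph| <= `|1 - ph| by exact: ler_piMl.
have n2 : `|cos th| * `|pf - pe| <= `|pf - pe| by exact: ler_piMl.
have : 3 * x ^+ 2 * (H / (F - H)) <= 3 * x ^+ 2 * (10 / 9 * tree_defect) by rewrite ler_wpM2l// mulr_ge0.
have : 3 * x ^+ 2 * ((F - E) / (F - H) + `|E / (F - H) - 1|) <= 3 * x ^+ 2 * (40 / 9 * tree_defect + 40 / 9 * tree_defect).
  by apply: ler_wpM2l; [exact: mulr_ge0|exact: lerD].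
have : 0 <= x ^+ 2 * tree_defect by rewrite mulr_ge0.
lra.
Qed.

End Law.
End OneTree.

(** A cluster point exists by compactness of the segment, and an ultrafilter converges to each of
    its cluster points. *)
Lemma ultra_bounded_cvg {R : realType} {I : Type} (G : set_system I) (u : I -> R) (a b : R) :
  UltraFilter G -> (forall i, a <= u i <= b) -> exists l : R, u i @[i --> G] --> l.
Proof.
move=> UG uab; have PG := @ultra_proper _ _ UG.
have [l [_ cl]] : `[a, b] `&` cluster (u i @[i --> G]) !=set0.
  apply: segment_compact; rewrite /fmap /=; apply: filterS filterT => i _ /=.
  by rewrite in_itv /= uab.
exists l => A Al; have [//|h] := in_ultra_setVsetC (u @^-1` A) UG.
by have [x [/= nA xA]] := cl (~` A) A h Al.
Qed.

(** Plays the role of extraction of subsequences: if some neighbourhood of l fails, [\oo] restricted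
    to the failing indices extends to an ultrafilter that contradicts the hypothesis. *)
Lemma cvg_of_ultra {R : realType} (u : nat -> R) (l : R) :
  (forall G : set_system nat, UltraFilter G -> \oo `<=` G -> u i @[i --> G] --> l) ->
  u i @[i --> \oo] --> l.
Proof.
move=> h A Al; apply: contrapT => nA.
have PF : ProperFilter (within (~` (u @^-1` A)) \oo).
  apply: Build_ProperFilter => w0; apply: nA.
  apply: (@filterS _ \oo _ (fun i => (~` (u @^-1` A)) i -> set0 i)) w0 => i h0.
  by apply: contrapT => /h0.
have [G [UG FG]] := ultraFilterLemma PF.
have PG := @ultra_proper _ _ UG.
have G1 : G (~` (u @^-1` A)) by apply: FG; apply: nearW.
have sub : \oo `<=` G by move=> B oB; apply: FG; apply: filterS oB.
have G2 : G (u @^-1` A) := h G UG sub A Al.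
by have [i [? ?]] := @filter_ex _ G PG _ (filterI G1 G2).
Qed.

Lemma dcf_zero {R : realType} (x : R) : dcf (fun=> 0) x = expR (- (x ^+ 2 / 2)).
Proof.
apply/cvg_lim => //; apply: cvg_near_cst; apply: nearW => K.
rewrite /dcf_trunc !big1 => [|k _|k _]; last 2 first.
- by rewrite expr0n.
- by rewrite !mul0r sinc0.
by rewrite mul0r subr0 !mul1r.
Qed.

(** * Sequences of trees with n - r = o(n^(1/2)) *)

Section Sequence.
Context (R : realType) (disp : nat -> Order.disp_t) (P : forall N : nat, finPOrderType (disp N))
  (C : forall N : nat, {set P N})
  (dd : nat -> measure_display) (Om : forall N : nat, measurableType (dd N))
  (Pr : forall N : nat, probability (Om N) R)
  (X : forall N : nat, {RV Pr N >-> R}).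
Hypothesis P_std : forall N : nat, standardized_tree (P N).
Hypothesis C_chain : forall N : nat, is_chain (C N).
Hypothesis C_max : forall N : nat, #|C N| = poset_rank (P N).
Hypothesis X_law : forall N k : nat,
    Pr N (X N @^-1` [set k%:R]) = ((qhook R (P N))`_k / (qhook R (P N)).[1])%:E.
Hypothesis n_infty : (fun N : nat => #|P N|) @ \oo --> \oo.
Hypothesis n_sub_r : (fun N : nat => (#|P N| - poset_rank (P N))%:R : R) =o_\oo
             (fun N : nat => Num.sqrt (#|P N|%:R : R)).

Local Notation RR := (measurableTypeR R).
Let nu N : probability RR R := law (standardize (X N)).
Let eh N : nat -> R := @normalized_elevations R _ _ (C N).
Let dl N : R := @tree_defect R _ _ (C N).

Let eh_predust N : predust (eh N).
Proof. exact: normalized_elevations_predust. Qed.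

Let off_chainE N : (#|P N| - poset_rank (P N))%N = off_chain (C N).
Proof. by rewrite -C_max -(cardsC (C N)) addKn. Qed.

Let defect_near (ep : R) : 0 < ep -> ep <= 2^-1 ->
  \forall N \near \oo, (off_chain (C N) <= (poset_rank (P N)).-1)%N /\ dl N <= 2 * ep ^+ 2.
Proof.
move=> ep0 ep1; have /eqoP/(_ ep ep0) h := n_sub_r.
have n16 : \forall N \near \oo, (16 <= #|P N|)%N by apply: (@n_infty [set n | (16 <= n)%N]); exact: nbhs_infty_ge.
near=> N.
have n16N : (16 <= #|P N|)%N by near: N; exact: n16.
have : `|(#|P N| - poset_rank (P N))%:R : R| <= ep * `|Num.sqrt (#|P N|%:R : R)| by near: N; exact: h.
rewrite off_chainE ger0_norm// ger0_norm ?sqrtr_ge0//.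
have r2 := poset_rank_ge2 (P_std N) (C_chain N) (C_max N).
have nE : #|P N| = (poset_rank (P N) + off_chain (C N))%N by rewrite -C_max -(cardsC (C N)).
set m := off_chain (C N); set r := poset_rank (P N) in r2 nE *.
set s := Num.sqrt _ => ms.
have s2 : s ^+ 2 = r%:R + m%:R by rewrite sqr_sqrtr// nE natrD.
(* With s = sqrt n >= 4 and m <= s / 2, r - 1 = s^2 - m - 1 >= s^2 / 2. Then m <= ep s gives m^2 /
   (r - 1) <= 2 ep^2. *)
have s4 : 4 <= s.
  rewrite -(@ler_sqr R) ?nnegrE ?sqrtr_ge0// s2 -natrD -nE.
  by rewrite -natrX ler_nat.
have r1 : (r.-1)%:R = r%:R - 1 :> R by rewrite -subn1 natrB//; lia.
have m0 : 0 <= m%:R :> R by [].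
have ms2 : m%:R <= 2^-1 * s by apply: (le_trans ms); rewrite ler_wpM2r// sqrtr_ge0.
have rs : s ^+ 2 / 2 <= (r.-1)%:R by rewrite r1; nra.
have rp : 0 < (r.-1)%:R :> R by apply: lt_le_trans rs; nra.
split.
  by rewrite -(ler_nat R); apply: le_trans rs; nra.
rewrite /dl /tree_defect -/m -/r ler_pdivrMr//.
have : m%:R ^+ 2 <= (ep * s) ^+ 2 by rewrite ler_sqr ?nnegrE// mulr_ge0 ?sqrtr_ge0// ltW.
rewrite exprMn => h2; apply: (le_trans h2).
have e2 : 0 <= ep ^+ 2 := sqr_ge0 ep.
by have := ler_wpM2l e2 rs; lra.
Unshelve. all: by end_near. Qed.

Let off_chain_near : \forall N \near \oo, (off_chain (C N) <= (poset_rank (P N)).-1)%N.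
Proof.
have h2 : 0 < (2^-1 : R) by [].
by apply: filterS (defect_near h2 (lexx _)) => N [].
Qed.

Let dl_ge0 N : 0 <= dl N. Proof. exact: tree_defect_ge0. Qed.

Let defect_cvg : dl N @[N --> \oo] --> 0.
Proof.
apply/cvgrPdist_le => e e0.
pose ep := Num.min (2^-1 : R) (e / 2).
have ep0 : 0 < ep by rewrite lt_min; apply/andP; split => //; rewrite divr_gt0.
have ep1 : ep <= 2^-1 by rewrite ge_min lexx.
have ep2 : ep <= e / 2 by rewrite ge_min lexx orbT.
apply: filterS (defect_near ep0 ep1) => N [_ h].
rewrite sub0r normrN ger0_norm//; apply: (le_trans h); nra.
Qed.

Section Filter.
Variables (G : set_system nat).
Hypothesis PG : ProperFilter G.
Hypothesis subG : \oo `<=` G.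
Variable t : nat -> R.
Hypothesis eh_cvg : forall k, eh N k @[N --> G] --> t k.

Let cf_cvg (x th : R) :
  \int[Pr N]_w cos (x * standardize (X N) w + th) @[N --> G] --> cos th * dcf t x.
Proof.
have c1 : cos th * dcf (eh N) x @[N --> G] --> cos th * dcf t x.
  by apply: cvgM; [exact: cvg_cst|exact: cvg_dcf_seq].
have c2 : 31 * x ^+ 2 * dl N @[N --> G] --> 0.
  have h : 31 * x ^+ 2 * dl N @[N --> \oo] --> 31 * x ^+ 2 * 0.
    by apply: cvgM; [exact: cvg_cst|exact: defect_cvg].
  by rewrite mulr0 in h => A /h; exact: subG.
have d10 : \forall N \near \oo, 10 * dl N <= 1.
  have /cvgrPdist_le/(_ 10^-1) h := defect_cvg.
  have p10 : 0 < (10^-1 : R) by [].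
  apply: filterS (h p10) => N; rewrite sub0r normrN ger0_norm//; lra.
apply/cvgrPdist_le => e e0; have e2 : 0 < e / 2 by rewrite divr_gt0.
have /cvgrPdist_le/(_ _ e2) n1 := c1; have /cvgrPdist_le/(_ _ e2) n2 := c2.
have n3 : \forall N \near G, (off_chain (C N) <= (poset_rank (P N)).-1)%N /\ 10 * dl N <= 1.
  by apply: subG; apply: filterS2 off_chain_near d10.
near=> N.
have [mN dN] : (off_chain (C N) <= (poset_rank (P N)).-1)%N /\ 10 * dl N <= 1 by near: N; exact: n3.
have h1 : `|cos th * dcf t x - cos th * dcf (eh N) x| <= e / 2 by near: N; exact: n1.
have h2 : `|0 - 31 * x ^+ 2 * dl N| <= e / 2 by near: N; exact: n2.
have h3 := tree_cf (P_std N) (C_chain N) (C_max N) mN (X_law N) x th dN.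
have h4 : 31 * x ^+ 2 * dl N <= e / 2 by apply: le_trans h2; rewrite sub0r normrN ler_norm.
apply: le_trans (ler_distD (cos th * dcf (eh N) x) _ _) _.
rewrite [X in _ + X]distrC; have := le_trans h3 h4; move: h1; lra.
Unshelve. all: by end_near. Qed.

Let law_cosE N (x th : R) :
  \int[nu N]_y cos (x * y + th) = \int[Pr N]_w cos (x * standardize (X N) w + th).
Proof. by rewrite (@law_Rintegral _ _ _ _ (standardize (X N)))//; exact: bmeas_cos. Qed.

(** Stated along any proper filter finer than [\oo], to be used both with [\oo] and with
    ultrafilters. The sine integrals are the case of phase -pi/2. *)
Lemma tree_weak_cvg (mu : probability RR R) : has_cf mu (dcf t) ->
  forall a : R, {for a, continuous (fun y : R => mu `]-oo, y])} ->
  cdf (standardize (X N)) a @[N --> G] --> mu `]-oo, a].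
Proof.
move=> mucf; apply: (@Levy_continuity R nat G PG nu mu).
- move=> x; have cosE : (fun y : RR => cos (x * y)) = (fun y => cos (x * y + 0)).
    by apply/funext => y; rewrite addr0.
  rewrite cosE mucf; under eq_fun do rewrite law_cosE.
  exact: cf_cvg.
- move=> x; have sinE : (fun y : RR => sin (x * y)) = (fun y => cos (x * y + - (pi / 2))).
    by apply/funext => y; rewrite cosD cosN sinN cos_pihalf sin_pihalf; ring.
  rewrite sinE mucf; under eq_fun do rewrite law_cosE.
  exact: cf_cvg.
(* Chebyshev's bound 1 / L^2 equals eps here, for all N at once. *)
- move=> eps eps0; exists (Num.sqrt eps^-1); first by rewrite sqrtr_gt0 invr_gt0.
  move=> N; have h := tree_tight (P_std N) (C_chain N) (C_max N) (X_law N).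
  have s0 : 0 < Num.sqrt eps^-1 by rewrite sqrtr_gt0 invr_gt0.
  have nuE : has_law (standardize (X N)) (nu N) by [].
  rewrite -nuE; last exact: measurable_far.
  apply: (@le_trans _ _ (Num.sqrt eps^-1 ^- 2)); first exact: (h _ s0).
  by rewrite sqr_sqrtr ?invrK// invr_ge0 ltW.
Qed.

End Filter.

Let weak_limit_eq (mu mu' : probability RR R) (G : set_system nat) :
  ProperFilter G -> \oo `<=` G ->
  cvg_in_distribution (fun N => standardize (X N)) mu ->
  (forall a : R, {for a, continuous (fun y : R => mu' `]-oo, y])} ->
    cdf (standardize (X N)) a @[N --> G] --> mu' `]-oo, a]) ->
  forall A, measurable A -> mu A = mu' A.
Proof.
move=> PG sub h1 h2; apply: (@weak_limit_unique R nat G PG (fun N a => cdf (standardize (X N)) a)) => //.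
by move=> x cx A /(h1 x cx); exact: sub.
Qed.

Let cf_ext (mu mu' : probability RR R) phi : (forall A, measurable A -> mu A = mu' A) ->
  has_cf mu' phi -> has_cf mu phi.
Proof.
move=> e h x th; rewrite -h /Rintegral; congr fine.
by apply: eq_measure_integral => A mA _; exact: e.
Qed.

Let has_cf_inj (mu : probability RR R) t t' : predust t -> predust t' ->
  has_cf mu (dcf t) -> has_cf mu (dcf t') -> t = t'.
Proof.
move=> pt pt' h h'; apply: dcf_inj => //; apply/funext => x.
by have := h x 0; rewrite (h' x 0) cos0 !mul1r.
Qed.

(** The coordinates are bounded by sqrt 12, so they all converge along G. The law built from the
    limit t is then a weak limit along G, hence equals [mu]. *)
Let ultra_limit (mu : probability RR R) (G : set_system nat) :
  UltraFilter G -> \oo `<=` G ->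
  cvg_in_distribution (fun N => standardize (X N)) mu ->
  exists t, [/\ predust t, forall k, eh N k @[N --> G] --> t k & has_cf mu (dcf t)].
Proof.
move=> UG sub hmu; have PG := @ultra_proper _ _ UG.
have bnd k N : 0 <= eh N k <= Num.sqrt 12.
  have [e0 _ e12] := eh_predust N; rewrite e0 /=.
  rewrite -[leLHS]ger0_norm// -sqrtr_sqr ler_wsqrtr//; apply: le_trans (e12 k.+1).
  by rewrite big_ord_recr lerDr sumr_ge0// => i _; exact: sqr_ge0.
have [t tl] := choice (fun k => ultra_bounded_cvg UG (bnd k)).
have pt : predust t by exact: (predust_lim eh_predust tl).
exists t; split => //.
have [mu' law'] := dustpan_law_exists (predust_dustpan pt).
have cf' := dustpan_law_cf (predust_dustpan pt) law'.
apply: (cf_ext _ cf'); apply: (@weak_limit_eq _ _ G) => //.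
exact: (@tree_weak_cvg G PG sub t tl mu' cf').
Qed.

(** Every ultrafilter finer than [\oo] yields a limit t whose characteristic function is that of
    [mu]; injectivity makes t the same for all of them, so the convergence holds along [\oo]. *)
Lemma tree_cvg_elevations (mu : probability RR R) :
  cvg_in_distribution (fun N => standardize (X N)) mu ->
  exists t : nat -> R, [/\ predust t,
    forall k, normalized_elevations (C N) k @[N --> \oo] --> t k & has_cf mu (dcf t)].
Proof.
move=> hmu; have [G0 [UG0 sub0]] := @ultraFilterLemma _ \oo _.
have [t [pt _ mut]] := ultra_limit UG0 sub0 hmu.
exists t; split => // k; apply: cvg_of_ultra => G UG sub.
have [t' [pt' t'l mut']] := ultra_limit UG sub hmu.
by rewrite (has_cf_inj pt pt' mut mut'); exact: t'l.
Qed.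

(** For the direct implication, [mu] coincides with one constructed dustpan law, whose probability
    space and variables then serve as witnesses. *)
Lemma tree_cvg_law t (mu : probability RR R) : dustpan t ->
  (forall k, normalized_elevations (C N) k @[N --> \oo] --> t k) ->
  cvg_in_distribution (fun N => standardize (X N)) mu <-> dustpan_law t mu.
Proof.
move=> dt tl; split; last first.
  by move=> /(dustpan_law_cf dt) cf x cx; exact: (@tree_weak_cvg \oo _ (@subset_refl _ _) t tl mu cf).
move=> hmu; have [mu' law'] := dustpan_law_exists dt.
have e := @weak_limit_eq mu mu' \oo _ (@subset_refl _ _) hmu
  (@tree_weak_cvg \oo _ (@subset_refl _ _) t tl mu' (dustpan_law_cf dt law')).
have [d [T [Q [U [S [Z [h1 h2 h3 h4 h5]]]]]]] := law'.
exists d, T, Q, U, S, Z; split => // A mA; rewrite h5//; exact/esym/e.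
Qed.

Lemma tree_cvg_iff :
  (exists mu : probability RR R, cvg_in_distribution (fun N => standardize (X N)) mu) <->
  (exists t : nat -> R, dustpan t /\
     forall k : nat, (fun N : nat => normalized_elevations (C N) k) @ \oo --> t k).
Proof.
split=> [[mu /tree_cvg_elevations[t [pt tl _]]]|[t [dt tl]]].
  by exists t; split => //; exact: predust_dustpan.
by have [mu law'] := dustpan_law_exists dt; exists mu; apply/(tree_cvg_law mu dt tl).
Qed.

Let E2 N : R := elev_sum (C N) 2.

Let E2_gt0 N : 0 < E2 N. Proof. exact: elev_sum_gt0. Qed.

Let eh0_sq N : eh N 0 ^+ 2 = 12 * ((poset_rank (P N)).-1)%:R ^+ 2 / E2 N.
Proof.
by rewrite /eh normalized_elevations0// expr_div_n exprMn !sqr_sqrtr// ltW// E2_gt0.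
Qed.

Let has_cf_std_normal : has_cf (normal_prob (0 : R) 1) (dcf (fun=> 0)).
Proof.
have := @has_cf_normal R 1 (oner_neq0 _); rewrite (_ : (fun x : R => _) = dcf (fun=> 0))//.
by apply/funext => x; rewrite dcf_zero expr1n mul1r.
Qed.

(** The largest normalized elevation has square 12 (r - 1)^2 / |e|_2^2, which tends to 0 exactly
    when |e/r|_2 tends to infinity, as (r - 1) / r lies between 1/2 and 1. It dominates the other
    coordinates. *)
Lemma tree_asymptotically_normal : asymptotically_normal X <->
  (fun N : nat => (lp_norm 2 (@scaled_elevations R _ _ (C N)) ^+ 2)%E) @ \oo --> +oo%E.
Proof.
have rk N : 1 <= (poset_rank (P N)).-1%:R :> R /\ (poset_rank (P N))%:R = (poset_rank (P N)).-1%:R + 1 :> R.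
  have r2 := poset_rank_ge2 (P_std N) (C_chain N) (C_max N).
  by split; [rewrite (ler_nat R 1); lia|rewrite natr1 prednK//; lia].
have p0 : predust (fun=> 0 : R).
  by split => // K; rewrite big1 // => k _; rewrite expr0n.
split.
  move=> /tree_cvg_elevations[t [pt tl cft]].
  have t0 : t = (fun=> 0) by exact: has_cf_inj pt p0 cft has_cf_std_normal.
  have c0 : eh N 0 @[N --> \oo] --> 0 by have := tl 0%N; rewrite t0.
  apply/cvgeyPge => A; pose B := Num.max A 1.
  have B0 : 0 < B by rewrite lt_max ltr01 orbT.
  (* With q = r - 1 and E = |e|_2^2: 12 q^2 <= ep^2 E gives 4 q^2 B <= E, and r^2 <= 4 q^2 since q
     >= 1. *)
  have [ep ep0 epB] : exists2 ep : R, 0 < ep & ep ^+ 2 * B <= 3.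
    exists (Num.sqrt B^-1); first by rewrite sqrtr_gt0 invr_gt0.
    by rewrite sqr_sqrtr ?invr_ge0 ?(ltW B0)// mulVf ?gt_eqF//; lra.
  have /cvgrPdist_le/(_ ep ep0) n1 := c0.
  apply: filterS n1 => N; rewrite sub0r normrN => h.
  rewrite scaled_sum_sq lee_fin; apply: (@le_trans _ _ B); first by rewrite le_max lexx.
  have [r1 rE] := rk N; rewrite -/(E2 N) rE; set q := _.-1%:R in r1 *.
  have h2 : eh N 0 ^+ 2 <= ep ^+ 2 by rewrite -(real_normK (num_real (eh N 0))) ler_sqr ?nnegrE// ltW.
  have := E2_gt0 N; move: h2; rewrite eh0_sq -/q; move: (E2 N) => E h2 E0.
  have q0 : 0 < q ^+ 2 by nra.
  have h3 : 12 * q ^+ 2 <= ep ^+ 2 * E by move: h2; rewrite ler_pdivrMr.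
  rewrite ler_pdivlMr; last by nra.
  have h4 : (q + 1) ^+ 2 <= 4 * q ^+ 2 by nra.
  have h5 : 12 * q ^+ 2 * B <= 3 * E by nra.
  apply: (@le_trans _ _ (B * (4 * q ^+ 2))); first by rewrite ler_pM2l.
  lra.
move=> /cvgeyPge cy.
have tl k : eh N k @[N --> \oo] --> 0.
  apply/cvgrPdist_le => e e0.
  have := cy (12 / e ^+ 2); apply: filterS => N; rewrite scaled_sum_sq lee_fin.
  have [r1 rE] := rk N; rewrite -/(E2 N) rE; set q := _.-1%:R in r1 *.
  have e20 : 0 < e ^+ 2 by rewrite exprn_gt0.
  rewrite ler_pdivlMr; last by nra.
  rewrite mulrAC ler_pdivrMr// => h.
  have [eh0 _ _] := eh_predust N.
  rewrite sub0r normrN ger0_norm//; apply: le_trans (predust_nonincr (eh_predust N) (leq0n k)) _.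
  rewrite -(@ler_sqr R) ?nnegrE//; last exact: ltW.
  by rewrite eh0_sq -/q ler_pdivrMr// mulrC; nra.
exact: (@tree_weak_cvg \oo _ (@subset_refl _ _) (fun=> 0) tl _ has_cf_std_normal).
Qed.

Lemma tree_cumulant_equiv (d : nat) : ~~ odd d -> (2 <= d)%N ->
  (fun N : nat => std_cumulant (X N) d) ~_\oo
    (fun N : nat =>
           (bernoulli_number R d / d%:R)
             / (bernoulli_number R 2 / 2) `^ (d%:R / 2)
           * (fine (lp_norm d (scaled_elevations (C N)))
                / fine (lp_norm 2 (scaled_elevations (C N)))) ^+ d).
Proof.
move=> dodd d2.
have [j j0 dj] : exists2 j, (0 < j)%N & d = j.*2.
  exists d./2; first by rewrite half_gt0.
  by rewrite -[LHS]odd_double_half (negbTE dodd).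
have [n dn] : exists n, d = n.+2 by exists d.-2; lia.
pose A p N : R := power_sum p (gaps (C N)) - power_sum p (off_hooks (C N)).
pose E p N : R := elev_sum (C N) p.
have E0 p N : 0 < E p N by exact: elev_sum_gt0.
have ratio p : A p.+1 N / E p.+1 N @[N --> \oo] --> (1 : R).
  apply/cvgrPdist_le => e e0.
  pose K : R := (p.+1 * 2 ^ p).+1%:R.
  have K0 : 0 < K by rewrite ltr0n.
  have eK : 0 < e / K by rewrite divr_gt0.
  have /cvgrPdist_le/(_ _ eK) n1 := defect_cvg.
  near=> N.
  have mN : (off_chain (C N) <= (poset_rank (P N)).-1)%N by near: N; exact: off_chain_near.
  have : `|0 - dl N| <= e / K by near: N; exact: n1.
  rewrite sub0r normrN ger0_norm// ler_pdivlMr// => dK.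
  have := @gap_hook_dist R _ _ _ (P_std N) (C_chain N) (C_max N) mN p.
  rewrite -/(A p.+1 N) -/(E p.+1 N) -/K -/(dl N) => h.
  have -> : 1 - A p.+1 N / E p.+1 N = - ((A p.+1 N - E p.+1 N) / E p.+1 N).
    by field; rewrite gt_eqF.
  rewrite normrN normrM [`|(E p.+1 N)^-1|]ger0_norm ?invr_ge0 ?(ltW (E0 _ _))// ler_pdivrMr//.
  by apply: (le_trans h); rewrite ler_wpM2r ?(ltW (E0 _ _))// mulrC.
(* The factor relating the two sequences: their difference is q - 1 times the comparison sequence,
   so it suffices that q tends to 1. *)
pose q N : R := (A d N / E d N) * ((A 2 N / E 2 N) ^+ j)^-1.
have q1 : q N @[N --> \oo] --> (1 : R).
  rewrite -[X in _ --> X](mulr1 1); apply: cvgM; first by rewrite dn; exact: ratio.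
  rewrite -[X in _ --> X]invr1; apply: cvgV; first exact: oner_neq0.
  have h : (fun z : R => z ^+ j) @ (1 : R) --> (1 : R).
    by rewrite -[X in _ --> X](expr1n _ j); exact: exprn_continuous.
  by apply: (@cvg_comp _ _ _ (fun N => A 2 N / E 2 N) (fun z : R => z ^+ j) _ _ _ _ h); exact: ratio.
apply/eqaddoP => ep ep0.
have /cvgrPdist_le/(_ _ ep0) n1 := q1.
have A2 : \forall N \near \oo, 0 < A 2 N.
  have /cvgrPdist_lt/(_ 1 ltr01) n2 := ratio 1%N.
  apply: filterS n2 => N h.
  have h' : 0 < A 2 N / E 2 N by move: h; rewrite ltr_norml; lra.
  by move: h'; rewrite pmulr_lgt0// invr_gt0.
near=> N.
have mN : (off_chain (C N) <= (poset_rank (P N)).-1)%N by near: N; exact: off_chain_near.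
have A2N : 0 < A 2 N by near: N; exact: A2.
have hq : `|1 - q N| <= ep by near: N; exact: n1.
have fE : std_cumulant (X N) d = bernoulli_number R d / d%:R * (12 ^+ j * A d N / A 2 N ^+ j).
  have := @tree_std_cumulant R _ _ _ (P_std N) (C_chain N) (C_max N) _ _ _ (X N) (X_law N) n j.
  by rewrite -dn; apply => //; exact: ltW.
have gE := @cumulant_limitE R _ _ _ (P_std N) (C_chain N) (C_max N) j j0.
rewrite -dj -/(E d N) -/(E 2 N) in gE.
rewrite [X in `|X|]/= !fctE fE gE.
have -> : bernoulli_number R d / d%:R * (12 ^+ j * A d N / A 2 N ^+ j) -
   bernoulli_number R d / d%:R * (12 ^+ j * E d N / E 2 N ^+ j) =
   - (1 - q N) * (bernoulli_number R d / d%:R * (12 ^+ j * E d N / E 2 N ^+ j)).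
  rewrite /q exprMn exprVn; field.
  by rewrite !expf_neq0 ?gt_eqF// ltr0n; lia.
by rewrite normrM normrN ler_wpM2r.
Unshelve. all: by end_near. Qed.

Lemma tree_cumulant_limit (d : nat) N : ~~ odd d -> (2 <= d)%N ->
  (bernoulli_number R d / d%:R) / (bernoulli_number R 2 / 2) `^ (d%:R / 2)
   * (fine (lp_norm d (scaled_elevations (C N)))
        / fine (lp_norm 2 (scaled_elevations (C N)))) ^+ d
  = bernoulli_number R d / d%:R * fine (lp_norm d (normalized_elevations (C N))) ^+ d.
Proof.
move=> dodd d2.
have [j j0 ->] : exists2 j, (0 < j)%N & d = j.*2.
  exists d./2; first by rewrite half_gt0.
  by rewrite -[LHS]odd_double_half (negbTE dodd).
by rewrite cumulant_limitE// normalized_lp.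
Qed.

End Sequence.

Theorem theorem5p12 (R : realType)
  (disp : nat -> Order.disp_t) (P : forall N : nat, finPOrderType (disp N))
  (C : forall N : nat, {set P N})
  (dd : nat -> measure_display) (Om : forall N : nat, measurableType (dd N))
  (Pr : forall N : nat, probability (Om N) R)
  (X : forall N : nat, {RV Pr N >-> R})
  (P_std : forall N : nat, standardized_tree (P N))
  (C_chain : forall N : nat, is_chain (C N))
  (C_max : forall N : nat, #|C N| = poset_rank (P N))
  (X_law : forall N k : nat,
    Pr N (X N @^-1` [set k%:R]) =
    ((qhook R (P N))`_k / (qhook R (P N)).[1])%:E)
  (n_infty : (fun N : nat => #|P N|) @ \oo --> \oo)
  (n_sub_r : (fun N : nat => (#|P N| - poset_rank (P N))%:R : R) =o_\oo
             (fun N : nat => Num.sqrt (#|P N|%:R : R))) :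
  [/\ forall d : nat, ~~ odd d -> (2 <= d)%N ->
        (fun N : nat => std_cumulant (X N) d) ~_\oo
        (fun N : nat =>
           (bernoulli_number R d / d%:R)
             / (bernoulli_number R 2 / 2) `^ (d%:R / 2)
           * (fine (lp_norm d (scaled_elevations (C N)))
                / fine (lp_norm 2 (scaled_elevations (C N)))) ^+ d)
        /\
        forall N : nat,
          (bernoulli_number R d / d%:R)
            / (bernoulli_number R 2 / 2) `^ (d%:R / 2)
          * (fine (lp_norm d (scaled_elevations (C N)))
               / fine (lp_norm 2 (scaled_elevations (C N)))) ^+ d
          = bernoulli_number R d / d%:R
            * fine (lp_norm d (normalized_elevations (C N))) ^+ d,
      (exists mu : probability (measurableTypeR R) R,
         cvg_in_distribution (fun N => standardize (X N)) mu) <->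
      (exists t : nat -> R, dustpan t /\
         forall k : nat,
           (fun N : nat => normalized_elevations (C N) k) @ \oo --> t k),
      forall t : nat -> R, dustpan t ->
        (forall k : nat,
           (fun N : nat => normalized_elevations (C N) k) @ \oo --> t k) ->
        forall mu : probability (measurableTypeR R) R,
          cvg_in_distribution (fun N => standardize (X N)) mu <->
          dustpan_law t mu,
      asymptotically_normal X <->
      (fun N : nat => (lp_norm 2 (@scaled_elevations R _ _ (C N)) ^+ 2)%E)
        @ \oo --> +oo%E &
      forall N : nat,
        (lp_norm 2 (scaled_elevations (C N)) ^+ 2)%E =
        (\sum_(u in ~: C N)
           ((elevation (C N) u)%:R / (poset_rank (P N))%:R : R) ^+ 2)%:E].
Proof.
split.
- move=> d dodd d2; split; last by move=> N; exact: tree_cumulant_limit.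
  exact: tree_cumulant_equiv.
- exact: tree_cvg_iff.
- by move=> t dt tl mu; exact: tree_cvg_law.
- exact: tree_asymptotically_normal.
- move=> N; rewrite scaled_sum_sq elev_sumE mulr_suml; congr EFin.
  by apply: eq_bigr => u _; rewrite expr_div_n.
Qed.
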